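(* Let $d\ge1$, let $u_0\in L^\infty(\mathbb{T}^d)$ be positive (with $\operatorname{ess\,inf}u_0>0$), and let $u\in L^\infty(\mathbb{T}^d\times[0,\infty))$ be a weak solution to $$u_t - u\,|\nabla| u + |\nabla|(u^2) = 0$$ with initial condition $u_0$, having the properties (P) listed in the context. Let $m(t)=\min_{x\in\mathbb{T}^d}u(x,t)$, $M(t)=\max_{x\in\mathbb{T}^d}u(x,t)$ and $A(t)=M(t)-m(t)$. Then $m(t)$ is increasing, $M(t)$ is decreasing, and both $A(t)$ and $\|\nabla u(t)\|_{L^\infty(\mathbb{T}^d)}$ decay to zero exponentially fast as $t\to\infty$. Consequently, the solution $u(t)$ converges to a constant at an exponential rate as $t\to\infty$.
   Context: $\mathbb{T}^d=(\mathbb{R}/2\pi\mathbb{Z})^d$ and $\mathbb{R}_+=[0,\infty)$. $|\nabla|=(-\Delta)^{1/2}$ is the Fourier multiplier with symbol $|\xi|$. Let $c_d>0$ be the dimensional constant such that on $\mathbb{R}^d$, $|\nabla|f(x)=\mathrm{p.v.}\int_{\mathbb{R}^d}\frac{c_d}{|x-y|^{d+1}}(f(x)-f(y))\,dy$, and set $K_{\mathrm{per}}(z)=\sum_{j\in\mathbb{Z}^d}\frac{c_d}{|z+2\pi j|^{d+1}}$. The seminorm is $\|f\|_{\dot H^{1/2}(\mathbb{T}^d)}^2=\int_{\mathbb{T}^d}f\,|\nabla|f\,dx$. Weak solution with initial value $u_0$: for every $\phi\in C^\infty(\mathbb{R}_+\times\mathbb{T}^d)$ and every $t\ge 0$, $$\int_{\mathbb{T}^d}u(x,t)\phi(x,t)\,dx-\int_{\mathbb{T}^d}u_0(x)\phi(x,0)\,dx-\int_0^t\!\!\int_{\mathbb{T}^d}u\,\partial_t\phi\,dx\,ds$$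 $$=\frac12\int_0^t\!\!\iint\phi(x,s)(u(y,s)-u(x,s))^2K_{\mathrm{per}}(y-x)\,dy\,dx\,ds$$ $$+\frac12\int_0^t\!\!\iint u(x,s)(\phi(x,s)-\phi(y,s))(u(y,s)-u(x,s))K_{\mathrm{per}}(y-x)\,dy\,dx\,ds,$$ the double integrals being over $\mathbb{T}^d\times\mathbb{T}^d$. Properties (P) (those of the weak solutions whose existence the paper establishes for every such $u_0$): $u\in L^\infty(\mathbb{R}_+\times\mathbb{T}^d)\cap L^2(\mathbb{R}_+;\dot H^{1/2})\cap C^0(\mathbb{R}_+;L^2)$; as $t\to0^+$, $u(t)\to u_0$ weakly$^*$ in $L^\infty$ and strongly in $L^2$; $\|u(t)\|_{L^2}=\|u_0\|_{L^2}$ for all $t\geq 0$; the momentum $\int_{\mathbb{T}^d}u(x,t)\,dx$ is continuous on $\mathbb{R}_+$ and $\int_{\mathbb{T}^d} u(x,t')dx=\int_{\mathbb{T}^d} u(x,t)dx+\int_t^{t'}\|u(s)\|_{\dot H^{1/2}}^2ds$ for all $t,t'\ge0$; for every $T>0$ and $k\in\mathbb{N}$ there is $\alpha_k\in(0,1)$ such that for all $0<t_0<T$ the norms $\|u\|_{C^{k+\alpha_k,\alpha_k}_{x,t}(\mathbb{T}^d\times(t_0,T))}$ and $\|\nabla_x^ku\|_{\mathrm{Lip}(\mathbb{T}^d\times(t_0,T))}$ are bounded by constants depending only on $d,k,t_0,T,\min u_0,\max u_0$; and for $t>0$ the equation holds in the classical sense. Here $C^{k+\alpha,\alpha}_{x,t}$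 is the Hölder space of functions $C^{k+\alpha}$ in $x$ uniformly in $t$ and $C^\alpha$ in $t$ uniformly in $x$, and $\mathrm{Lip}$ is the space of bounded functions Lipschitz in $(x,t)$. At $t=0$, $\min$ and $\max$ mean the essential infimum and supremum of $u_0$. ''Increasing''/''decreasing'' are in the non-strict sense. A quantity $q(t)$ decays exponentially fast if $q(t)\le Ce^{-\gamma t}$ for all sufficiently large $t$, with some $C,\gamma>0$; convergence to a constant is uniform on $\mathbb{T}^d$. *)

(* Defs.v *)
From HB Require Import structures.
From mathcomp Require Import all_boot all_order all_algebra.
From mathcomp Require Import all_classical all_reals all_analysis.
From mathcomp Require Import ess_sup_inf.
Import Order.TTheory GRing.Theory Num.Theory.
Import numFieldNormedType.Exports.

Set Implicit Arguments.
Unset Strict Implicit.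
Unset Printing Implicit Defensive.

Local Open Scope classical_set_scope.
Local Open Scope ring_scope.

(* 'rV[R]_n carries the product (= Borel) sigma-algebra, as tuples do. *)
Definition rV_display : measure_display. Proof. exact: default_measure_display. Qed.

Section measurable_rV.
Context (R : realType) (n : nat).

Let coor : 'I_n -> 'rV[R]_n -> measurableTypeR R := fun i x => x ord0 i.

Let rV_set0 : g_sigma_preimage coor set0.
Proof. exact: sigma_algebra0. Qed.

Let rV_setC A : g_sigma_preimage coor A -> g_sigma_preimage coor (~` A).
Proof. exact: sigma_algebraC. Qed.

Let rV_bigcup (F : _^nat) : (forall i, g_sigma_preimage coor (F i)) ->
  g_sigma_preimage coor (\bigcup_i (F i)).
Proof. exact: sigma_algebra_bigcup. Qed.

HB.instance Definition _ := @isMeasurable.Build rV_display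
  'rV[R]_n (g_sigma_preimage coor) rV_set0 rV_setC rV_bigcup.

Lemma measurable_coor (i : 'I_n) :
  measurable_fun [set: 'rV[R]_n] (fun x => x ord0 i : measurableTypeR R).
Proof.
move=> _ Y mY; rewrite setTI; apply: sub_sigma_algebra => /=.
rewrite -bigcup_seq/=; exists i => /=; first by rewrite mem_index_enum.
by exists Y => //; rewrite setTI.
Qed.

End measurable_rV.

Section lebesgue_rV.
Context (R : realType).

Definition cons_rV n (z : measurableTypeR R * 'rV[R]_n) : 'rV[R]_n.+1 :=
  \row_i (if unlift ord0 i is Some j then z.2 ord0 j else z.1).

Definition uncons_rV n (x : 'rV[R]_n.+1) : measurableTypeR R * 'rV[R]_n :=
  (x ord0 ord0, \row_j x ord0 (lift ord0 j)).

Lemma cons_rVK n : cancel (@cons_rV n) (@uncons_rV n).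
Proof.
move=> [x y]; rewrite /uncons_rV /cons_rV; congr pair.
  by rewrite mxE unlift_none.
by apply/rowP => j; rewrite !mxE liftK.
Qed.

Lemma measurable_fun_rV d (T : measurableType d) n (f : T -> 'rV[R]_n) :
  (forall i, measurable_fun [set: T]
     (fun x => f x ord0 i : measurableTypeR R)) ->
  measurable_fun [set: T] f.
Proof.
move=> mf.
apply: (@measurability _ _ _ _ setT f
  (\big[setU/set0]_(i < n) preimage_set_system setT
     (fun x : 'rV[R]_n => x ord0 i : measurableTypeR R) measurable)) => //.
move=> _ [A + <-]; rewrite -bigcup_seq/= => -[i _ [B mB <-]].
by rewrite !setTI; have := mf i measurableT B mB; rewrite setTI.
Qed.

Lemma measurable_cons_rV n : measurable_fun setT (@cons_rV n).
Proof.
apply: measurable_fun_rV => i.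
rewrite (_ : (fun _ => _) =
    (fun z : measurableTypeR R * 'rV[R]_n =>
       if unlift ord0 i is Some j
       then (z.2 ord0 j : measurableTypeR R) else z.1)); last first.
  by apply/funext => z; rewrite /cons_rV mxE.
case: unliftP => [j _|_]; last exact: measurable_fst.
exact: (measurableT_comp (@measurable_coor R n j) measurable_snd).
Qed.

Lemma measurable_uncons_rV n : measurable_fun setT (@uncons_rV n).
Proof.
apply: measurable_fun_pair; first exact: measurable_coor.
apply: measurable_fun_rV => i.
rewrite (_ : (fun _ => _) =
    (fun x : 'rV[R]_n.+1 =>
       (x ord0 (lift ord0 i) : measurableTypeR R))); last first.
  by apply/funext => x; rewrite mxE.
exact: measurable_coor.
Qed.

Section step.
Context (n : nat) (mu : {sigma_finite_measure set 'rV[R]_n -> \bar R}).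

Definition lebesgue_step : set 'rV[R]_n.+1 -> \bar R :=
  pushforward (lebesgue_measure \x mu)%E (@cons_rV n).

Let step0 : lebesgue_step set0 = 0%E.
Proof. by rewrite /lebesgue_step /pushforward preimage_set0 measure0. Qed.

Let step_ge0 A : (0 <= lebesgue_step A)%E.
Proof. by rewrite /lebesgue_step /pushforward. Qed.

Let step_sigma_additive : semi_sigma_additive lebesgue_step.
Proof.
have mc := @measurable_cons_rV n.
move=> F mF tF mUF; rewrite /lebesgue_step /pushforward preimage_bigcup.
apply: measure_semi_sigma_additive.
- by move=> k; rewrite -[X in measurable X]setTI; exact: mc.
- apply/trivIsetP => /= i j _ _ ij; rewrite -preimage_setI.
  by move/trivIsetP : tF => /(_ _ _ _ _ ij) ->//; rewrite preimage_set0.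
- by rewrite -preimage_bigcup -[X in measurable X]setTI; exact: mc.
Qed.

HB.instance Definition _ := isMeasure.Build _ _ _
  lebesgue_step step0 step_ge0 step_sigma_additive.

Let step_sigma_finite : sigma_finite setT lebesgue_step.
Proof.
have /sigma_finiteP[F [FT ndF Foo]] := sigma_finiteT (@lebesgue_measure R).
have /sigma_finiteP[G [GT ndG Goo]] := sigma_finiteT mu.
exists (fun k => @uncons_rV n @^-1` (F k `*` G k)).
  rewrite -preimage_bigcup (_ : \bigcup_k _ = setT) ?preimage_setT//.
  rewrite -setXTT FT GT predeqE => -[x y]; split.
    by move=> [k _ []/= ? ?]; split; exists k.
  move=> [/= [k _ Fkx] [l _ Gly]]; exists (maxn k l) => //; split.
  - by move: x Fkx; exact/subsetPset/ndF/leq_maxl.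
  - by move: y Gly; exact/subsetPset/ndG/leq_maxr.
move=> k; have [mFk Fkoo] := Foo k; have [mGk Gkoo] := Goo k; split.
  rewrite -[X in measurable X]setTI.
  by apply: measurable_uncons_rV => //; exact: measurableX.
rewrite /lebesgue_step /pushforward (_ : _ @^-1` _ = F k `*` G k).
  by rewrite product_measure1E// lte_mul_pinfty// ge0_fin_numE.
by rewrite -comp_preimage (_ : _ \o _ = id)//; apply/funext/cons_rVK.
Qed.

HB.instance Definition _ := Measure_isSigmaFinite.Build _ _ _
  lebesgue_step step_sigma_finite.

End step.

Fixpoint lebesgue_rV (n : nat) : {sigma_finite_measure set 'rV[R]_n -> \bar R} :=
  match n with
  | 0 => [the {sigma_finite_measure set 'rV[R]_0 -> \bar R} of \d_(0 : 'rV[R]_0)]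
  | n'.+1 => [the {sigma_finite_measure set 'rV[R]_n'.+1 -> \bar R} of
               lebesgue_step (lebesgue_rV n')]
  end.

Definition torus_cell n : set 'rV[R]_n :=
  [set x | forall i, 0 <= x ord0 i <= 2 * pi].

Lemma measurable_torus_cell n : measurable (@torus_cell n).
Proof.
rewrite (_ : @torus_cell n = \bigcap_(i : 'I_n)
   ((fun x : 'rV[R]_n => x ord0 i : measurableTypeR R) @^-1` `[0, 2 * pi])).
  apply: fin_bigcap_measurable; first exact: finite_finset.
  move=> i _; rewrite -[X in measurable X]setTI.
  by apply: measurable_coor => //; exact: measurable_itv.
apply/seteqP; split => x /= H i; first by move=> _; rewrite /= in_itv/= H.
by have := H i I; rewrite /= in_itv/=.
Qed.

Definition torus_measure n : set 'rV[R]_n -> \bar R :=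
  mrestr (lebesgue_rV n) (@measurable_torus_cell n).

HB.instance Definition _ n := Measure.on (@torus_measure n).

Lemma torus_measure_sigma_finite n : sigma_finite setT (@torus_measure n).
Proof.
have [F FT Foo] := sigma_finiteT (lebesgue_rV n).
exists F => // k; split; first exact: (Foo k).1.
apply: le_lt_trans (Foo k).2; rewrite /torus_measure /mrestr/=.
have mF := (Foo k).1; have mC := @measurable_torus_cell n.
by apply: le_measure; rewrite ?inE//; apply: measurableI.
Qed.

HB.instance Definition _ n := Measure_isSigmaFinite.Build _ _ _
  (@torus_measure n) (@torus_measure_sigma_finite n).

End lebesgue_rV.
Arguments lebesgue_rV {R} n.
Arguments torus_measure {R} n A.

Section torus_functions.
Context {R : realType} {d : nat}.
Local Notation V := 'rV[R]_d.
Local Notation leb := (@lebesgue_measure R).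
Local Notation leb_d := (lebesgue_rV d : {sigma_finite_measure set V -> \bar R}).
Local Notation mu := (torus_measure d : set V -> \bar R).
Implicit Types (f g : V -> R) (x y z : V) (k : 'rV[int]_d) (u : R -> V -> R).

Definition dot x y : R := \sum_(i < d) x ord0 i * y ord0 i.

Definition enorm x : R := Num.sqrt (dot x x).

Definition intvec k : V := map_mx intr k.

(* Functions on the torus are 2 pi-periodic functions on R^d; integrals over
   the torus are integrals with respect to [torus_measure d]. *)
Definition torus_periodic f := forall x k, f (x + (2 * pi) *: intvec k) = f x.

Definition fcos f k : R :=
  ((2 * pi) ^+ d)^-1 * \int[mu]_x (f x * cos (dot (intvec k) x)).

Definition fsin f k : R :=
  ((2 * pi) ^+ d)^-1 * \int[mu]_x (f x * sin (dot (intvec k) x)).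

(* With fhat k = fcos f k - i fsin f k, the k-th term of the Fourier series of
   |nabla| f is |k| Re (fhat k exp (i k.x)); the imaginary parts of the terms
   k and -k cancel. *)
Definition absnabla_term f x k : R :=
  enorm (intvec k) * (fcos f k * cos (dot (intvec k) x)
                      + fsin f k * sin (dot (intvec k) x)).

Definition absnabla_summable f x :=
  summable [set: 'rV[int]_d] (fun k => (absnabla_term f x k)%:E).

Definition absnabla f x : R :=
  fine (\esum_(k in [set: 'rV[int]_d]) (Num.max (absnabla_term f x k) 0)%:E)
  - fine (\esum_(k in [set: 'rV[int]_d]) (Num.max (- absnabla_term f x k) 0)%:E).

(* \int f |nabla| f, as the pairing of f with the distribution |nabla| f:
   (2 pi)^d \sum_k |k| |fhat k|^2, which may be +oo. *)
Definition Hhalf2 f : \bar R :=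
  \esum_(k in [set: 'rV[int]_d])
    ((2 * pi) ^+ d * (enorm (intvec k) * (fcos f k ^+ 2 + fsin f k ^+ 2)))%:E.

Definition iter_derive (W : normedModType R) (vs : seq W) (h : W -> R) :
  W -> R := foldr (fun v h' => 'D_v h') h vs.

Definition smooth (W : normedModType R) (h : W -> R) :=
  forall vs, continuous (iter_derive vs h) /\
    forall w v, derivable (iter_derive vs h) w v.

(* |nabla| f on R^d for real f, by the Fourier inversion formula:
   (2 pi)^-d \int |w| \int f y exp (i w.(x - y)) dy dw, where the imaginary
   part is odd in w. *)
Definition absnabla_Rd f x : R :=
  ((2 * pi) ^+ d)^-1 * \int[leb_d]_w
    (enorm w * \int[leb_d]_y (f y * cos (dot w (x - y)))).

Definition is_kernel_constant (c : R) :=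
  0 < c /\
  forall f, smooth f -> (exists r, forall x, r < enorm x -> f x = 0) ->
  forall x,
    \int[leb_d]_(y in [set y | e <= enorm (x - y)])
       (c / enorm (x - y) ^+ d.+1 * (f x - f y)) @[e --> 0^'+]
    --> absnabla_Rd f x.

(* At z in 2 pi Z^d the singular term is 0, as x / 0 = 0; this is a null set. *)
Definition Kper (c : R) z : R :=
  fine (\esum_(j in [set: 'rV[int]_d])
    (c / enorm (z + (2 * pi) *: intvec j) ^+ d.+1)%:E).

Definition dt (phi : R * V -> R) (s : R) x : R := derive1 (fun r => phi (r, x)) s.

(* A smooth function on [0, +oo[ x T^d is the restriction of a smooth function
   on R x T^d. *)
Definition test_function (phi : R * V -> R) :=
  smooth phi /\ forall t, torus_periodic (fun x => phi (t, x)).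

Definition weak_solution (c : R) (u0 : V -> R) u :=
  forall phi, test_function phi -> forall t, 0 <= t ->
    \int[mu]_x (u t x * phi (t, x)) - \int[mu]_x (u0 x * phi (0, x))
    - \int[leb]_(s in `[0, t]) \int[mu]_x (u s x * dt phi s x)
    = 2^-1 * \int[leb]_(s in `[0, t]) \int[(mu \x mu)%E]_p
        (phi (s, p.1) * (u s p.2 - u s p.1) ^+ 2 * Kper c (p.2 - p.1))
    + 2^-1 * \int[leb]_(s in `[0, t]) \int[(mu \x mu)%E]_p
        (u s p.1 * (phi (s, p.1) - phi (s, p.2)) * (u s p.2 - u s p.1)
         * Kper c (p.2 - p.1)).

Definition basis_vec (i : 'I_d) : V := delta_mx ord0 i.

Definition partials (s : seq 'I_d) f : V -> R := iter_derive (map basis_vec s) f.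

Definition Ck (k : nat) f := forall s : seq 'I_d, (size s <= k)%N ->
  continuous (partials s f) /\
  ((size s < k)%N -> forall x i, derivable (partials s f) x (basis_vec i)).

Definition nablak (k : nat) f x : {ffun k.-tuple 'I_d -> R} :=
  [ffun s => partials (tval s) f x].

Definition tensor_norm (k : nat) (a : {ffun k.-tuple 'I_d -> R}) : R :=
  Num.sqrt (\sum_s a s ^+ 2).

Definition gradient f x : V := \row_i 'D_(basis_vec i) f x.

(* Norm of C^{k+a,a}_{x,t}(T^d x ]t0, T[). By periodicity, distances may be
   taken in R^d instead of T^d. *)
Definition Holder_norm (k : nat) (a t0 T : R) u : \bar R :=
  (ereal_sup [set \sum_(j < k.+1)
                    ereal_sup [set (tensor_norm (nablak j (u t) x))%:E | x in setT]
                  + ereal_sup [set (tensor_norm (nablak k (u t) z.1 - nablak k (u t) z.2)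
                                    / enorm (z.1 - z.2) `^ a)%:E
                              | z in [set z : V * V | z.1 != z.2]]
             | t in `]t0, T[]
   + ereal_sup [set ereal_sup [set (`|u z.1 x - u z.2 x| / `|z.1 - z.2| `^ a)%:E
                              | z in [set z : R * R |
                                  [/\ t0 < z.1 < T, t0 < z.2 < T & z.1 != z.2]%R]]
               | x in setT])%E.

Definition Lip_nablak_norm (k : nat) (t0 T : R) u : \bar R :=
  (ereal_sup [set (tensor_norm (nablak k (u z.1) z.2))%:E
             | z in [set z : R * V | (t0 < z.1 < T)%R]]
   + ereal_sup [set (tensor_norm (nablak k (u w.1.1) w.1.2 - nablak k (u w.2.1) w.2.2)
                     / Num.sqrt ((w.1.1 - w.2.1) ^+ 2
                                 + enorm (w.1.2 - w.2.2) ^+ 2))%:E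
               | w in [set w : (R * V) * (R * V) |
                   [/\ t0 < w.1.1 < T, t0 < w.2.1 < T & w.1 != w.2]%R]])%E.

Definition Linfty (f : V -> R) :=
  measurable_fun setT f /\ (Lnorm mu +oo%E (EFin \o f) < +oo)%E.

Definition timeRplus : set R := `[0, +oo[%classic.

Definition spacetime_measure :=
  (mrestr leb (@measurable_itv R `[0%R, +oo[) \x mu)%E.

(* A function u on [0, +oo[ x T^d is encoded by u : R -> V -> R; the values u t
   for t < 0 are irrelevant.  [B k t0 T a b] is a bound which depends only on the dimension, k, t0, T and
   a = min u0, b = max u0. *)
Record regular_solution (B : nat -> R -> R -> R -> R -> R) (u0 : V -> R) u
    : Prop := {
  sol_periodic : forall t, 0 <= t -> torus_periodic (u t) ;
  sol_measurable :
    measurable_fun (timeRplus `*` setT) (fun z : measurableTypeR R * V => u z.1 z.2) ;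
  sol_Linfty :
    (Lnorm spacetime_measure +oo%E (fun p => (u p.1 p.2)%:E) < +oo)%E ;
  sol_L2_Hhalf :
    leb.-integrable timeRplus (fun t => Hhalf2 (u t)) ;
  sol_L2 : forall t, 0 <= t -> (Lnorm mu 2%:E (EFin \o u t) < +oo)%E ;
  sol_C0_L2 : forall t0, 0 <= t0 ->
    Lnorm mu 2%:E (fun x => (u t x - u t0 x)%:E) @[t --> within timeRplus (nbhs t0)]
    --> 0%E ;
  sol_init_weakstar : forall g, mu.-integrable setT (EFin \o g) ->
    \int[mu]_x (u t x * g x) @[t --> 0^'+] --> \int[mu]_x (u0 x * g x) ;
  sol_init_L2 :
    Lnorm mu 2%:E (fun x => (u t x - u0 x)%:E) @[t --> 0^'+] --> 0%E ;
  sol_L2_conserved : forall t, 0 <= t ->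
    Lnorm mu 2%:E (EFin \o u t) = Lnorm mu 2%:E (EFin \o u0) ;
  sol_momentum_continuous :
    {within timeRplus, continuous (fun t => \int[mu]_x u t x)} ;
  (* one of the two integrals vanishes: this is the oriented integral *)
  sol_momentum : forall t t', 0 <= t -> 0 <= t' ->
    \int[mu]_x u t' x = \int[mu]_x u t x
      + (fine (\int[leb]_(s in `[t, t']) Hhalf2 (u s))%E
         - fine (\int[leb]_(s in `[t', t]) Hhalf2 (u s))%E) ;
  sol_smooth : forall (T : R) (k : nat), 0 < T -> exists2 a, 0 < a < 1 &
    forall t0, 0 < t0 < T ->
    let b := B k t0 T (fine (ess_inf mu (EFin \o u0)))
                      (fine (ess_sup mu (EFin \o u0))) in
    [/\ forall t, t0 < t < T -> Ck k (u t),
        (Holder_norm k a t0 T u <= b%:E)%E &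
        (Lip_nablak_norm k t0 T u <= b%:E)%E] ;
  sol_classical : forall t x, 0 < t ->
    [/\ derivable (fun s => u s x) t 1,
        absnabla_summable (u t) x,
        absnabla_summable (fun y => u t y ^+ 2) x &
        derive1 (fun s => u s x) t - u t x * absnabla (u t) x
        + absnabla (fun y => u t y ^+ 2) x = 0]
}.

(* For t > 0, u t is continuous and periodic, so that the infimum and the
   supremum are attained. *)
Definition umin (u0 : V -> R) u (t : R) : \bar R :=
  if t == 0 then ess_inf mu (EFin \o u0)
  else ereal_inf [set (u t x)%:E | x in setT].

Definition umax (u0 : V -> R) u (t : R) : \bar R :=
  if t == 0 then ess_sup mu (EFin \o u0)
  else ereal_sup [set (u t x)%:E | x in setT].

Definition amplitude (u0 : V -> R) u (t : R) : \bar R :=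
  (umax u0 u t - umin u0 u t)%E.

Definition gradient_Linfty u (t : R) : \bar R :=
  Lnorm mu +oo%E (fun x => (enorm (gradient (u t) x))%:E).

Definition uniform_dist f (a : R) : \bar R :=
  ereal_sup [set `|f x - a|%:E | x in setT].

End torus_functions.

Definition decays_exponentially {R : realType} (q : R -> \bar R) :=
  exists C gamma : R, [/\ 0 < C, 0 < gamma &
    \forall t \near +oo, (q t <= (C * expR (- gamma * t))%:E)%E].

(* Main.v *)
(** Let Q be the transition operator of the lazy nearest neighbour walk on the lattice
    of mesh h. Expanding sqrt (1 - q) in powers of q turns - |nabla| into the limit, as h
    tends to 0, of L_h = (2 sqrt d / h) sum_n a_n (Q^(n+1) - 1) with a_n > 0; this is the
    only place where Fourier series are needed. The equation becomes
    u_t = lim (L_h (u^2) - u L_h u), and everything else follows from the positivity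
    of Q^n, with errors O(h).

    Symmetrizing the form int f (Q^n (u^2) - u Q^n u) shows that int (k - u)_+^2 and
    int (u - k)_+^2 decrease in time, so min u increases and max u decreases, from t = 0 on.
    If u has its maximum A + min u at x1 and its minimum at x2, then at these points
    A' <= - min u * lim (2 sqrt d / h) sum_n a_n (A - (Q^n u x1 - Q^n u x2)). The gradient
    of Q^n u is O(A / (h sqrt n)), so that Q^n u x1 - Q^n u x2 <= A / 2 for n >= C / h^2,
    and these n carry a mass of order h: hence A' <= - kappa A.

    At a maximum point x of V = |nabla u|^2, put F y = |nabla u y - nabla u x|^2 and
    D = lim L_h F x. The terms of V_t are controlled by - (min u / 4) D + V L_h u. The
    amplitude bound forces D >= c V^(3/2) / A, and V |L_h u| <= C A D, so V_t is at most
    - c min u V^(3/2) / A once A is small: sqrt V is bounded by a multiple of the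
    exponential bound for A. *)
Require Import Defs.
From HB Require Import structures.
From mathcomp Require Import all_boot all_order all_algebra.
From mathcomp Require Import all_classical all_reals all_analysis.
From mathcomp Require Import measurable_realfun ess_sup_inf.
From mathcomp Require Import ring lra.
Import Order.TTheory GRing.Theory Num.Theory.
Import numFieldNormedType.Exports.

Local Open Scope classical_set_scope.
Local Open Scope ring_scope.

Set Implicit Arguments.
Unset Strict Implicit.
Unset Printing Implicit Defensive.

(** [absnabla] is given by Fourier coefficients, where no sign is visible, while every claim is a
    comparison principle. Powers of the walk supply the signs: they preserve order, are
    self-adjoint, commute with translations and partial derivatives, and have the Fourier modes as
    eigenfunctions. The series is cut at an [N] with [bcoef N <= h ^+ 2], so that against the
    prefactor of order 1 / h the cut costs only O(h). Two obstacles shape the rest. The datum is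
    attained only in L^2, so the bounds by [ess_inf] and [ess_sup] come from integral energies and
    not from a pointwise maximum argument. And a maximum over the torus need not be differentiable
    in time: the maximum point is frozen at each time and compared from the left in [touching_le0].
    The gradient also has to be differentiated in time, which rests on the time-Lipschitz bounds for
    second derivatives in space. The gradient estimate sets in only after the amplitude has fallen
    below the minimum over 1600 d; there the dissipation D beats the term V L_h u. *)

Section scalar_derivatives.
Context {R : realType}.
Implicit Types (f g : R -> R) (x a b : R).

Lemma derfD f g x a b : is_derive x (1 : R) f a -> is_derive x (1 : R) g b ->
  is_derive x (1 : R) (fun z => f z + g z) (a + b).
Proof. exact: is_deriveD. Qed.

Lemma derfN f x a : is_derive x (1 : R) f a ->
  is_derive x (1 : R) (fun z => - f z) (- a).
Proof. exact: is_deriveN. Qed.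

Lemma derfB f g x a b : is_derive x (1 : R) f a -> is_derive x (1 : R) g b ->
  is_derive x (1 : R) (fun z => f z - g z) (a - b).
Proof. by move=> fa gb; apply: derfD => //; exact: derfN. Qed.

Lemma derfM f g x a b : is_derive x (1 : R) f a -> is_derive x (1 : R) g b ->
  is_derive x (1 : R) (fun z => f z * g z) (a * g x + f x * b).
Proof.
move=> fa gb.
have -> : a * g x + f x * b = f x *: b + g x *: a.
  by rewrite addrC [a * _]mulrC.
exact: is_deriveM.
Qed.

Lemma derf_cst x c : is_derive x (1 : R) (fun=> c : R) 0.
Proof. exact: is_derive_cst. Qed.

Lemma derf_id x : is_derive x (1 : R) (fun z => z) 1.
Proof. exact: is_derive_id. Qed.

Lemma derfZ f x a c : is_derive x (1 : R) f a ->
  is_derive x (1 : R) (fun z => c * f z) (c * a).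
Proof.
move=> fa; have := derfM (derf_cst x c) fa.
by rewrite mul0r add0r.
Qed.

Lemma derfX f x a n : is_derive x (1 : R) f a ->
  is_derive x (1 : R) (fun z => f z ^+ n) (n%:R * f x ^+ n.-1 * a).
Proof.
move=> fa; elim: n => [|n IH]; first by rewrite !mul0r; exact: derf_cst.
have -> : (fun z => f z ^+ n.+1) = (fun z => f z * f z ^+ n).
  by apply/funext => z; rewrite exprS.
have := derfM fa IH.
suff <- : a * f x ^+ n + f x * (n%:R * f x ^+ n.-1 * a) =
  n.+1%:R * f x ^+ n.+1.-1 * a by [].
rewrite /= -natr1; case: n {IH} => [|n]; first by rewrite !expr0; ring.
by rewrite /= exprS; ring.
Qed.

Lemma derf_eq f x a b : is_derive x (1 : R) f a -> a = b -> is_derive x (1 : R) f b.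
Proof. by move=> ? <-. Qed.

End scalar_derivatives.

(** * The lazy lattice walk: linearity, positivity, and decay of the gradient of its powers *)

Section walk.
Context {R : realType} {d : nat}.
Local Notation V := 'rV[R]_d.
Local Notation e := (@basis_vec R d).
Implicit Types (f g : V -> R) (x y z : V) (h : R) (n : nat).

(** The walk stays put with probability 1/2, so that its symbol lies in [0, 1], the range on which
    [sqrt_approx] controls the expansion of sqrt (1 - q). *)
Definition walk h f x : R :=
  2^-1 * f x + (4 * d%:R)^-1 * \sum_i (f (x + h *: e i) + f (x - h *: e i)).

Definition walkn h n f : V -> R := iter n (walk h) f.

Arguments walkn : simpl never.

Lemma walknS h n f : walkn h n.+1 f = walk h (walkn h n f).
Proof. by []. Qed.

Lemma walknSr h n f : walkn h n.+1 f = walkn h n (walk h f).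
Proof. by rewrite /walkn iterSr. Qed.

Lemma walknD h m n f : walkn h (m + n) f = walkn h m (walkn h n f).
Proof. by rewrite /walkn iterD. Qed.

Lemma walkn_lin h n (a : R) f g x :
  walkn h n (fun y => a * f y + g y) x = a * walkn h n f x + walkn h n g x.
Proof.
elim: n x => [//|n IH] x; rewrite !walknS /walk IH.
under eq_bigr => i _ do rewrite !IH addrACA -mulrDr.
by rewrite big_split/= -mulr_sumr; ring.
Qed.

Lemma walkn0 h n x : walkn h n (fun=> 0) x = 0.
Proof.
elim: n x => [//|n IH] x; rewrite walknS /walk IH.
by rewrite big1 ?mulr0 ?addr0// => i _; rewrite !IH addr0.
Qed.

Lemma walknZ h n (a : R) f x :
  walkn h n (fun y => a * f y) x = a * walkn h n f x.
Proof.
have := walkn_lin h n a f (fun=> 0) x; rewrite walkn0 addr0 => <-.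
by congr walkn; apply/funext => y; rewrite addr0.
Qed.

Lemma walkn_add h n f g x :
  walkn h n (fun y => f y + g y) x = walkn h n f x + walkn h n g x.
Proof.
rewrite -[X in _ = X + _]mul1r -walkn_lin.
by congr walkn; apply/funext => y; rewrite mul1r.
Qed.

Lemma walknN h n f x : walkn h n (fun y => - f y) x = - walkn h n f x.
Proof.
rewrite -mulN1r -walknZ.
by congr walkn; apply/funext => y; rewrite mulN1r.
Qed.

Lemma walknB h n f g x :
  walkn h n (fun y => f y - g y) x = walkn h n f x - walkn h n g x.
Proof. by rewrite walkn_add walknN. Qed.

Lemma walkn_sum h n (I : Type) (r : seq I) (F : I -> V -> R) x :
  walkn h n (fun y => \sum_(i <- r) F i y) x = \sum_(i <- r) walkn h n (F i) x.
Proof.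
elim: r => [|i r IH].
  by rewrite big_nil -[RHS](walkn0 h n x); congr walkn; apply/funext => y;
    rewrite big_nil.
rewrite big_cons -IH -walkn_add; congr walkn.
by apply/funext => y; rewrite big_cons.
Qed.

Lemma ler_walkn h n f g x : (forall y, f y <= g y) ->
  walkn h n f x <= walkn h n g x.
Proof.
move=> fg; elim: n x => [//|n IH] x; rewrite !walknS /walk.
apply: lerD; first by rewrite ler_pM2l.
by apply: ler_wpM2l; [rewrite invr_ge0 mulr_ge0|apply: ler_sum => i _; apply: lerD].
Qed.

Lemma walkn_shift h n f z x :
  walkn h n (fun y => f (y + z)) x = walkn h n f (x + z).
Proof.
elim: n x => [//|n IH] x; rewrite !walknS /walk IH.
by congr (_ + _ * _); apply: eq_bigr => i _; rewrite !IH ![x + z + _]addrAC.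
Qed.

Hypothesis d_gt0 : (0 < d)%N.

Let d_neq0 : d%:R != 0 :> R.
Proof. by rewrite pnatr_eq0 -lt0n. Qed.

Lemma walkn_cst h n (a : R) x : walkn h n (fun=> a) x = a.
Proof.
elim: n x => [//|n IH] x; rewrite walknS /walk IH.
under eq_bigr => i _ do rewrite !IH.
rewrite sumr_const card_ord -[(a + a) *+ d]mulr_natr.
by field.
Qed.

Lemma walkn_ge h n f (a : R) x : (forall y, a <= f y) -> a <= walkn h n f x.
Proof. by move=> ?; rewrite -[leLHS](walkn_cst h n a x); exact: ler_walkn. Qed.

Lemma walkn_le h n f (a : R) x : (forall y, f y <= a) -> walkn h n f x <= a.
Proof. by move=> ?; rewrite -[leRHS](walkn_cst h n a x); exact: ler_walkn. Qed.

Lemma normr_walkn_le h n f (a : R) x : (forall y, `|f y| <= a) ->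
  `|walkn h n f x| <= a.
Proof.
move=> fa; rewrite ler_norml; apply/andP; split.
  by apply: walkn_ge => y; have := fa y; rewrite ler_norml => /andP[].
by apply: walkn_le => y; have := fa y; rewrite ler_norml => /andP[].
Qed.

(** Jensen's inequality, from the nonnegative average of [(f y - a) ^+ 2] with [a] the average of
    [f]. *)
Lemma walkn_sqr h n f x : walkn h n f x ^+ 2 <= walkn h n (fun y => f y ^+ 2) x.
Proof.
set a := walkn h n f x.
have : 0 <= walkn h n (fun y => (f y - a) ^+ 2) x.
  by apply: walkn_ge => y; exact: sqr_ge0.
rewrite (_ : (fun y => _) = (fun y => (- (2 * a)) * f y + (f y ^+ 2 + a ^+ 2))).
  by rewrite walkn_lin walkn_add walkn_cst -/a; lra.
by apply/funext => y; ring.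
Qed.

(** Left without the division by [h ^+ 2]: the squared increments along the 2 d edges at [x]. *)
Definition sqgrad h f x : R :=
  \sum_i ((f (x + h *: e i) - f x) ^+ 2 + (f (x - h *: e i) - f x) ^+ 2).

Let sum_cst (a : R) : d%:R * a = \sum_(i < d) a.
Proof. by rewrite sumr_const card_ord mulr_natl. Qed.

(** With S1 and S2 the sums of the 2 d edge increments and of their squares, the variance of one
    step is S2 / (4 d) - S1^2 / (16 d^2). Since S1^2 <= 2 d S2 by Cauchy-Schwarz, at least half of
    the first term survives. *)
Lemma walk_variance h f x :
  (8 * d%:R)^-1 * sqgrad h f x <= walk h (fun y => f y ^+ 2) x - walk h f x ^+ 2.
Proof.
pose p i := f (x + h *: e i) - f x; pose q i := f (x - h *: e i) - f x.
pose S2 := \sum_i (p i ^+ 2 + q i ^+ 2); pose S1 := \sum_i (p i + q i).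
have -> : sqgrad h f x = S2 by [].
have d0 : 0 < d%:R :> R by rewrite ltr0n.
have E1 : walk h f x = f x + (4 * d%:R)^-1 * S1.
  rewrite /walk (_ : \sum_i _ = S1 + d%:R * (2 * f x)); first by field.
  rewrite /S1 sum_cst -big_split/=.
  by apply: eq_bigr => i _; rewrite /p /q; ring.
have E2 : walk h (fun y => f y ^+ 2) x =
    f x ^+ 2 + (4 * d%:R)^-1 * (S2 + 2 * f x * S1).
  rewrite /walk (_ : \sum_i _ = S2 + 2 * f x * S1 + d%:R * (2 * f x ^+ 2)).
    by field.
  rewrite /S1 /S2 sum_cst mulr_sumr -!big_split/=.
  by apply: eq_bigr => i _; rewrite /p /q; ring.
have CS : S1 ^+ 2 <= 2 * d%:R * S2.
  pose s := S1 / (2 * d%:R).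
  have : 0 <= \sum_(i < d) ((p i - s) ^+ 2 + (q i - s) ^+ 2).
    by apply: sumr_ge0 => i _; rewrite addr_ge0 ?sqr_ge0.
  have -> : \sum_(i < d) ((p i - s) ^+ 2 + (q i - s) ^+ 2) =
      S2 + - (2 * s) * S1 + d%:R * (2 * s ^+ 2).
    rewrite sum_cst /S1 /S2 mulr_sumr -!big_split/=.
    by apply: eq_bigr => i _; ring.
  have -> : S2 + - (2 * s) * S1 + d%:R * (2 * s ^+ 2) = S2 - S1 ^+ 2 / (2 * d%:R).
    by rewrite /s; field.
  by rewrite subr_ge0 ler_pdivrMr ?mulr_gt0// [S2 * _]mulrC.
rewrite E1 E2 -subr_ge0.
rewrite (_ : _ - _ = (16 * d%:R ^+ 2)^-1 * (2 * d%:R * S2 - S1 ^+ 2)); last by field.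
by rewrite mulr_ge0 ?subr_ge0// invr_ge0 mulr_ge0// exprn_ge0.
Qed.

Lemma walkn_commS h m n f x z :
  walkn h n (fun y => walkn h m f (y + z) - walkn h m f y) x =
  walkn h (n + m) f (x + z) - walkn h (n + m) f x.
Proof. by rewrite walknB walkn_shift !walknD. Qed.

(* Telescoping [Q^(n+1-m)((Q^m f)^2)] in [m], each increment being at least the
   squared gradient of [Q^n f] by [walk_variance] and Jensen's inequality. *)
Lemma sqgrad_walkn_le h n f x :
  n.+1%:R / (8 * d%:R) * sqgrad h (walkn h n f) x <=
  walkn h n.+1 (fun y => f y ^+ 2) x.
Proof.
pose X m := walkn h (n.+1 - m) (fun y => walkn h m f y ^+ 2) x.
pose c := (8 * d%:R)^-1 * sqgrad h (walkn h n f) x.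
have c8 : 0 <= (8 * d%:R)^-1 :> R by rewrite invr_ge0 mulr_ge0.
have step m : (m < n.+1)%N -> c <= X m - X m.+1.
  move=> mn; rewrite /X subSS subSn// walknSr -walknB.
  apply: (@le_trans _ _ (walkn h (n - m) (fun y => (8 * d%:R)^-1 * sqgrad h (walkn h m f) y) x)).
    rewrite walknZ ler_wpM2l//.
    rewrite /sqgrad walkn_sum; apply: ler_sum => i _; rewrite walkn_add.
    have E z : walkn h n f (x + z) - walkn h n f x =
        walkn h (n - m) (fun y => walkn h m f (y + z) - walkn h m f y) x.
      by rewrite walkn_commS subnK.
    by rewrite !E; apply: lerD; exact: walkn_sqr.
  by apply: ler_walkn => y; rewrite walknS; exact: walk_variance.
have : \sum_(0 <= m < n.+1) c <= \sum_(0 <= m < n.+1) (X m - X m.+1).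
  rewrite big_nat [leRHS]big_nat; apply: ler_sum => m /andP[_]; exact: step.
rewrite sumr_const_nat subn0 -[c *+ _]mulr_natl /c mulrA => /le_trans; apply.
rewrite -[leLHS]opprK -sumrN; under eq_bigr do rewrite opprB.
rewrite telescope_sumr// opprB /X subn0 subnn lerBlDr lerDl.
exact: sqr_ge0.
Qed.

Lemma sqgrad_ge h f x i :
  (f (x + h *: e i) - f x) ^+ 2 <= sqgrad h f x.
Proof.
rewrite /sqgrad (bigD1 i)//= -addrA lerDl addr_ge0 ?sqr_ge0//.
by apply: sumr_ge0 => j _; rewrite addr_ge0 ?sqr_ge0.
Qed.

End walk.

Lemma mean_value (R : realType) (f f' : R -> R) (a b : R) : a <= b ->
  (forall x, a <= x <= b -> is_derive x 1 f (f' x)) ->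
  exists2 c, a <= c <= b & f b - f a = f' c * (b - a).
Proof.
move=> ab df.
have [||c] := @MVT_segment R f f' a b ab.
- by move=> x; rewrite in_itv/= => /andP[/ltW ? /ltW ?]; apply: df; apply/andP.
- apply: continuous_in_subspaceT => x; rewrite inE/= in_itv/= => /df dx.
  by apply: differentiable_continuous; apply/derivable1_diffP; exact: ex_derive.
- by rewrite in_itv/= => ? ?; exists c.
Qed.

(** * Power series coefficients of 1 - sqrt (1 - q) and the truncation error *)

Section coefficients.
Context {R : realType}.
Implicit Types (n N : nat) (s q : R).

(* [bcoef n = binomial(2n, n) / 4^n], and [acoef n] is the coefficient of
   [q^(n+1)] in [1 - sqrt (1 - q)]. *)
Definition bcoef n : R := \prod_(i < n) ((2 * i%:R + 1) / (2 * i%:R + 2)).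

Definition acoef n : R := bcoef n / (2 * n%:R + 2).

Lemma bcoef0 : bcoef 0 = 1. Proof. by rewrite /bcoef big_ord0. Qed.

Lemma bcoefS n : bcoef n.+1 = bcoef n * ((2 * n%:R + 1) / (2 * n%:R + 2)).
Proof. by rewrite /bcoef big_ord_recr. Qed.

Let pos2 n : 0 < 2 * n%:R + 2 :> R.
Proof. by rewrite ltr_wpDl// mulr_ge0. Qed.

Let neq2 n : 2 * n%:R + 2 != 0 :> R.
Proof. by rewrite gt_eqF. Qed.

Lemma bcoef_gt0 n : 0 < bcoef n.
Proof.
by rewrite /bcoef; apply: prodr_gt0 => i _; rewrite divr_gt0.
Qed.

Lemma acoef_gt0 n : 0 < acoef n.
Proof. by rewrite divr_gt0// bcoef_gt0. Qed.

Lemma acoefE n : acoef n = bcoef n - bcoef n.+1.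
Proof. by rewrite bcoefS /acoef; have := neq2 n => h; field. Qed.

Lemma sum_acoef m n : (m <= n)%N -> \sum_(m <= i < n) acoef i = bcoef m - bcoef n.
Proof.
move=> mn; under eq_bigr do rewrite acoefE -opprB.
by rewrite sumrN telescope_sumr// opprB.
Qed.

(** This product decreases in [n], and the one in [bcoef_ge] increases; together they place
    [bcoef n] between constant multiples of n^(-1/2). *)
Lemma bcoef_le n : bcoef n ^+ 2 * (2 * n%:R + 1) <= 1.
Proof.
elim: n => [|n IH]; first by rewrite bcoef0; lra.
apply: le_trans IH; rewrite bcoefS -subr_ge0.
have n0 : 0 <= n%:R :> R by [].
rewrite (_ : _ - _ = bcoef n ^+ 2 * (2 * n%:R + 1) / (2 * n%:R + 2) ^+ 2).
  by rewrite divr_ge0 ?sqr_ge0// mulr_ge0 ?sqr_ge0// addr_ge0// mulr_ge0.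
by rewrite -[n.+1%:R]natr1; have := neq2 n => h; field.
Qed.

Lemma bcoef_ge n : 1 <= bcoef n ^+ 2 * (4 * n%:R + 1).
Proof.
elim: n => [|n IH]; first by rewrite bcoef0; lra.
apply: (le_trans IH); rewrite bcoefS -subr_ge0.
rewrite (_ : _ - _ = bcoef n ^+ 2 / (2 * n%:R + 2) ^+ 2).
  by rewrite divr_ge0 ?sqr_ge0.
by rewrite -[n.+1%:R]natr1; have := neq2 n => h; field.
Qed.

(** With q = 1 - s^2, so that sqrt (1 - q) = s, [U N s] is the partial sum of the expansion. Its
    derivative is [s * B N s], where [B] is the partial sum of the series of (1 - q)^(-1/2) = 1 /
    s. *)
Let U N s : R := \sum_(n < N) acoef n * (1 - (1 - s ^+ 2) ^+ n.+1).

Let B N s : R := \sum_(n < N) bcoef n * (1 - s ^+ 2) ^+ n.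

Let is_derive_q s : is_derive s (1 : R) (fun z => 1 - z ^+ 2) (- (2 * s)).
Proof.
apply: derf_eq (derfB (derf_cst s 1) (derfX 2 (derf_id s))) _.
by rewrite expr1; ring.
Qed.

Let is_derive_U N s : is_derive s 1 (U N) (s * B N s).
Proof.
elim: N => [|N IH].
  rewrite (_ : U 0 = cst 0); last by apply/funext => z; rewrite /U big_ord0.
  rewrite /B big_ord0 mulr0; exact: is_derive_cst.
rewrite (_ : U N.+1 = fun z => U N z + acoef N * (1 - (1 - z ^+ 2) ^+ N.+1)).
  have D := derfZ (acoef N) (derfB (derf_cst s 1)
    (derfX N.+1 (is_derive_q s))).
  apply: derf_eq (derfD IH D) _.
  have -> : B N.+1 s = B N s + bcoef N * (1 - s ^+ 2) ^+ N.
    by rewrite /B big_ord_recr.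
  by rewrite /acoef/= -natr1; have := neq2 N => h; field.
by apply/funext => z; rewrite /U big_ord_recr.
Qed.

(** The differentiated sum telescopes to its last term, which is nonnegative on [0, 1]. For [N = 0]
    the exponent [N.-1] is harmless because of the factor [N]. *)
Let is_derive_W N s :
  is_derive s 1 (fun z => z * B N z) (2 * N%:R * bcoef N * (1 - s ^+ 2) ^+ N.-1).
Proof.
elim: N => [|N IH].
  rewrite (_ : (fun z => _) = cst 0).
    rewrite mulr0 !mul0r; exact: is_derive_cst.
  by apply/funext => z; rewrite /B big_ord0 mulr0.
rewrite (_ : (fun z => z * B N.+1 z) =
   fun z => z * B N z + z * (bcoef N * (1 - z ^+ 2) ^+ N)).
  have D := derfM (derf_id s) (derfZ (bcoef N)
    (derfX N (is_derive_q s))).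
  apply: derf_eq (derfD IH D) _.
  rewrite bcoefS -natr1; have := neq2 N => h.
  case: N {IH D} h => [|N] h /=; first by rewrite ?expr0; field.
  have := exprS (1 - s ^+ 2) N => ->; move: ((1 - s ^+ 2) ^+ N) => p.
  by field.
by apply/funext => z; rewrite /B big_ord_recr mulrDr.
Qed.

(** [s * B N s] increases up to its value at s = 1, where only the term [bcoef 0 = 1] can remain. *)
Let sB_le1 N s : 0 <= s <= 1 -> s * B N s <= 1.
Proof.
move=> /andP[s0 s1].
have [c /andP[sc c1] E] := mean_value s1 (fun z _ => is_derive_W N z).
have : 0 <= 1 * B N 1 - s * B N s.
  rewrite E mulr_ge0 ?subr_ge0//.
  rewrite mulr_ge0 ?exprn_ge0 ?subr_ge0// ?expr_le1//.
  - by rewrite !mulr_ge0// ltW// bcoef_gt0.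
  - exact: le_trans sc.
have : B N 1 <= 1.
  rewrite /B; case: N E => [|N] E; first by rewrite big_ord0.
  rewrite big_ord_recl/= bcoef0 expr0 mul1r big1 ?addr0// => i _.
  by rewrite expr1n subrr exprS mul0r mulr0.
by lra.
Qed.

(** The difference s - [U N s] has derivative 1 - [s * B N s] >= 0 and increases from 0 at s = 0 to
    [bcoef N] at s = 1. *)
Lemma sqrt_approx N q : 0 <= q <= 1 ->
  Num.sqrt (1 - q) - bcoef N <= \sum_(n < N) acoef n * (1 - q ^+ n.+1)
  <= Num.sqrt (1 - q).
Proof.
move=> /andP[q0 q1]; set s := Num.sqrt _.
have s0 : 0 <= s := sqrtr_ge0 _.
have s2 : s ^+ 2 = 1 - q by rewrite sqr_sqrtr// subr_ge0.
have s1 : s <= 1 by rewrite -[leRHS]sqrtr1 ler_sqrt//; lra.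
have -> : \sum_(n < N) acoef n * (1 - q ^+ n.+1) = U N s.
  by apply: eq_bigr => n _; rewrite s2 subKr.
have d z : is_derive z (1 : R) (fun z => z - U N z) (1 - z * B N z).
  exact: derfB (derf_id z) (is_derive_U N z).
apply/andP; split.
- have [c /andP[sc c1] /eqP] := mean_value s1 (fun z _ => d z).
  have -> : U N 1 = 1 - bcoef N.
    rewrite -[X in X - _ N]bcoef0 -sum_acoef// big_mkord; apply: eq_bigr => i _.
    by rewrite expr1n subrr exprS mul0r subr0 mulr1.
  move=> /eqP E; rewrite lerBlDr -lerBlDl.
  have : 0 <= (1 - c * B N c) * (1 - s).
    by rewrite mulr_ge0 ?subr_ge0// sB_le1// c1 (le_trans s0).
  by rewrite -E; lra.
- have [c /andP[c0 cs] E] := mean_value s0 (fun z _ => d z).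
  have : 0 <= (1 - c * B N c) * (s - 0).
    by rewrite mulr_ge0 ?subr_ge0// sB_le1// c0 (le_trans cs).
  have -> : (1 - c * B N c) * (s - 0) = s - U N s.
    rewrite -E (_ : U N 0 = 0) ?subr0//.
    by rewrite /U big1// => i _; rewrite expr0n subr0 expr1n subrr mulr0.
  by rewrite subr_ge0.
Qed.

End coefficients.

(** * Smooth periodic functions: stability, mean values, compactness *)

Section smooth_periodic.
Context {R : realType} {d : nat}.
Local Notation V := 'rV[R]_d.
Local Notation e := (@basis_vec R d).
Implicit Types (f g : V -> R) (x y z : V) (i : 'I_d) (r : R).

Definition pd i f : V -> R := 'D_(e i) f.

Record smoothT f : Prop := SmoothT {
  smoothT_periodic : torus_periodic f ;
  smoothT_Ck : forall k, Ck k f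
}.

(** Coinduction principle: a class of continuous functions with partial derivatives in the same
    class consists of smooth functions. It avoids computing iterated derivatives of products, modes
    and translates. *)
Lemma Ck_coind (P : (V -> R) -> Prop) :
  (forall f, P f -> [/\ continuous f, forall x i, derivable f x (e i) &
     forall i, P (pd i f)]) -> forall f, P f -> forall k, Ck k f.
Proof.
move=> HP f Pf k s _.
have : P (partials s f).
  by elim: s => [//|i s IH]; have [_ _ +] := HP _ IH; exact.
by move=> /HP[].
Qed.

Lemma smoothT_continuous f : smoothT f -> continuous f.
Proof. by move=> [_ /(_ 0 [::] isT)[]]. Qed.

Lemma smoothT_derivable f x i : smoothT f -> derivable f x (e i).
Proof. by move=> [_ /(_ 1 [::] isT)[_ +]] => /(_ isT); exact. Qed.

Lemma derive_translate f (v x z : V) : 'D_v (fun y => f (y + z)) x = 'D_v f (x + z).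
Proof.
rewrite /derive; suff -> : (fun h : R => h^-1 *: (f (h *: v + x + z) - f (x + z))) =
  (fun h => h^-1 *: (f (h *: v + (x + z)) - f (x + z))) by [].
by apply/funext => h; rewrite addrA.
Qed.

Lemma pd_periodic i f : torus_periodic f -> torus_periodic (pd i f).
Proof.
move=> pf x k; rewrite /pd.
have <- := derive_translate f (e i) x ((2 * pi) *: intvec k).
suff -> : (fun y => f (y + (2 * pi) *: intvec k)) = f by [].
by apply/funext => y; exact: pf.
Qed.

Lemma smoothT_pd i f : smoothT f -> smoothT (pd i f).
Proof.
move=> [pf cf]; split; first exact: pd_periodic.
move=> k s sk; have E : partials s (pd i f) = partials (rcons s i) f.
  by rewrite /partials /iter_derive map_rcons foldr_rcons.
rewrite E; have := cf k.+1 (rcons s i).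
by rewrite size_rcons !ltnS => /(_ sk)[].
Qed.

Lemma pdM i f g x : smoothT f -> smoothT g ->
  pd i (fun y => f y * g y) x = pd i f x * g x + f x * pd i g x.
Proof.
move=> sf sg; rewrite /pd; have := @deriveM R V f g x (e i) (smoothT_derivable sf)
  (smoothT_derivable sg).
by rewrite /GRing.scale/= => ->; rewrite addrC [g x * _]mulrC.
Qed.

Lemma pd_lin i (a : R) f g x : smoothT f -> smoothT g ->
  pd i (fun y => a * f y + g y) x = a * pd i f x + pd i g x.
Proof.
move=> sf sg; rewrite /pd.
have df := smoothT_derivable (x := x) (i := i) sf.
have dg := smoothT_derivable (x := x) (i := i) sg.
have := @deriveD R V R (a \*: f) g x (e i) (derivableZ df) dg.
by move=> ->; congr (_ + _); exact: deriveZ.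
Qed.

Lemma pd_cst i (a : R) x : pd i (fun=> a) x = 0.
Proof. by rewrite /pd; exact: derive_cst. Qed.

(* Stable under [pd] by the Leibniz rule, so that [Ck_coind] applies. *)
Inductive smooth_alg : (V -> R) -> Prop :=
| salg_base f : smoothT f -> smooth_alg f
| salg_cst a : smooth_alg (fun=> a)
| salg_add f g : smooth_alg f -> smooth_alg g -> smooth_alg (fun x => f x + g x)
| salg_mul f g : smooth_alg f -> smooth_alg g -> smooth_alg (fun x => f x * g x).

Let salg_prop f : smooth_alg f -> [/\ torus_periodic f, continuous f,
  forall x i, derivable f x (e i) & forall i, smooth_alg (pd i f)].
Proof.
elim => {f} [f sf|a|f g sf [pf cf df af] sg [pg cg dg ag]
  |f g sf [pf cf df af] sg [pg cg dg ag]].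
- split; [exact: smoothT_periodic|exact: smoothT_continuous| |].
    by move=> x i; exact: smoothT_derivable.
  by move=> i; apply: salg_base; exact: smoothT_pd.
- split=> //; first by move=> x; exact: cst_continuous.
  move=> i; rewrite (_ : pd i _ = (fun=> 0)); first exact: salg_cst.
  by apply/funext => x; rewrite pd_cst.
- split.
  + by move=> x k; rewrite pf pg.
  + by move=> x; apply: continuousD; [exact: cf|exact: cg].
  + by move=> x i; apply: derivableD.
  + move=> i; rewrite (_ : pd i _ = (fun x => pd i f x + pd i g x)).
      exact: salg_add.
    by apply/funext => x; rewrite /pd; exact: (@deriveD R V R f g).
- split.
  + by move=> x k; rewrite pf pg.
  + by move=> x; apply: continuousM; [exact: cf|exact: cg].
  + by move=> x i; apply: derivableM.
  + move=> i; rewrite (_ : pd i _ = (fun x => f x * pd i g x + g x * pd i f x)).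
      by apply: salg_add; apply: salg_mul.
    by apply/funext => x; rewrite /pd; exact: (@deriveM R V f g).
Qed.

Lemma salg_smoothT f : smooth_alg f -> smoothT f.
Proof.
move=> sf; apply: SmoothT; first by have [] := salg_prop sf.
apply: (@Ck_coind smooth_alg) => // g /salg_prop[pg cg dg ag].
by split.
Qed.

Lemma smoothT_cst a : smoothT (fun=> a).
Proof. exact/salg_smoothT/salg_cst. Qed.

Lemma smoothTD f g : smoothT f -> smoothT g -> smoothT (fun x => f x + g x).
Proof. by move=> sf sg; apply/salg_smoothT/salg_add; exact: salg_base. Qed.

Lemma smoothTM f g : smoothT f -> smoothT g -> smoothT (fun x => f x * g x).
Proof. by move=> sf sg; apply/salg_smoothT/salg_mul; exact: salg_base. Qed.

Lemma smoothTX2 f : smoothT f -> smoothT (fun x => f x ^+ 2).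
Proof.
move=> sf; rewrite (_ : (fun x => _) = (fun x => f x * f x)); first exact: smoothTM.
by apply/funext => x; rewrite expr2.
Qed.

Lemma smoothTZ a f : smoothT f -> smoothT (fun x => a * f x).
Proof. by move=> sf; apply: smoothTM => //; exact: smoothT_cst. Qed.

Lemma smoothTB f g : smoothT f -> smoothT g -> smoothT (fun x => f x - g x).
Proof.
move=> sf sg; rewrite (_ : (fun x => _) = (fun x => f x + -1 * g x)).
  by apply: smoothTD => //; exact: smoothTZ.
by apply/funext => x; rewrite mulN1r.
Qed.

Lemma smoothT_sum (I : Type) (s : seq I) (F : I -> V -> R) :
  (forall j, smoothT (F j)) -> smoothT (fun x => \sum_(j <- s) F j x).
Proof.
move=> sF; elim: s => [|j s IH].
  rewrite (_ : (fun x => _) = (fun=> 0)); first exact: smoothT_cst.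
  by apply/funext => x; rewrite big_nil.
rewrite (_ : (fun x => _) = (fun x => F j x + \sum_(j <- s) F j x)).
  exact: smoothTD.
by apply/funext => x; rewrite big_cons.
Qed.

Lemma is_derive_line f x i r : derivable f (x + r *: e i) (e i) ->
  is_derive r (1 : R) (fun t => f (x + t *: e i)) (pd i f (x + r *: e i)).
Proof.
move=> df.
have E : (fun h : R => h^-1 *: (f (x + (h *: 1 + r) *: e i) - f (x + r *: e i))) =
         (fun h : R => h^-1 *: (f (h *: e i + (x + r *: e i)) - f (x + r *: e i))).
  apply/funext => h; congr (_ *: (f _ - _)).
  by rewrite scalerDl addrCA [h *: 1]mulr1.
apply: DeriveDef.
  by move: df; rewrite /derivable /= -E.
by rewrite /derive/= E.
Qed.

Lemma line_mean_value f i x (a b : R) :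
  (forall y, derivable f y (e i)) -> a <= b ->
  exists2 c, a <= c <= b &
    f (x + b *: e i) - f (x + a *: e i) = pd i f (x + c *: e i) * (b - a).
Proof.
move=> df ab.
have [|c abc E] := @mean_value R (fun t => f (x + t *: e i))
  (fun t => pd i f (x + t *: e i)) a b ab.
  by move=> t _; exact: is_derive_line.
by exists c.
Qed.

Definition reduce x : V := \row_i (x ord0 i - 2 * pi * (Num.floor (x ord0 i / (2 * pi)))%:~R).

Lemma reduceE f x : torus_periodic f -> f (reduce x) = f x.
Proof.
move=> pf; rewrite -(pf (reduce x) (\row_i Num.floor (x ord0 i / (2 * pi)))).
by congr f; apply/rowP => i; rewrite !mxE subrK.
Qed.

Lemma reduce_cell x : torus_cell (reduce x).
Proof.
move=> i; rewrite mxE; set t := x ord0 i.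
have p0 : 0 < 2 * pi :> R by rewrite mulr_gt0// pi_gt0.
have := floor_itv (t / (2 * pi)) => /andP[].
rewrite intrD; move: (Num.floor _)%:~R => m.
rewrite ler_pdivlMr// ltr_pdivrMr// => h1 h2.
by apply/andP; split; lra.
Qed.

Lemma compact_torus_cell : compact (@torus_cell R d).
Proof.
have := @rV_compact R d (fun=> `[0, 2 * pi]%classic).
move=> /(_ (fun=> @segment_compact R 0 (2 * pi))).
by under eq_set do under eq_forall do rewrite /= in_itv/=.
Qed.

Lemma periodic_max f : continuous f -> torus_periodic f ->
  exists x, torus_cell x /\ forall y, f y <= f x.
Proof.
move=> cf pf.
have [||x] := @EVT_max_rV R d f (@torus_cell R d) _ compact_torus_cell.
- by exists (reduce 0); exact: reduce_cell.
- exact: continuous_subspaceT.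
rewrite inE => xc H; exists x; split => // y.
by rewrite -(reduceE _ pf); apply: H; rewrite inE; exact: reduce_cell.
Qed.

Lemma periodic_bounded f : continuous f -> torus_periodic f ->
  exists2 K, 0 < K & forall x, `|f x| <= K.
Proof.
move=> cf pf.
have [x [_ Hx]] := @periodic_max (fun y => `|f y|)
  (fun y => continuous_comp (cf y) (@norm_continuous _ _ _)) (fun y k => congr1 _ (pf y k)).
by exists (`|f x| + 1) => [|y]; [rewrite ltr_wpDl|rewrite (le_trans (Hx y))// lerDl].
Qed.

End smooth_periodic.

(** * Integration over the torus: measurability, Fubini, translation invariance *)

Section torus_integral.
Context {R : realType}.
Local Notation leb := (@lebesgue_measure R).

Definition grid_point d (n : nat) (k : 'rV[int]_d) : 'rV[R]_d :=
  \row_i ((k ord0 i)%:~R / n.+1%:R).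

Definition grid_floor d (n : nat) (x : 'rV[R]_d) : 'rV[int]_d :=
  \row_i Num.floor (x ord0 i * n.+1%:R).

Lemma grid_dist d n (x : 'rV[R]_d) : `|x - grid_point n (grid_floor n x)| <= n.+1%:R^-1.
Proof.
rewrite /Num.Def.normr/= mx_normrE; apply: bigmax_le => // -[i j] _ /=.
rewrite !mxE ord1; set t := x ord0 j.
have n0 : 0 < n.+1%:R :> R by rewrite ltr0n.
have := floor_itv (t * n.+1%:R) => /andP[].
rewrite intrD; move: (Num.floor _)%:~R => m h1 h2.
rewrite (_ : t - m / n.+1%:R = (t * n.+1%:R - m) / n.+1%:R); last first.
  by rewrite mulrBl mulfK// gt_eqF.
rewrite normrM normfV (ger0_norm (ltW n0)) ler_pdivrMr// mulVf ?gt_eqF//.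
by rewrite ger0_norm; lra.
Qed.

(** The sigma-algebra on row vectors is generated by the coordinates, so continuity is linked to it
    by approximation: [f] is the pointwise limit of functions constant on the countably many cubes
    of a grid, which are products of half-open intervals. *)
Lemma continuous_measurable_rV d (f : 'rV[R]_d -> R) : continuous f ->
  measurable_fun setT (f : 'rV[R]_d -> measurableTypeR R).
Proof.
move=> cf.
apply: (@measurable_realfun.measurable_fun_cvg _ _ _ setT
   (fun n x => f (grid_point n (grid_floor n x)))).
  move=> n _ B mB; rewrite setTI.
  rewrite (_ : _ @^-1` _ = \bigcup_(k : 'rV[int]_d)
    ([set x | grid_floor n x = k] `&` [set x | B (f (grid_point n k))])); last first.
    apply/seteqP; split => [x /= Bx|x [k _ [/= <-]]//].
    by exists (grid_floor n x).
  apply: countable_bigcupT_measurable; first exact: countableP.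
  move=> k; apply: measurableI; last first.
    by have [bk|bk] := pselect (B (f (grid_point n k)));
      [rewrite (_ : mkset _ = setT)//|rewrite (_ : mkset _ = set0)//];
      apply/seteqP; split.
  rewrite (_ : mkset _ = \bigcap_(i : 'I_d)
     ((fun x : 'rV[R]_d => x ord0 i : measurableTypeR R) @^-1`
       `[(k ord0 i)%:~R / n.+1%:R, (k ord0 i + 1)%:~R / n.+1%:R[)).
    apply: fin_bigcap_measurable; first exact: finite_finset.
    move=> i _; rewrite -[X in measurable X]setTI.
    by apply: measurable_coor => //; exact: measurable_itv.
  have n0 : 0 < n.+1%:R :> R by rewrite ltr0n.
  apply/seteqP; split => x /=.
    move=> <- i _; rewrite /= in_itv/= ler_pdivrMr// ltr_pdivlMr// mxE.
    exact: floor_itv.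
  move=> H; apply/rowP => i; rewrite mxE.
  by apply: floor_def; have := H i I; rewrite /= in_itv/= ler_pdivrMr// ltr_pdivlMr.
move=> x _; apply: continuous_cvg; first exact: cf.
apply/cvgrPdist_le => e e0; near=> n.
apply: le_trans (grid_dist n x) _.
rewrite invf_ple ?posrE// -natr1; near: n.
exists (Num.bound e^-1) => // m /= hm.
rewrite (@le_trans _ _ m%:R) ?lerDl//.
rewrite (@le_trans _ _ (Num.bound e^-1)%:R) ?ler_nat//.
by apply: ltW; apply: le_lt_trans (archi_boundP _); rewrite ?ler_norm// invr_ge0 ltW.
Unshelve. all: by end_near. Qed.

Lemma integral_mrestr dd (T : measurableType dd) (m : {measure set T -> \bar R})
   (D : set T) (mD : measurable D) (f : T -> \bar R) :
  measurable_fun setT f -> (mrestr m mD).-integrable setT f ->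
  (\int[mrestr m mD]_x f x = \int[m]_(x in D) f x)%E.
Proof.
move=> mf intf.
rewrite (@negligible_integral _ _ _ _ setT (~` D))//; last first.
  - by rewrite /= /mrestr setICl measure0.
  - exact: measurableC.
rewrite setTD setCK; apply: eq_measure_integral => A mA AD.
by rewrite /= /mrestr setIidl.
Qed.

Lemma cons_rV_cell n :
  @cons_rV R n @^-1` (@torus_cell R n.+1) = `[0, 2 * pi] `*` @torus_cell R n.
Proof.
apply/seteqP; split => -[a x] /=.
  move=> H; split; first by have := H ord0; rewrite mxE unlift_none in_itv.
  by move=> i; have := H (lift ord0 i); rewrite mxE liftK.
rewrite in_itv/= => -[ha hx] i; rewrite mxE.
by case: unliftP => [j _|_] //=; exact: hx.
Qed.

Let leb2pi : leb `[0, 2 * pi] = (2 * pi)%:E.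
Proof.
rewrite lebesgue_measure_itv/= lte_fin mulr_gt0 ?pi_gt0//.
by rewrite oppr0 adde0.
Qed.

Lemma lebesgue_cell d : lebesgue_rV d (@torus_cell R d) = ((2 * pi) ^+ d)%:E.
Proof.
elim: d => [|n IH] /=.
  by rewrite diracE expr0 mem_set//; case.
rewrite /lebesgue_step /pushforward cons_rV_cell product_measure1E//=.
  by rewrite IH leb2pi exprS.
exact: measurable_torus_cell.
Qed.

Lemma torus_measureT d : torus_measure d [set: 'rV[R]_d] = ((2 * pi) ^+ d)%:E.
Proof. by rewrite /torus_measure /mrestr setTI lebesgue_cell. Qed.

Let bounded_int dd (T : measurableType dd) (m : {measure set T -> \bar R})
   (D : set T) (f : T -> R) (K : R) : measurable D -> (m D < +oo)%E ->
   measurable_fun D f -> (forall x, `|f x| <= K) -> m.-integrable D (EFin \o f).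
Proof.
move=> mD mDoo mf fK; apply: measurable_bounded_integrable => //.
exists K; split; first exact: num_real.
by move=> M KM x _ /=; rewrite (le_trans (fK x))// ltW.
Qed.

Lemma torus_integrable d (f : 'rV[R]_d -> R) (K : R) :
  measurable_fun setT f -> (forall x, `|f x| <= K) ->
  (torus_measure d).-integrable setT (EFin \o f).
Proof.
by move=> mf; apply: bounded_int => //=; rewrite torus_measureT ltry.
Qed.

Lemma torus_integralE d (f : 'rV[R]_d -> R) (K : R) :
  measurable_fun setT f -> (forall x, `|f x| <= K) ->
  \int[torus_measure d]_x f x = \int[lebesgue_rV d]_(x in @torus_cell R d) f x.
Proof.
move=> mf fK; rewrite /Rintegral; congr fine.
apply: integral_mrestr; first exact/measurable_EFinP.
exact: torus_integrable fK.
Qed.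

(** Fubini for the first coordinate: Lebesgue measure in dimension n + 1 is by definition the image
    of a product under [cons_rV]. It is the induction step for all later facts about torus
    integrals. *)
Lemma torus_integralS n (f : 'rV[R]_n.+1 -> R) (K : R) :
  measurable_fun setT f -> (forall x, `|f x| <= K) ->
  \int[torus_measure n.+1]_x f x =
  \int[leb]_(a in `[0, 2 * pi]) \int[torus_measure n]_x f (cons_rV (a, x)).
Proof.
move=> mf fK.
have mc := @measurable_cons_rV R n.
have mfc : measurable_fun setT (f \o @cons_rV R n) by exact: measurableT_comp.
have mC m : measurable (@torus_cell R m) by exact: measurable_torus_cell.
have mD : measurable (`[0, 2 * pi] `*` @torus_cell R n : set (measurableTypeR R * _)).
  exact: measurableX.
have intP : (leb \x lebesgue_rV n)%E.-integrable (`[0, 2 * pi] `*` @torus_cell R n)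
     (EFin \o (f \o @cons_rV R n)).
  apply: (bounded_int mD _ _ (fun x => fK _)); last exact: measurable_funTS.
  rewrite /= product_measure1E//; last exact: mC.
  rewrite [ltLHS](_ : _ = ((2 * pi)%:E * ((2 * pi) ^+ n)%:E)%E) ?ltry//.
  by congr (_ * _)%E; [exact: leb2pi|exact: lebesgue_cell].
rewrite (torus_integralE mf fK) /Rintegral /= /lebesgue_step.
rewrite integral_pushforward//; last 3 first.
- exact/measurable_EFinP.
- by rewrite cons_rV_cell.
- exact: mC.
rewrite cons_rV_cell integral_mkcond.
rewrite -integral12_prod_meas1; last first.
  by apply/(integrable_mkcond _ mD).
rewrite [in RHS]integral_mkcond; congr fine; apply: eq_integral => a _ /=.
rewrite [RHS]patchE /fubini_F.
case: ifPn => [aI|aI]; last first.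
  rewrite integral0_eq// => x _; rewrite patchE.
  by case: ifPn => //; rewrite inE/= => -[]; rewrite notin_setE in aI.
have mfa : measurable_fun setT (fun x => f (cons_rV (a, x))).
  by apply: (measurableT_comp mfc); exact: pair1_measurable.
have intC : (lebesgue_rV n).-integrable (@torus_cell R n) (fun x => (f (cons_rV (a, x)))%:E).
  apply: (bounded_int (mC n) _ _ (fun x => fK _)); last exact: measurable_funTS.
  rewrite [ltLHS](_ : _ = ((2 * pi) ^+ n)%:E) ?ltry//.
  exact: lebesgue_cell.
move: (torus_integralE mfa (fun x => fK _)); rewrite /Rintegral /= => ->.
rewrite fineK; last first.
  by apply: integrable_fin_num => //; exact: mC.
rewrite [in RHS]integral_mkcond; apply: eq_integral => x _.
rewrite !patchE; rewrite inE in aI.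
by congr (if _ then _ else _); apply/idP/idP; rewrite !inE/= => // -[].
Qed.

End torus_integral.

Section torus_calculus.
Context {R : realType}.
Local Notation leb := (@lebesgue_measure R).

Lemma antiderivative (f : R -> R) (a b : R) : continuous f ->
  exists F : R -> R, forall x, a < x < b -> is_derive x (1 : R) F (f x).
Proof.
move=> cf; exists (fun x => \int[leb]_(t in `[a, x]) f t) => x /andP[ax xb].
have intf : leb.-integrable `[a, b] (EFin \o f).
  apply: continuous_compact_integrable; first exact: segment_compact.
  exact: continuous_subspaceT.
have [dF F'] := @continuous_FTC1_closed R f a x b xb intf ax (cf x).
by apply: DeriveDef; [exact: dF|rewrite -derive1E].
Qed.

Lemma fundamental_thm (f F : R -> R) (a b : R) : a < b -> continuous f ->
  (forall x, a <= x <= b -> is_derive x (1 : R) F (f x)) ->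
  \int[leb]_(t in `[a, b]) f t = F b - F a.
Proof.
move=> ab cf dF.
have cF x : a <= x <= b -> {for x, continuous F}.
  move=> /dF ?; apply: differentiable_continuous.
  by apply/derivable1_diffP; exact: ex_derive.
rewrite /Rintegral (@continuous_FTC2 R f F a b ab) ?EFinB//.
- exact: continuous_subspaceT.
- split.
  + move=> x; rewrite in_itv/= => /andP[/ltW ? /ltW ?].
    have /dF ? : a <= x <= b by apply/andP.
    exact: ex_derive.
  + by apply: cvg_at_right_filter; apply: cF; rewrite lexx ltW.
  + by apply: cvg_at_left_filter; apply: cF; rewrite lexx ltW.
- move=> x; rewrite in_itv/= => /andP[/ltW ? /ltW ?].
  have /dF ? : a <= x <= b by apply/andP.
  by rewrite derive1E derive_val.
Qed.

(** With [F] an antiderivative, F (z + T) - F z has derivative f (z + T) - f z = 0 in z. *)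
Lemma integral_periodic_shift (f : R -> R) (T z : R) : 0 < T -> continuous f ->
  (forall x, f (x + T) = f x) ->
  \int[leb]_(t in `[0, T]) f (t + z) = \int[leb]_(t in `[0, T]) f t.
Proof.
move=> T0 cf pf.
(* The antiderivative has its derivative at interior points only; this interval contains in its
   interior all x + y with x in [0, T] and y between - |z| and |z|. *)
have [F dF] := antiderivative (- `|z| - 1) (`|z| + T + 1) cf.
have dFs y x : - `|z| <= y <= `|z| -> 0 <= x <= T ->
    is_derive x (1 : R) (fun t => F (t + y)) (f (x + y)).
  move=> /andP[? ?] /andP[? ?].
  have D : is_derive (x + y) (1 : R) F (f (x + y)) by apply: dF; apply/andP; split; lra.
  have := @is_derive1_comp R F (fun t => t + y) x _ _ D
    (derfD (derf_id x) (derf_cst x y)).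
  by rewrite addr0 mulr1.
have zz : - `|z| <= z <= `|z| by rewrite -ler_norml lexx.
have z0 : - `|z| <= 0 <= `|z| by rewrite oppr_le0 normr_ge0.
have cfz y : continuous (fun t => f (t + y)).
  by move=> x; apply: continuous_comp; [apply: cvgD; [exact: cvg_id|exact: cvg_cst]|exact: cf].
rewrite (fundamental_thm T0 (cfz z) (fun x hx => dFs z x zz hx)).
have := fundamental_thm T0 (cfz 0) (fun x hx => dFs 0 x z0 hx).
under eq_Rintegral do rewrite addr0.
move=> ->; rewrite !add0r addr0.
have dG y : - `|z| <= y <= `|z| -> is_derive y (1 : R) (fun t => F (t + T) - F t) 0.
  move=> yz; rewrite -(subrr (f y)) -{1}(pf y).
  apply: derfB.
    have D := dFs y T yz; rewrite ltW// lexx in D.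
    have DT : is_derive (y + T) (1 : R) F (f (y + T)).
      by apply: dF; move: yz => /andP[? ?]; apply/andP; split; lra.
    have := @is_derive1_comp R F (fun t => t + T) y _ _ DT
      (derfD (derf_id y) (derf_cst y T)).
    by rewrite addr0 mulr1.
  by apply: dF; move: yz => /andP[? ?]; apply/andP; split; lra.
have [zp|zn] := leP 0 z.
  have [|c _] := @mean_value R (fun t => F (t + T) - F t) (fun=> 0) 0 z zp.
    move=> x /andP[? ?]; apply: dG; rewrite ger0_norm//; apply/andP; split; lra.
  by rewrite mul0r add0r (addrC T); lra.
have [|c _] := @mean_value R (fun t => F (t + T) - F t) (fun=> 0) z 0 (ltW zn).
  move=> x /andP[? ?]; apply: dG; rewrite ltr0_norm//; apply/andP; split; lra.
by rewrite mul0r add0r (addrC T); lra.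
Qed.

(** The antiderivative is monotone with equal values at both ends, hence constant; a point where [f]
    is positive would give an interval on which the mean value theorem contradicts this. *)
Lemma integral_eq0_continuous (f : R -> R) (a b : R) : a < b -> continuous f ->
  (forall x, 0 <= f x) -> \int[leb]_(t in `[a, b]) f t = 0 ->
  forall x, a <= x <= b -> f x = 0.
Proof.
move=> ab cf f0.
have [F dF] := antiderivative (a - 1) (b + 1) cf.
have dF' x : a <= x <= b -> is_derive x (1 : R) F (f x).
  by move=> /andP[? ?]; apply: dF; apply/andP; split; lra.
rewrite (fundamental_thm ab cf dF') => Fab.
have mono x y : a <= x -> x <= y -> y <= b -> F x <= F y.
  move=> ax xy yb; have [|c _ E] := @mean_value R F f x y xy.
    by move=> z /andP[? ?]; apply: dF'; apply/andP; split; lra.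
  by rewrite -subr_ge0 E mulr_ge0// subr_ge0.
have Fc x : a <= x <= b -> F x = F a.
  move=> /andP[ax xb]; have h1 := mono _ _ (lexx a) ax xb.
  have h2 := mono _ _ ax xb (lexx b).
  by lra.
move=> x /andP[ax xb]; apply/eqP; rewrite eq_le f0 andbT leNgt; apply/negP => fx.
have [e e0 He] : exists2 e, 0 < e & forall y, `|x - y| < e -> 0 < f y.
  have /cvgrPdist_lt /(_ _ fx) /nbhs_ballP[e /= e0 He] := cf x.
  by exists e => // y /He /=; have := ler_norm (f x - f y); lra.
(* A neighbourhood of [x] on which [f] is positive, clipped to [a, b]; it keeps positive length even
   when [x] is an endpoint. *)
pose p := Num.max a (x - e / 2); pose q := Num.min b (x + e / 2).
have pq : p < q by rewrite /p /q gt_max !lt_min; apply/andP; split; apply/andP; split; lra.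
have ap : a <= p by rewrite /p le_max lexx.
have qb : q <= b by rewrite /q ge_min lexx.
have [|c /andP[pc cq] E] := @mean_value R F f p q (ltW pq).
  by move=> z /andP[? ?]; apply: dF'; apply/andP; split; lra.
have : 0 < f c.
  apply: He; rewrite ltr_norml.
  have : x - e / 2 <= p by rewrite /p le_max lexx orbT.
  have : q <= x + e / 2 by rewrite /q ge_min lexx orbT.
  by move=> *; apply/andP; split; lra.
have -> : f c = 0.
  apply/eqP; have /eqP := E; rewrite !Fc ?subrr; try by apply/andP; split; lra.
  by rewrite eq_sym mulf_eq0 subr_eq0 (gt_eqF pq) orbF.
by rewrite ltxx.
Qed.

Definition cper d (f : 'rV[R]_d -> R) := continuous f /\ torus_periodic f.

Definition tint d (f : 'rV[R]_d -> R) : R := \int[torus_measure d]_x f x.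

Lemma cper_integrable d (f : 'rV[R]_d -> R) : cper f ->
  (torus_measure d).-integrable setT (EFin \o f).
Proof.
move=> [cf pf]; have [K _ fK] := periodic_bounded cf pf.
exact: torus_integrable (continuous_measurable_rV cf) fK.
Qed.

Lemma cper_cst d (a : R) : cper (fun _ : 'rV[R]_d => a).
Proof. by split => // x; exact: cst_continuous. Qed.

Lemma cperD d (f g : 'rV[R]_d -> R) : cper f -> cper g -> cper (fun x => f x + g x).
Proof.
move=> [cf pf] [cg pg]; split; last by move=> x k; rewrite pf pg.
by move=> x; apply: continuousD; [exact: cf|exact: cg].
Qed.

Lemma cperM d (f g : 'rV[R]_d -> R) : cper f -> cper g -> cper (fun x => f x * g x).
Proof.
move=> [cf pf] [cg pg]; split; last by move=> x k; rewrite pf pg.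
by move=> x; apply: continuousM; [exact: cf|exact: cg].
Qed.

Lemma cper_comp d (phi : R -> R) (f : 'rV[R]_d -> R) : continuous phi -> cper f ->
  cper (fun x => phi (f x)).
Proof.
move=> cphi [cf pf]; split; last by move=> x k; rewrite pf.
by move=> x; apply: continuous_comp; [exact: cf|exact: cphi].
Qed.

Lemma cperZ d (a : R) (f : 'rV[R]_d -> R) : cper f -> cper (fun x => a * f x).
Proof. by move=> cf; apply: cperM => //; exact: cper_cst. Qed.

Lemma cperN d (f : 'rV[R]_d -> R) : cper f -> cper (fun x => - f x).
Proof.
move=> cf; rewrite (_ : (fun x => _) = (fun x => -1 * f x)); first exact: cperZ.
by apply/funext => x; rewrite mulN1r.
Qed.

Lemma cperB d (f g : 'rV[R]_d -> R) : cper f -> cper g -> cper (fun x => f x - g x).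
Proof. by move=> cf cg; exact: (cperD cf (cperN cg)). Qed.

Lemma cper_shift d (f : 'rV[R]_d -> R) (z : 'rV[R]_d) : cper f ->
  cper (fun x => f (x + z)).
Proof.
move=> [cf pf]; split; last by move=> x k; rewrite addrAC pf.
move=> x; apply: (@cvg_comp _ _ _ (fun x => x + z) f _ (nbhs (x + z))).
  have : {for x, continuous (id \+ cst z)}.
    by apply: continuousD; [exact: cvg_id|exact: cst_continuous].
  exact.
exact: cf.
Qed.

Lemma cper_sum d (I : Type) (s : seq I) (F : I -> 'rV[R]_d -> R) :
  (forall i, cper (F i)) -> cper (fun x => \sum_(i <- s) F i x).
Proof.
move=> sF; elim: s => [|i s IH].
  rewrite (_ : (fun x => _) = (fun=> 0)); first exact: cper_cst.
  by apply/funext => x; rewrite big_nil.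
rewrite (_ : (fun x => _) = (fun x => F i x + \sum_(i <- s) F i x)).
  exact: cperD.
by apply/funext => x; rewrite big_cons.
Qed.

Lemma tintD d (f g : 'rV[R]_d -> R) : cper f -> cper g ->
  tint (fun x => f x + g x) = tint f + tint g.
Proof. by move=> cf cg; apply: RintegralD => //; exact: cper_integrable. Qed.

Lemma tintB d (f g : 'rV[R]_d -> R) : cper f -> cper g ->
  tint (fun x => f x - g x) = tint f - tint g.
Proof. by move=> cf cg; apply: RintegralB => //; exact: cper_integrable. Qed.

Lemma tintZ d (a : R) (f : 'rV[R]_d -> R) : cper f ->
  tint (fun x => a * f x) = a * tint f.
Proof. by move=> cf; apply: RintegralZl => //; exact: cper_integrable. Qed.

Lemma tint_cst d (a : R) : tint (fun _ : 'rV[R]_d => a) = a * (2 * pi) ^+ d.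
Proof.
rewrite /tint Rintegral_cst//; congr (_ * _).
exact: (congr1 fine (@torus_measureT R d)).
Qed.

Lemma tint_sum d (I : Type) (s : seq I) (F : I -> 'rV[R]_d -> R) :
  (forall i, cper (F i)) ->
  tint (fun x => \sum_(i <- s) F i x) = \sum_(i <- s) tint (F i).
Proof.
move=> sF; elim: s => [|i s IH].
  rewrite big_nil (_ : (fun x => _) = (fun=> 0)) ?tint_cst ?mul0r//.
  by apply/funext => x; rewrite big_nil.
rewrite big_cons -IH -tintD//; last exact: cper_sum.
rewrite (_ : (fun x => \sum_(i <- _) _) = (fun x => F i x + \sum_(i <- s) F i x))//.
by apply/funext => x; rewrite big_cons.
Qed.

Lemma tint_le d (f g : 'rV[R]_d -> R) : cper f -> cper g ->
  (forall x, f x <= g x) -> tint f <= tint g.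
Proof.
move=> cf cg fg; apply: le_Rintegral => //; exact: cper_integrable.
Qed.

Lemma tint_bound d (f : 'rV[R]_d -> R) (K : R) : cper f ->
  (forall x, `|f x| <= K) -> `|tint f| <= K * (2 * pi) ^+ d.
Proof.
move=> cf fK; rewrite -tint_cst ler_norml; apply/andP; split.
  rewrite -mulN1r -tintZ; last exact: cper_cst.
  apply: tint_le => //; first exact/cperZ/cper_cst.
  by move=> x; rewrite mulN1r; have := fK x; rewrite ler_norml => /andP[].
apply: tint_le => //; first exact: cper_cst.
by move=> x; have := fK x; rewrite ler_norml => /andP[].
Qed.

End torus_calculus.

Section torus_fubini.
Context {R : realType}.
Local Notation leb := (@lebesgue_measure R).

Lemma cons_rVD n (a b : R) (x y : 'rV[R]_n) :
  cons_rV (a + b, x + y) = cons_rV (a, x) + cons_rV (b, y).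
Proof. by apply/rowP => i; rewrite !mxE; case: unliftP => [j _|_] /=; rewrite ?mxE. Qed.

Lemma norm_cons_rV n (a : R) (x : 'rV[R]_n) : `|cons_rV (a, x)| <= Num.max `|a| `|x|.
Proof.
rewrite [leLHS]/Num.Def.normr/= mx_normrE; apply: bigmax_le.
  by rewrite le_max normr_ge0.
move=> [i j] _ /=; rewrite mxE ord1; case: unliftP => [k _|_] /=.
  rewrite le_max; apply/orP; right.
  by rewrite [leRHS]/Num.Def.normr/= mx_normrE; apply/bigmax_geP; right => /=; exists (ord0, k).
by rewrite le_max lexx.
Qed.

Lemma cons_rVB n (a b : R) (x y : 'rV[R]_n) :
  cons_rV (a, x) - cons_rV (b, y) = cons_rV (a - b, x - y).
Proof. by apply/rowP => i; rewrite !mxE; case: unliftP => [j _|_] /=; rewrite ?mxE. Qed.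

Lemma cons_rV_continuousl n (x : 'rV[R]_n) : continuous (fun a : R => cons_rV (a, x)).
Proof.
move=> a; apply/cvgrPdist_lt => e e0; near=> b.
rewrite cons_rVB (le_lt_trans (norm_cons_rV _ _))// subrr normr0.
rewrite gt_max e0 andbT; near: b.
by have /cvgrPdist_lt := @cvg_id _ (nbhs a); apply.
Unshelve. all: by end_near. Qed.

Lemma cons_rV_continuousr n (a : R) : continuous (fun x : 'rV[R]_n => cons_rV (a, x)).
Proof.
move=> x B /nbhs_ballP[e e0 He]; apply/nbhs_ballP; exists e => // y.
rewrite -ball_normE /= => xy; apply: He; rewrite -ball_normE /=.
rewrite cons_rVB (le_lt_trans (norm_cons_rV _ _))// subrr normr0.
by rewrite gt_max xy andbT; exact: e0.
Qed.

Lemma cons_rV_intvec n (m : int) (k : 'rV[int]_n) :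
  cons_rV (2 * pi * m%:~R, (2 * pi) *: intvec k) =
  (2 * pi) *: intvec (\row_i (if unlift ord0 i is Some j then k ord0 j else m)) :> 'rV[R]_n.+1.
Proof. by apply/rowP => i; rewrite !mxE; case: unliftP => [j _|_] /=; rewrite ?mxE. Qed.

Lemma slice_cper n (f : 'rV[R]_n.+1 -> R) (a : R) : cper f ->
  cper (fun x => f (cons_rV (a, x))).
Proof.
move=> [cf pf]; split.
  move=> x; apply: (@cvg_comp _ _ _ (fun x => cons_rV (a, x)) f _ (nbhs (cons_rV (a, x)))).
    exact: cons_rV_continuousr.
  exact: cf.
move=> x k; rewrite -{1}(addr0 a) cons_rVD -{1}(mulr0 (2 * pi)).
by rewrite (cons_rV_intvec 0) pf.
Qed.

Lemma slice_tint_continuous n (f : 'rV[R]_n.+1 -> R) : cper f ->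
  continuous (fun a => tint (fun x => f (cons_rV (a, x)))).
Proof.
move=> cpf; have [cf pf] := cpf; move=> a.
have [K _ fK] := periodic_bounded cf pf.
have := @continuity_under_integral R _ _ (torus_measure n : {measure set _ -> \bar R})
  (fun a x => f (cons_rV (a, x))) setT measurableT (a - 1) (a + 1)
  (fun b _ => cper_integrable (slice_cper b cpf)) _ (fun=> K)
  (cper_integrable (cper_cst n K)) _.
apply.
- apply: aeW => x _ b _.
  apply: (@cvg_comp _ _ _ (fun b => cons_rV (b, x)) f _ (nbhs (cons_rV (b, x)))).
    exact: cons_rV_continuousl.
  exact: cf.
- by move=> b _; apply: aeW => x _.
- by rewrite inE/= in_itv/=; apply/andP; split; lra.
Qed.

Lemma tintS n (f : 'rV[R]_n.+1 -> R) : cper f ->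
  tint f = \int[leb]_(a in `[0, 2 * pi]) tint (fun x => f (cons_rV (a, x))).
Proof.
move=> [cf pf]; have [K _ fK] := periodic_bounded cf pf.
exact: (torus_integralS (continuous_measurable_rV cf) fK).
Qed.

Let twopi_gt0 : 0 < 2 * pi :> R.
Proof. by rewrite mulr_gt0// pi_gt0. Qed.

Lemma cons_uncons n (z : 'rV[R]_n.+1) :
  z = cons_rV (z ord0 ord0, \row_j z ord0 (lift ord0 j)).
Proof. by apply/rowP => i; rewrite mxE; case: unliftP => [j ->|->] /=; rewrite ?mxE. Qed.

(** Induction on the dimension: the induction hypothesis shifts each slice, and the slice integrals
    form a continuous periodic function of the first coordinate. *)
Lemma tint_shift d (f : 'rV[R]_d -> R) (z : 'rV[R]_d) : cper f ->
  tint (fun x => f (x + z)) = tint f.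
Proof.
elim: d f z => [|n IH] f z cf.
  rewrite (_ : (fun x => _) = f)//.
  by apply/funext => x; congr f; apply/rowP => -[].
rewrite tintS; last exact: cper_shift.
rewrite (tintS cf) (cons_uncons z).
set z0 := z _ _; set z' := \row_j _.
transitivity (\int[leb]_(a in `[0, 2 * pi]) (fun b => tint (fun x => f (cons_rV (b, x)))) (a + z0)).
  apply: eq_Rintegral => a _; rewrite -(IH _ z' (slice_cper _ cf)).
  by congr tint; apply/funext => x; rewrite cons_rVD.
apply: integral_periodic_shift => //; first exact: slice_tint_continuous.
move=> a; congr tint; apply/funext => x.
rewrite -{1}(addr0 x) cons_rVD.
rewrite -[X in cons_rV (X, 0)]mulr1 (_ : 1 = 1%:~R)// (_ : 0 = (2 * pi) *: intvec 0); last first.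
  by apply/rowP => i; rewrite !mxE mulr0.
by rewrite cons_rV_intvec cf.2.
Qed.

(** By periodicity only points of the cell matter. The slice integrals are continuous, nonnegative
    and of integral zero, hence vanish, and the induction hypothesis applies to each slice. *)
Lemma tint_eq0 d (f : 'rV[R]_d -> R) : cper f -> (forall x, 0 <= f x) ->
  tint f = 0 -> forall x, f x = 0.
Proof.
move=> cf f0 If; suff H x : torus_cell x -> f x = 0.
  by move=> x; rewrite -(reduceE _ cf.2); apply: H; exact: reduce_cell.
elim: d f cf f0 If x => [|n IH] f cf f0 If x xc.
  have E y : f y = f x by congr f; apply/rowP => -[].
  move: If; rewrite (_ : f = (fun=> f x)); last exact/funext.
  by rewrite tint_cst expr0 mulr1.
rewrite (cons_uncons x).
move: If; rewrite (tintS cf) => If.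
pose g a := tint (fun x => f (cons_rV (a, x))).
have g0 a : 0 <= g a.
  rewrite -(mul0r ((2 * pi) ^+ n)) -tint_cst.
  by apply: tint_le => //; [exact: cper_cst|exact: slice_cper].
have := integral_eq0_continuous twopi_gt0 (slice_tint_continuous cf) g0 If.
move=> /(_ _ (xc ord0)) gx0.
apply: (IH (fun y => f (cons_rV (x ord0 ord0, y)))) => //; first exact: slice_cper.
by move=> i; rewrite mxE; exact: xc.
Qed.

(** A difference quotient has integral 0 by translation invariance, and it differs from the
    derivative by at most a bound for the second derivative times the step. *)
Lemma tint_pd d (f : 'rV[R]_d -> R) (i : 'I_d) : smoothT f -> tint (pd i f) = 0.
Proof.
move=> sf.
have cfT g : smoothT g -> cper g.
  by move=> sg; split; [exact: smoothT_continuous|exact: smoothT_periodic].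
have sf1 := smoothT_pd i sf; have sf2 := smoothT_pd i sf1.
have [K K0 fK] := periodic_bounded (smoothT_continuous sf2) (smoothT_periodic sf2).
apply/eqP; rewrite -normr_eq0; apply/eqP/le_anti; rewrite normr_ge0 andbT.
apply/ler_addgt0Pr => e e0; rewrite add0r.
have P0 : 0 < (2 * pi) ^+ d :> R by rewrite exprn_gt0.
(* The step for which the error K r, integrated over the torus, equals [e]. *)
pose r := e / (K * (2 * pi) ^+ d).
have r0 : 0 < r by rewrite divr_gt0// mulr_gt0.
pose q x := r^-1 * (f (x + r *: basis_vec i) - f x).
have cq : cper q by apply/cperZ/cperB; [exact/cper_shift/cfT|exact: cfT].
have tq : tint q = 0.
  rewrite tintZ; last by apply: cperB; [exact/cper_shift/cfT|exact: cfT].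
  by rewrite tintB ?tint_shift ?subrr ?mulr0//; [exact: cfT|exact/cper_shift/cfT|exact: cfT].
rewrite -[tint _]subr0 -tq -tintB//; last exact: cfT.
have -> : e = K * r * (2 * pi) ^+ d.
  by rewrite /r invfM mulrA mulrACA mulfV ?gt_eqF// mul1r mulrAC mulfK// gt_eqF.
apply: tint_bound => [|x]; first by apply: cperB => //; exact: cfT.
have [|c /andP[c0 cr]] := @line_mean_value R d f i x 0 r _ (ltW r0).
  by move=> y; exact: smoothT_derivable.
rewrite scale0r addr0 subr0 /q => ->; rewrite mulrC mulfK ?gt_eqF//.
have [|c' /andP[c'0 c'c]] := @line_mean_value R d (pd i f) i x 0 c _ c0.
  by move=> y; exact: smoothT_derivable.
rewrite scale0r addr0 subr0 => E.
rewrite distrC E normrM ler_pM// ger0_norm//.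
Qed.

End torus_fubini.

Lemma continuous_sumr (R : realType) (T : topologicalType) (I : Type) (s : seq I)
  (F : I -> T -> R) : (forall i, continuous (F i)) ->
  continuous (fun x => \sum_(i <- s) F i x).
Proof.
move=> cF; elim: s => [|i s IH].
  rewrite (_ : (fun x => _) = (fun=> 0)); first by move=> x; exact: cst_continuous.
  by apply/funext => x; rewrite big_nil.
rewrite (_ : (fun x => _) = (fun x => F i x + \sum_(i <- s) F i x)).
  by move=> x; apply: continuousD; [exact: cF|exact: IH].
by apply/funext => x; rewrite big_cons.
Qed.

(** * Real Fourier modes and coefficients *)

Section fourier_modes.
Context {R : realType} {d : nat}.
Local Notation V := 'rV[R]_d.
Local Notation e := (@basis_vec R d).
Implicit Types (f g : V -> R) (x y z : V) (k l : 'rV[int]_d).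

Lemma cosD2pi_int (a : R) (m : int) : cos (a + 2 * pi * m%:~R) = cos a.
Proof.
have H (b : R) n : cos (b + 2 * pi * n%:R) = cos b.
  rewrite mulr_natr mulrC mulr_natr; exact: periodicn (@cosD2pi R) n b.
case: m => n; first exact: H.
by rewrite NegzE intrN -pmulrn mulrN -[in RHS](subrK (2 * pi * n.+1%:R) a) H.
Qed.

Lemma sinD2pi_int (a : R) (m : int) : sin (a + 2 * pi * m%:~R) = sin a.
Proof.
have H (b : R) n : sin (b + 2 * pi * n%:R) = sin b.
  rewrite mulr_natr mulrC mulr_natr; exact: periodicn (@sinD2pi R) n b.
case: m => n; first exact: H.
by rewrite NegzE intrN -pmulrn mulrN -[in RHS](subrK (2 * pi * n.+1%:R) a) H.
Qed.

Definition phase k x : R := dot (intvec k) x.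

Lemma phaseD k x y : phase k (x + y) = phase k x + phase k y.
Proof.
by rewrite /phase /dot -big_split/=; apply: eq_bigr => i _; rewrite !mxE mulrDr.
Qed.

Lemma phaseZ k (r : R) x : phase k (r *: x) = r * phase k x.
Proof.
by rewrite /phase /dot mulr_sumr; apply: eq_bigr => i _; rewrite !mxE mulrCA.
Qed.

Lemma phase_basis k i : phase k (e i) = (k ord0 i)%:~R.
Proof.
rewrite /phase /dot (bigD1 i)//= !mxE !eqxx mulr1 big1 ?addr0// => j ji.
by rewrite !mxE /= (negbTE ji) mulr0.
Qed.

Lemma phaseDl k l x : phase (k + l) x = phase k x + phase l x.
Proof.
rewrite /phase /dot -big_split/=; apply: eq_bigr => i _.
by rewrite !mxE intrD mulrDl.
Qed.

Lemma phaseNl k x : phase (- k) x = - phase k x.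
Proof.
rewrite /phase /dot -sumrN; apply: eq_bigr => i _.
by rewrite !mxE intrN mulNr.
Qed.

Lemma phase_intvec k l : exists m : int, phase k (intvec l) = m%:~R.
Proof.
exists (\sum_i k ord0 i * l ord0 i).
by rewrite /phase /dot rmorph_sum/=; apply: eq_bigr => i _; rewrite !mxE rmorphM.
Qed.

Lemma phase_continuous k : continuous (phase k).
Proof.
apply: continuous_sumr => i x.
by apply: continuousM; [exact: cst_continuous|exact: coord_continuous].
Qed.

(** Real form of a complex exponential: for fixed [k] the two-parameter family is stable under
    partial derivatives and translations, and its members are eigenfunctions of the walk. *)
Definition mode (a b : R) k x : R := a * cos (phase k x) + b * sin (phase k x).

Lemma mode_periodic a b k : torus_periodic (mode a b k).
Proof.
move=> x l; rewrite /mode phaseD phaseZ.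
by have [m ->] := phase_intvec k l; rewrite cosD2pi_int sinD2pi_int.
Qed.

Lemma mode_continuous a b k : continuous (mode a b k).
Proof.
have cphi : continuous (fun t : R => a * cos t + b * sin t).
  move=> t; apply: (@continuousD _ _ _ (fun t => a * cos t) (fun t => b * sin t)).
    by apply: (@continuousM _ _ (fun=> a) cos);
      [exact: cst_continuous|exact: continuous_cos].
  by apply: (@continuousM _ _ (fun=> b) sin);
      [exact: cst_continuous|exact: continuous_sin].
move=> x; apply: (@cvg_comp _ _ _ (phase k) (fun t : R => a * cos t + b * sin t) _
  (nbhs (phase k x))); [exact: phase_continuous|exact: cphi].
Qed.

Lemma is_derive_mode a b k x i :
  is_derive x (e i) (mode a b k) (mode (b * (k ord0 i)%:~R) (- (a * (k ord0 i)%:~R)) k x).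
Proof.
set c := (k ord0 i)%:~R.
have D : is_derive (0 : R) (1 : R) (fun t => mode a b k (x + t *: e i))
    (mode (b * c) (- (a * c)) k x).
  rewrite (_ : (fun t => _) =
    fun t : R => a * cos (phase k x + t * c) + b * sin (phase k x + t * c)); last first.
    by apply/funext => t; rewrite /mode phaseD phaseZ phase_basis.
  have DL : is_derive (0 : R) (1 : R) (fun t => phase k x + t * c) c.
    apply: derf_eq (derfD (derf_cst 0 _) (derfM (derf_id 0) (derf_cst 0 c))) _.
    by rewrite add0r mul1r mulr0 addr0.
  have DC := @is_derive1_comp R cos (fun t => phase k x + t * c) 0 _ _ (is_derive_cos _) DL.
  have DS := @is_derive1_comp R sin (fun t => phase k x + t * c) 0 _ _ (is_derive_sin _) DL.
  apply: derf_eq (derfD (derfZ a DC) (derfZ b DS)) _.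
  by rewrite /mode mul0r addr0; ring.
have E : (fun h : R => h^-1 *: (mode a b k (x + (h *: 1 + 0) *: e i) - mode a b k (x + 0 *: e i)))
   = (fun h : R => h^-1 *: (mode a b k (h *: e i + x) - mode a b k x)).
  apply/funext => h; congr (_ *: (mode a b k _ - mode a b k _)).
    by rewrite addr0 [h *: 1]mulr1 addrC.
  by rewrite scale0r addr0.
apply: DeriveDef.
  have := @ex_derive _ _ _ _ _ _ _ D.
  by rewrite /derivable /= E.
have := @derive_val _ _ _ _ _ _ _ D.
by rewrite /derive/= E.
Qed.

Lemma smoothT_mode a b k : smoothT (mode a b k).
Proof.
apply: SmoothT; first exact: mode_periodic.
apply: (@Ck_coind R d (fun f => exists a b, f = mode a b k)); last by exists a, b.
move=> {a b} _ [a [b ->]]; split; first exact: mode_continuous.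
  by move=> x i; exact: (@ex_derive _ _ _ _ _ _ _ (is_derive_mode a b k x i)).
move=> i; exists (b * (k ord0 i)%:~R), (- (a * (k ord0 i)%:~R)).
by apply/funext => x; exact: (@derive_val _ _ _ _ _ _ _ (is_derive_mode a b k x i)).
Qed.

Lemma pd_mode i a b k x :
  pd i (mode a b k) x = mode (b * (k ord0 i)%:~R) (- (a * (k ord0 i)%:~R)) k x.
Proof. exact: (@derive_val _ _ _ _ _ _ _ (is_derive_mode a b k x i)). Qed.

Lemma smoothT_cper f : smoothT f -> cper f.
Proof.
by move=> sf; split; [exact: smoothT_continuous|exact: smoothT_periodic].
Qed.

Lemma mode_cper a b k : cper (mode a b k).
Proof. exact/smoothT_cper/smoothT_mode. Qed.

Lemma mode_le a b k x : `|mode a b k x| <= `|a| + `|b|.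
Proof.
apply: le_trans (ler_normD _ _) _; rewrite !normrM; apply: lerD.
  by rewrite ler_piMr// ler_norml cos_geN1 cos_le1.
by rewrite ler_piMr// ler_norml sin_geN1 sin_le1.
Qed.

(** If some coordinate k_i is nonzero, a translation by pi / k_i along e_i changes the sign of the
    mode but not its integral. *)
Lemma tint_mode a b k : tint (mode a b k) = a * (k == 0)%:R * (2 * pi) ^+ d.
Proof.
have [->|k0] := eqVneq k 0.
  rewrite mulr1 -tint_cst; congr tint; apply/funext => x.
  by rewrite /mode (_ : phase 0 x = 0) ?cos0 ?sin0 ?mulr1 ?mulr0 ?addr0//;
    rewrite /phase /dot big1// => i _; rewrite !mxE mul0r.
rewrite mulr0 mul0r.
have [i ki] : exists i, k ord0 i != 0.
  apply: contrapT => /forallNP H; move/eqP: k0; apply; apply/rowP => i.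
  by have := H i; move/negP; rewrite negbK mxE => /eqP.
have := tint_shift ((pi / (k ord0 i)%:~R) *: e i) (mode_cper a b k).
rewrite (_ : (fun x => _) = (fun x => -1 * mode a b k x)).
  by rewrite tintZ; [lra|exact: mode_cper].
apply/funext => x; rewrite /mode phaseD phaseZ phase_basis divfK; last by rewrite intr_eq0.
by rewrite cosDpi sinDpi; ring.
Qed.

Local Notation cosk k := (mode 1 0 k).
Local Notation sink k := (mode 0 1 k).

Lemma fcosE f k : fcos f k = ((2 * pi) ^+ d)^-1 * tint (fun x => f x * cosk k x).
Proof.
rewrite /fcos /tint; congr (_ * _); apply: eq_Rintegral => x _.
by rewrite /mode mul1r mul0r addr0.
Qed.

Lemma fsinE f k : fsin f k = ((2 * pi) ^+ d)^-1 * tint (fun x => f x * sink k x).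
Proof.
rewrite /fsin /tint; congr (_ * _); apply: eq_Rintegral => x _.
by rewrite /mode mul1r mul0r add0r.
Qed.

Let P0 : (2 * pi) ^+ d != 0 :> R.
Proof. by rewrite expf_neq0// mulf_neq0// gt_eqF// pi_gt0. Qed.

Let Pgt0 : 0 < (2 * pi) ^+ d :> R.
Proof. by rewrite exprn_gt0// mulr_gt0// pi_gt0. Qed.

Lemma fcosN f k : fcos f (- k) = fcos f k.
Proof.
rewrite !fcosE; congr (_ * tint _); apply/funext => x.
by rewrite /mode phaseNl cosN sinN; ring.
Qed.

Lemma fcosB f g k : cper f -> cper g ->
  fcos (fun x => f x - g x) k = fcos f k - fcos g k.
Proof.
move=> cf cg; have cm := mode_cper 1 0 k.
rewrite !fcosE -mulrBr -tintB; [|exact: cperM|exact: cperM].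
by congr (_ * tint _); apply/funext => x; rewrite mulrBl.
Qed.

Lemma fsinB f g k : cper f -> cper g ->
  fsin (fun x => f x - g x) k = fsin f k - fsin g k.
Proof.
move=> cf cg; have cm := mode_cper 0 1 k.
rewrite !fsinE -mulrBr -tintB; [|exact: cperM|exact: cperM].
by congr (_ * tint _); apply/funext => x; rewrite mulrBl.
Qed.

Lemma fsinN f k : cper f -> fsin f (- k) = - fsin f k.
Proof.
move=> cf; rewrite !fsinE -mulrN; congr (_ * _).
rewrite -mulN1r -tintZ; last exact/cperM/mode_cper.
by congr tint; apply/funext => x; rewrite /mode phaseNl cosN sinN; ring.
Qed.

Lemma fcos_sum (I : Type) (s : seq I) (F : I -> V -> R) k : (forall i, cper (F i)) ->
  fcos (fun x => \sum_(i <- s) F i x) k = \sum_(i <- s) fcos (F i) k.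
Proof.
move=> cF; rewrite fcosE.
rewrite (_ : (fun x => _) = (fun x => \sum_(i <- s) (F i x * cosk k x))).
  rewrite tint_sum; last by move=> i; apply: cperM => //; exact: mode_cper.
  by rewrite mulr_sumr; apply: eq_bigr => i _; rewrite fcosE.
by apply/funext => x; rewrite mulr_suml.
Qed.

Lemma fsin_sum (I : Type) (s : seq I) (F : I -> V -> R) k : (forall i, cper (F i)) ->
  fsin (fun x => \sum_(i <- s) F i x) k = \sum_(i <- s) fsin (F i) k.
Proof.
move=> cF; rewrite fsinE.
rewrite (_ : (fun x => _) = (fun x => \sum_(i <- s) (F i x * sink k x))).
  rewrite tint_sum; last by move=> i; apply: cperM => //; exact: mode_cper.
  by rewrite mulr_sumr; apply: eq_bigr => i _; rewrite fsinE.
by apply/funext => x; rewrite mulr_suml.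
Qed.

Lemma fcos_le f k (K : R) : cper f -> (forall x, `|f x| <= K) -> `|fcos f k| <= K.
Proof.
move=> cf fK; rewrite fcosE normrM gtr0_norm ?invr_gt0// mulrC ler_pdivrMr//.
apply: tint_bound => [|x]; first exact/cperM/mode_cper.
rewrite normrM -[leRHS]mulr1 ler_pM//.
by apply: le_trans (mode_le _ _ _ _) _; rewrite normr1 normr0 addr0.
Qed.

Lemma fsin_le f k (K : R) : cper f -> (forall x, `|f x| <= K) -> `|fsin f k| <= K.
Proof.
move=> cf fK; rewrite fsinE normrM gtr0_norm ?invr_gt0// mulrC ler_pdivrMr//.
apply: tint_bound => [|x]; first exact/cperM/mode_cper.
rewrite normrM -[leRHS]mulr1 ler_pM//.
by apply: le_trans (mode_le _ _ _ _) _; rewrite normr1 normr0 add0r.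
Qed.

(** Product-to-sum formulas. Since [k] and - [k] carry the same real modes, each contributes one
    half. *)
Lemma fcos_mode a b k l :
  fcos (mode a b k) l = 2^-1 * a * ((k == l)%:R + (k == - l)%:R).
Proof.
rewrite fcosE (_ : (fun x => _) =
    (fun x => 2^-1 * mode a b (k - l) x + 2^-1 * mode a b (k + l) x)).
  rewrite tintD; [|exact/cperZ/mode_cper|exact/cperZ/mode_cper].
  rewrite !tintZ; try exact: mode_cper.
  by rewrite !tint_mode subr_eq0 addr_eq0; have := P0 => h; field.
apply/funext => x; rewrite /mode !phaseDl phaseNl !cosD !sinD cosN sinN.
by field.
Qed.

Lemma fsin_mode a b k l :
  fsin (mode a b k) l = 2^-1 * b * ((k == l)%:R - (k == - l)%:R).
Proof.
rewrite fsinE (_ : (fun x => _) =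
    (fun x => 2^-1 * mode b (- a) (k - l) x - 2^-1 * mode b (- a) (k + l) x)).
  rewrite tintB; [|exact/cperZ/mode_cper|exact/cperZ/mode_cper].
  rewrite !tintZ; try exact: mode_cper.
  by rewrite !tint_mode subr_eq0 addr_eq0; have := P0 => h; field.
apply/funext => x; rewrite /mode !phaseDl phaseNl !cosD !sinD cosN sinN.
by field.
Qed.

(** Integration by parts: [tint_pd] applied to the product of [f] with the cosine mode. *)
Lemma fcos_pd f i k : smoothT f -> fcos (pd i f) k = (k ord0 i)%:~R * fsin f k.
Proof.
move=> sf; have sm := smoothT_mode 1 0 k.
have := tint_pd i (smoothTM sf sm).
rewrite (_ : pd i _ =
    (fun x => pd i f x * cosk k x - (k ord0 i)%:~R * (f x * sink k x))).
  have sfi := smoothT_pd i sf.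
  rewrite tintB; last 2 first.
  - exact/cperM/mode_cper/smoothT_cper.
  - exact/cperZ/cperM/mode_cper/smoothT_cper.
  rewrite tintZ; last exact/cperM/mode_cper/smoothT_cper.
  by move=> /eqP; rewrite subr_eq0 fcosE fsinE => /eqP ->; rewrite mulrCA.
apply/funext => x; rewrite pdM// pd_mode /mode; ring.
Qed.

Lemma fsin_pd f i k : smoothT f -> fsin (pd i f) k = - ((k ord0 i)%:~R * fcos f k).
Proof.
move=> sf; have sm := smoothT_mode 0 1 k.
have := tint_pd i (smoothTM sf sm).
rewrite (_ : pd i _ =
    (fun x => pd i f x * sink k x + (k ord0 i)%:~R * (f x * cosk k x))).
  have sfi := smoothT_pd i sf.
  rewrite tintD; last 2 first.
  - exact/cperM/mode_cper/smoothT_cper.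
  - exact/cperZ/cperM/mode_cper/smoothT_cper.
  rewrite tintZ; last exact/cperM/mode_cper/smoothT_cper.
  by move=> /eqP; rewrite addr_eq0 fcosE fsinE => /eqP ->; rewrite mulrN mulrCA.
apply/funext => x; rewrite pdM// pd_mode /mode; ring.
Qed.

End fourier_modes.

(** * Decay of Fourier coefficients and enumeration of frequencies *)

Section fourier_inversion.
Context {R : realType} {d : nat}.
Local Notation V := 'rV[R]_d.
Local Notation e := (@basis_vec R d).
Implicit Types (f g : V -> R) (x y z : V) (k l : 'rV[int]_d).

(** Inverse symbol of the product of the operators 1 - d_i^2. Unlike a power of |k|, it factorizes
    over the coordinates, so that its sum is elementary. *)
Definition kweight k : R := \prod_i (1 + (k ord0 i)%:~R ^+ 2)^-1.

Let sq1_gt0 (t : R) : 0 < 1 + t ^+ 2.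
Proof. by rewrite ltr_pwDl// sqr_ge0. Qed.

Lemma kweight_gt0 k : 0 < kweight k.
Proof. by apply: prodr_gt0 => i _; rewrite invr_gt0. Qed.

(** Comparison with a telescoping series: 1 / (1 + t^2) <= 2 / t - 2 / (t + 1). *)
Let inv_sq_sum n : \sum_(j < n.+1) (1 + j%:R ^+ 2)^-1 <= 3 :> R.
Proof.
have inv0 m : 0 <= m.+1%:R^-1 :> R by rewrite invr_ge0.
suff : \sum_(j < n.+1) (1 + j%:R ^+ 2)^-1 <= 3 - 2 / n.+1%:R :> R.
  by have := inv0 n; move: (_^-1) => a; lra.
elim: n => [|n IH]; first by rewrite big_ord1 expr0n addr0 invr1; lra.
rewrite big_ord_recr/=; apply: le_trans (lerD IH (lexx _)) _.
rewrite -[n.+2%:R]natr1; set t : R := n.+1%:R.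
have t1 : 1 <= t by rewrite ler1n.
have : (1 + t ^+ 2)^-1 <= 2 / (t * (t + 1)).
  rewrite ler_pdivlMr ?mulr_gt0//; try lra.
  rewrite mulrC ler_pdivrMr//.
  by have := sqr_ge0 (t - 1); rewrite sqrrB1; lra.
have -> : 2 / (t * (t + 1)) = 2 / t - 2 / (t + 1) by field; apply/andP; split; lra.
by move: (t^-1) ((t + 1)^-1) ((1 + t ^+ 2)^-1) => a b c; lra.
Qed.

(** Each integer coordinate is encoded by its absolute value and a sign. The sum over all codes
    factorizes, and each coordinate contributes at most 2 times 3; counting zero twice does no
    harm. *)
Lemma sum_kweight (s : seq 'rV[int]_d) : uniq s -> \sum_(k <- s) kweight k <= 6 ^+ d.
Proof.
move=> us.
pose n := \max_(k <- s) \max_i `|k ord0 i|%N.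
have kn k i : k \in s -> (`|k ord0 i|%N < n.+1)%N.
  move=> ks; rewrite ltnS /n; apply: leq_trans (leq_bigmax_seq k ks isT).
  exact: (@leq_bigmax _ (fun i => `|k ord0 i|%N)).
pose phi k : {ffun 'I_d -> 'I_n.+1 * bool} :=
  [ffun i => (inord `|k ord0 i|%N, (0 <= k ord0 i)%R)].
pose G (p : 'I_n.+1 * bool) : R := (1 + (p.1)%:R ^+ 2)^-1.
have phi_inj : {in s &, injective phi}.
  move=> k l ks ls /ffunP E; apply/rowP => i; have := E i; rewrite !ffunE => -[].
  move=> /(congr1 val); rewrite /= !inordK ?kn// => Ea Es.
  by rewrite [LHS]intEsign [RHS]intEsign Ea !ltNge Es.
have -> : \sum_(k <- s) kweight k = \sum_(p <- map phi s) \prod_i G (p i).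
  rewrite big_map; apply: eq_big_seq => k ks; apply: eq_bigr => i _.
  rewrite ffunE /G /= inordK ?kn//; congr (1 + _)^-1.
  by rewrite natr_absz intr_norm real_normK ?num_real.
apply: (@le_trans _ _ (\sum_(p : {ffun 'I_d -> 'I_n.+1 * bool}) \prod_i G (p i))).
  rewrite big_uniq ?map_inj_in_uniq//=.
  rewrite [leRHS](bigID (mem (map phi s)))/= lerDl sumr_ge0// => p _.
  by apply: prodr_ge0 => i _; rewrite invr_ge0 ltW.
rewrite -(@bigA_distr_bigA _ 0 1 _ _ 'I_d _ (fun=> G))/=.
rewrite prodr_const card_ord.
apply: lerXn2r; rewrite ?nnegrE//; first by apply: sumr_ge0 => p _; rewrite invr_ge0 ltW.
rewrite -(pair_bigA _ (fun (j : 'I_n.+1) (b : bool) => (1 + j%:R ^+ 2)^-1 : R))/=.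
rewrite (eq_bigr (fun j : 'I_n.+1 => 2 * (1 + j%:R ^+ 2)^-1)).
  by rewrite -mulr_sumr; have := inv_sq_sum n; lra.
by move=> j _; rewrite sumr_const card_bool mulr_natl.
Qed.

Definition helm i f x : R := f x - pd i (pd i f) x.

Lemma smoothT_helm i f : smoothT f -> smoothT (helm i f).
Proof. by move=> sf; apply: smoothTB; [exact: sf|do 2 apply: smoothT_pd]. Qed.

Lemma fcos_helm i f k : smoothT f ->
  fcos (helm i f) k = (1 + (k ord0 i)%:~R ^+ 2) * fcos f k.
Proof.
move=> sf; have sf1 := smoothT_pd i sf; have sf2 := smoothT_pd i sf1.
rewrite fcosB; [|exact: smoothT_cper|exact: smoothT_cper].
by rewrite fcos_pd// fsin_pd//; ring.
Qed.

Lemma fsin_helm i f k : smoothT f ->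
  fsin (helm i f) k = (1 + (k ord0 i)%:~R ^+ 2) * fsin f k.
Proof.
move=> sf; have sf1 := smoothT_pd i sf; have sf2 := smoothT_pd i sf1.
rewrite fsinB; [|exact: smoothT_cper|exact: smoothT_cper].
by rewrite fsin_pd// fcos_pd//; ring.
Qed.

(** The square of the weight is needed later: one factor absorbs 1 + |k|^2 through [enorm_weight],
    the other is summed by [sum_kweight]. *)
Lemma fourier_decay f : smoothT f -> exists2 C, 0 < C &
  forall k, `|fcos f k| <= C * kweight k ^+ 2 /\ `|fsin f k| <= C * kweight k ^+ 2.
Proof.
move=> sf; pose hs s := foldr helm f s.
have shs s : smoothT (hs s).
  by elim: s => [//|i s IH]; exact: smoothT_helm.
have cE s k : fcos (hs s) k = \prod_(i <- s) (1 + (k ord0 i)%:~R ^+ 2) * fcos f k.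
  elim: s => [|i s IH]; first by rewrite big_nil mul1r.
  by rewrite big_cons -mulrA -IH -fcos_helm.
have sE s k : fsin (hs s) k = \prod_(i <- s) (1 + (k ord0 i)%:~R ^+ 2) * fsin f k.
  elim: s => [|i s IH]; first by rewrite big_nil mul1r.
  by rewrite big_cons -mulrA -IH -fsin_helm.
(* Every operator 1 - d_i^2 is applied twice, which multiplies the coefficients by
   [kweight k ^- 2]. *)
pose s := index_enum 'I_d ++ index_enum 'I_d.
have [C C0 HC] := periodic_bounded (smoothT_continuous (shs s)) (smoothT_periodic (shs s)).
exists C => // k.
have P : \prod_(i <- s) (1 + (k ord0 i)%:~R ^+ 2) = (kweight k ^+ 2)^-1.
  by rewrite /s big_cat/= -expr2 -exprVn /kweight -prodfV; congr (_ ^+ 2);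
    apply: eq_bigr => i _; rewrite invrK.
have w0 : 0 < kweight k ^+ 2 by rewrite exprn_gt0// kweight_gt0.
have H (a : R) : `|(kweight k ^+ 2)^-1 * a| <= C -> `|a| <= C * kweight k ^+ 2.
  by rewrite normrM gtr0_norm ?invr_gt0// mulrC ler_pdivrMr.
split; apply: H; rewrite -P.
  by rewrite -cE; apply: fcos_le => //; exact/smoothT_cper.
by rewrite -sE; apply: fsin_le => //; exact/smoothT_cper.
Qed.

Lemma enorm_weight k : (1 + enorm (intvec k : V) ^+ 2) * kweight k <= 1.
Proof.
rewrite /enorm sqr_sqrtr; last by apply: sumr_ge0 => i _; rewrite -expr2 sqr_ge0.
have -> : kweight k = (\prod_i (1 + (k ord0 i)%:~R ^+ 2))^-1.
  by rewrite /kweight prodfV.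
rewrite ler_pdivrMr ?mul1r; last by apply: prodr_gt0.
have : 1 + \sum_(i <- index_enum 'I_d) (k ord0 i)%:~R ^+ 2 <=
   \prod_(i <- index_enum 'I_d) (1 + (k ord0 i)%:~R ^+ 2) :> R.
  elim: (index_enum _) => [|i s IH]; first by rewrite !big_nil addr0.
  rewrite !big_cons.
  have := @sumr_ge0 R _ s xpredT (fun i => (k ord0 i)%:~R ^+ 2) (fun i _ => sqr_ge0 _).
  move: IH; set S := \sum_(_ <- _) _; set P := \prod_(_ <- _) _.
  by have := sqr_ge0 ((k ord0 i)%:~R : R); set t := _ ^+ 2; nra.
by congr (1 + _ <= _); apply: eq_bigr => i _; rewrite !mxE expr2.
Qed.

Lemma kweight_le1 k : kweight k <= 1.
Proof.
apply: le_trans (enorm_weight k).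
by rewrite ler_peMl ?lerDl ?sqr_ge0// ltW// kweight_gt0.
Qed.

(** Increasing finite sets exhausting the frequencies; numbers below [n] that code no vector are
    dropped. The order is immaterial, as all series in question converge absolutely. *)
Definition kseq n : seq 'rV[int]_d := pmap (@pickle_inv _) (iota 0 n).

Lemma kseq_uniq n : uniq (kseq n).
Proof. exact: (pmap_uniq (@pickle_invK _)) (iota_uniq 0 n). Qed.

Lemma mem_kseq n k : (k \in kseq n) = (pickle k < n)%N.
Proof.
rewrite /kseq mem_pmap; apply/mapP/idP => [[m]|H].
  rewrite mem_iota add0n /= => mn E.
  by have := @pickle_invK 'rV[int]_d m; rewrite -E /= => ->.
by exists (pickle k); [rewrite mem_iota add0n|rewrite pickleK_inv].
Qed.

Lemma kseqD m n : kseq (m + n) = kseq m ++ pmap (@pickle_inv _) (iota m n).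
Proof. by rewrite /kseq iotaD pmap_cat. Qed.

Lemma ler_sum_kseq (F G : 'rV[int]_d -> R) m n : (m <= n)%N ->
  (forall k, `|F k| <= G k) ->
  `|\sum_(k <- kseq n) F k - \sum_(k <- kseq m) F k| <=
  \sum_(k <- kseq n) G k - \sum_(k <- kseq m) G k.
Proof.
move=> /subnKC <- FG; rewrite kseqD !big_cat/= !(addrC (\sum_(k <- kseq m) _)) !addrK.
apply: le_trans (ler_norm_sum _ _ _) _.
exact: ler_sum.
Qed.

Lemma kseq_exhaust (s : seq 'rV[int]_d) : exists n, forall m, (n <= m)%N -> {subset s <= kseq m}.
Proof.
exists (\max_(k <- s) (pickle k).+1)%N => m nm k ks.
rewrite mem_kseq (leq_trans _ nm)//.
exact: (leq_bigmax_seq (F := fun k => (pickle k).+1) k ks isT).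
Qed.

End fourier_inversion.

(** * Uniqueness of Fourier coefficients and uniform convergence of Fourier series *)

Section fourier_uniqueness.
Context {R : realType} {d : nat}.
Local Notation V := 'rV[R]_d.
Local Notation e := (@basis_vec R d).
Implicit Types (f g : V -> R) (x y z : V) (k l : 'rV[int]_d).

Lemma modeM (a b a' b' : R) k l x :
  mode a b k x * mode a' b' l x =
  mode (2^-1 * (a * a' - b * b')) (2^-1 * (a * b' + b * a')) (k + l) x +
  mode (2^-1 * (a * a' + b * b')) (2^-1 * (b * a' - a * b')) (k - l) x.
Proof.
rewrite /mode !phaseDl phaseNl !cosD !sinD cosN sinN.
move: (cos _) (sin _) (cos _) (sin _) => C S C' S'.
by field.
Qed.

Lemma cos_gt_near (t r : R) : 0 < r -> r <= pi -> cos r < cos t ->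
  exists m : int, `|t + 2 * pi * m%:~R| < r.
Proof.
move=> r0 rpi rt.
have pi0 := @pi_gt0 R.
have := floor_itv ((t + pi) / (2 * pi)) => /andP[].
set m := Num.floor _; rewrite intrD => h1 h2.
exists (- m).
have p2 : 0 < 2 * pi :> R by rewrite mulr_gt0.
move: h1 h2; rewrite ler_pdivlMr// ltr_pdivrMr// => h1 h2.
have E : cos `|t + 2 * pi * (- m)%:~R| = cos t by case: ger0P => _; rewrite ?cosN cosD2pi_int.
have b : `|t + 2 * pi * (- m)%:~R| <= pi.
  by rewrite rmorphN/= ler_norml; apply/andP; split; lra.
by rewrite -(@ltr_cos R) ?E// in_itv/= ?normr_ge0 ?b// ltW.
Qed.

(* If [g x0 > 0], the coefficients of [g p^n], which vanish, contradict the concentration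
   of [p^n] near [x0], where [p x = sum_i (1 + cos (x_i - x0_i))]. *)
Lemma fourier_unique g : cper g ->
  (forall k, fcos g k = 0 /\ fsin g k = 0) -> forall x, g x <= 0.
Proof.
move=> cg g0 x0; rewrite leNgt; apply/negP => gx0.
have P0 : 0 < (2 * pi) ^+ d :> R by rewrite exprn_gt0// mulr_gt0// pi_gt0.
have d0 : (0 < d)%N.
  rewrite lt0n; apply/negP => /eqP dE.
  have := g0 0 => -[]; rewrite fcosE => /eqP; rewrite mulf_eq0 invr_eq0 (gt_eqF P0)/=.
  rewrite (_ : (fun x => _) = (fun=> g x0)).
    by rewrite tint_cst mulf_eq0 (gt_eqF P0) (gt_eqF gx0).
  apply/funext => x; rewrite /mode /phase /dot big1 ?cos0 ?sin0 ?mulr0 ?addr0 ?mulr1.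
    by congr g; apply/rowP => i; move: (ltn_ord i); rewrite [X in (_ < X)%N]dE.
  by move=> i; move: (ltn_ord i); rewrite [X in (_ < X)%N]dE.
pose kap i : 'rV[int]_d := delta_mx ord0 i.
have phk i x : phase (kap i) x = x ord0 i.
  rewrite /phase /dot (bigD1 i)//= !mxE !eqxx mul1r big1 ?addr0// => j ji.
  by rewrite !mxE /= (negbTE ji) mul0r.
pose p x := \sum_i (1 + mode (cos (x0 ord0 i)) (sin (x0 ord0 i)) (kap i) x).
have pE x : p x = \sum_i (1 + cos (x ord0 i - x0 ord0 i)).
  by apply: eq_bigr => i _; rewrite /mode phk cosB; congr (1 + _); ring.
have cp : cper p.
  by apply: cper_sum => i; apply: cperD; [exact: cper_cst|exact: mode_cper].
have cX n : cper (fun x => p x ^+ n).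
  by apply: (cper_comp (phi := fun t => t ^+ n)) => //; exact: exprn_continuous.
have p_ge0 x : 0 <= p x.
  by rewrite pE; apply: sumr_ge0 => i _; have := cos_geN1 (x ord0 i - x0 ord0 i); lra.
have d1 : 1 <= d%:R :> R by rewrite ler1n.
have p_le x : p x <= 2 * d%:R.
  rewrite pE; apply: (@le_trans _ _ (\sum_(i < d) 2)).
    by apply: ler_sum => i _; have := cos_le1 (x ord0 i - x0 ord0 i); lra.
  by rewrite sumr_const card_ord mulr_natr.
have px0 : p x0 = 2 * d%:R.
  rewrite pE (eq_bigr (fun=> 2)); first by rewrite sumr_const card_ord mulr_natr.
  by move=> i _; rewrite subrr cos0.
(* The induction on [n] needs all modes at once: by [modeM], multiplication by [p] turns a mode into
   a combination of modes. *)
have orth n a b k : tint (fun x => g x * p x ^+ n * mode a b k x) = 0.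
  elim: n a b k => [|n IH] a b k.
    have [/eqP + /eqP] := g0 k.
    rewrite fcosE fsinE !mulf_eq0 !invr_eq0 (gt_eqF P0)/= => /eqP h1 /eqP h2.
    rewrite (_ : (fun x => _) = (fun x => a * (g x * mode 1 0 k x) + b * (g x * mode 0 1 k x))).
      rewrite tintD ?tintZ ?h1 ?h2 ?mulr0 ?addr0//;
        by do ?apply: cperZ; apply: cperM => //; exact: mode_cper.
    by apply/funext => x; rewrite /mode expr0; ring.
  rewrite (_ : (fun x => _) = (fun x => \sum_(i <- index_enum 'I_d)
    (g x * p x ^+ n * mode a b k x + (g x * p x ^+ n *
      (mode (cos (x0 ord0 i)) (sin (x0 ord0 i)) (kap i) x * mode a b k x))))).
    have cgp : cper (fun x => g x * p x ^+ n) by exact: cperM.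
    rewrite tint_sum; last first.
      move=> i; apply: cperD; apply: cperM => //; first exact: mode_cper.
      by apply: cperM; exact: mode_cper.
    rewrite big1// => i _; rewrite tintD; last 2 first.
    - by apply: cperM => //; exact: mode_cper.
    - by apply: cperM => //; apply: cperM; exact: mode_cper.
    rewrite IH add0r.
    under [X in tint X]eq_fun do rewrite modeM mulrDr.
    rewrite tintD ?IH ?addr0//; by apply: cperM => //; exact: mode_cper.
  apply/funext => x; rewrite exprSr {2}/p !mulr_sumr mulr_suml.
  by apply: eq_bigr => i _; ring.
have [K K0 gK] := periodic_bounded cg.1 cg.2.
have [r [r0 rpi Hr]] : exists r, [/\ 0 < r, r <= pi / 2 &
    forall y, (forall i, `|y ord0 i - x0 ord0 i| < r) -> g x0 / 2 <= g y].
  have /cvgrPdist_lt /(_ _ (divr_gt0 gx0 (ltr0n R 2))) /nbhs_ballP[s /= s0 Hs] := cg.1 x0.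
  exists (Num.min s (pi / 2)); split.
  - by rewrite lt_min; apply/andP; split => //; rewrite divr_gt0// pi_gt0.
  - by rewrite ge_min lexx orbT.
  - move=> y Hy.
    have : `|g x0 - g y| < g x0 / 2.
      apply: Hs; rewrite -ball_normE /= /Num.Def.normr/= mx_normrE.
      apply: bigmax_lt => // -[i j] _ /=; rewrite !mxE ord1 distrC.
      by have := Hy j; rewrite lt_min => /andP[].
    by have := ler_norm (g x0 - g y); lra.
have rpi' : r <= pi by apply: (le_trans rpi); have := @pi_gt0 R; lra.
have c1 : cos r < 1.
  by rewrite -(@cos0 R) ltr_cos ?in_itv/= ?lexx ?pi_ge0 ?rpi' ?(ltW r0).
have c0 : 0 <= cos r by apply: cos_ge0_pihalf; rewrite rpi andbT; lra.
(* If [p x] exceeds [r2], every coordinate of [x] is within [r] of that of [x0] modulo 2 pi, so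
   [g x >= g x0 / 2]. The level [r1] lies halfway between [r2] and the maximum 2 d; the choice r <=
   pi / 2 keeps [r2] positive. *)
pose r2 := 2 * d%:R - 1 + cos r; pose r1 := (r2 + 2 * d%:R) / 2.
have r20 : 0 < r2 by rewrite /r2; lra.
have r21 : r2 < r1 by rewrite /r1 /r2; lra.
have r1d : r1 < 2 * d%:R by rewrite /r1 /r2; lra.
have gp x : r2 < p x -> g x0 / 2 <= g x.
  move=> rp; have H i : cos r < cos (x ord0 i - x0 ord0 i).
    have : p x <= 2 * d%:R - 1 + cos (x ord0 i - x0 ord0 i).
      rewrite pE (bigD1 i)//=; have : \sum_(j < d | j != i) (1 + cos (x ord0 j - x0 ord0 j)) <= \sum_(j < d | j != i) 2.
        by apply: ler_sum => j _; have := cos_le1 (x ord0 j - x0 ord0 j); lra.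
      have : \sum_(j < d) (2 : R) = 2 * d%:R by rewrite sumr_const card_ord mulr_natr.
      by rewrite (bigD1 i)//=; lra.
    by move: rp; rewrite /r2; lra.
  have [m Hm] := choice (fun i => cos_gt_near r0 rpi' (H i)).
  rewrite -(cg.2 x (\row_i m i)); apply: Hr => i.
  by rewrite !mxE addrAC; exact: Hm.
have g20 : 0 < g x0 / 2 by rewrite divr_gt0.
(* Continuous substitute for the indicator of the set where [p > r1]. *)
pose chi x := Num.max 0 (p x - r1).
have cchi : cper chi.
  apply: (cper_comp (phi := fun t => Num.max 0 (t - r1))) => // t.
  apply: (@continuous_max _ _ (fun=> 0) (fun t => t - r1) t); first exact: cst_continuous.
  by apply: continuousD; [exact: cvg_id|exact: cst_continuous].
have chi0 x : 0 <= chi x by rewrite /chi le_max lexx.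
have tchi : 0 < tint chi.
  rewrite lt_neqAle; apply/andP; split; last first.
    rewrite -(mul0r ((2 * pi) ^+ d)) -tint_cst.
    by apply: tint_le => //; exact: cper_cst.
  apply/eqP => /esym /(tint_eq0 cchi chi0) /(_ x0).
  by rewrite /chi px0 => /eqP; rewrite gt_eqF// lt_max subr_gt0 r1d orbT.
pose Q := (g x0 / 2 + K) * (2 * pi) ^+ d.
(* Pointwise, [g * p ^+ n] is at least a multiple of [r1 ^+ n * chi] minus a multiple of [r2 ^+ n],
   while its integral is 0. As r2 < r1, this fails for large [n]. *)
have key n : g x0 / 2 / (2 * d%:R) * tint chi * r1 ^+ n <= Q * r2 ^+ n.
  pose A := g x0 / 2 / (2 * d%:R) * r1 ^+ n; pose B := (g x0 / 2 + K) * r2 ^+ n.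
  have : tint (fun x => A * chi x - B) <= tint (fun x => g x * p x ^+ n).
    apply: tint_le; [apply: cperB; [exact: cperZ|exact: cper_cst]|exact: cperM|].
    move=> x; have [pr|pr] := leP (p x) r2.
      rewrite /chi max_l; last by rewrite subr_le0 (le_trans pr)// ltW.
      rewrite mulr0 sub0r.
      have : - (K * r2 ^+ n) <= g x * p x ^+ n.
        rewrite lerNl -mulNr; apply: le_trans (ler_norm _) _.
        rewrite normrM normrN ler_pM// (ger0_norm (exprn_ge0 _ _))//.
        by apply: lerXn2r => //; rewrite nnegrE// ltW.
      have : 0 < r2 ^+ n by rewrite exprn_gt0.
      by rewrite /B; nra.
    have pn0 : 0 <= p x ^+ n by rewrite exprn_ge0.
    have h1 : g x0 / 2 * p x ^+ n <= g x * p x ^+ n by rewrite ler_wpM2r// gp.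
    have B0 : 0 <= B by rewrite /B mulr_ge0// ?exprn_ge0// ltW// addr_gt0.
    suff : A * chi x <= g x0 / 2 * p x ^+ n by lra.
    rewrite /A /chi; have [le|gt] := leP (p x - r1) 0.
      by rewrite mulr0 mulr_ge0// ltW.
    have r1n : 0 <= r1 ^+ n by rewrite exprn_ge0// ltW// (lt_trans r20).
    rewrite [leLHS](_ : _ = g x0 / 2 * (r1 ^+ n * ((p x - r1) / (2 * d%:R)))); last first.
      by move: ((2 * d%:R)^-1 : R) => D; ring.
    rewrite ler_pM2l//.
    have hr : r1 ^+ n <= p x ^+ n.
      apply: lerXn2r; rewrite ?nnegrE//; first by rewrite ltW// (lt_trans r20).
      by rewrite -subr_ge0 ltW.
    apply: le_trans hr; rewrite ler_piMr// ler_pdivrMr; last by lra.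
    by have := p_le x; lra.
  have := orth n 1 0 0.
  rewrite (_ : (fun x => _ * mode 1 0 0 x) = (fun x => g x * p x ^+ n)); last first.
    apply/funext => x; rewrite /mode (_ : phase 0 x = 0) ?cos0 ?mul0r ?addr0 ?mulr1//.
    by rewrite /phase /dot big1// => i _; rewrite !mxE mul0r.
  move=> ->.
  have -> : tint (fun x => A * chi x - B) = A * tint chi - B * (2 * pi) ^+ d.
    by rewrite tintB; [rewrite tintZ// tint_cst|exact: cperZ|exact: cper_cst].
  by rewrite /A /B /Q; lra.
have r10 : 0 < r1 by rewrite (lt_trans r20).
have cv0 : (fun n => Q * (r2 / r1) ^+ n) @ \oo --> (0 : R).
  rewrite -(mulr0 Q); apply: cvgM; first exact: cvg_cst.
  apply: cvg_expr; rewrite ger0_norm; last by rewrite divr_ge0// ltW.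
  by rewrite ltr_pdivrMr ?mul1r.
have T0 : 0 < g x0 / 2 / (2 * d%:R) * tint chi.
  by rewrite mulr_gt0// divr_gt0// mulr_gt0// ltr0n.
have [n _ /(_ n (leqnn n))] := cvgr_lt _ cv0 _ T0.
rewrite /= exprMn exprVn mulrA ltNge ler_pdivlMr ?exprn_gt0// => /negP; apply.
exact: key.
Qed.

End fourier_uniqueness.

Lemma continuous_eps (R : realType) (T : topologicalType) (f : T -> R) :
  (forall x (t : R), 0 < t -> nbhs x [set y | `|f x - f y| < t]) -> continuous f.
Proof.
move=> H x B /nbhs_ballP[t t0 Ht]; apply: filterS (H x t t0) => y /= xy.
by apply: Ht; rewrite -ball_normE.
Qed.

Lemma continuous_near (R : realType) (T : topologicalType) (f : T -> R) x (t : R) :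
  continuous f -> 0 < t -> nbhs x [set y | `|f x - f y| < t].
Proof.
move=> cf t0; have H := cf x (ball (f x) t) (nbhsx_ballx _ _ t0).
by apply: (@filterS _ (nbhs x) _ _ _ _ H) => y /=; rewrite -ball_normE.
Qed.

Section fourier_series.
Context {R : realType} {d : nat}.
Local Notation V := 'rV[R]_d.
Implicit Types (f g : V -> R) (x y z : V) (k l : 'rV[int]_d).

Definition fterm f k : V -> R := mode (fcos f k) (fsin f k) k.

Definition fsum f n x : R := \sum_(k <- kseq n) fterm f k x.

Lemma fsum_cper f n : cper (fsum f n).
Proof. by apply: cper_sum => k; exact: mode_cper. Qed.

Lemma sum_kseq_pair (F : 'rV[int]_d -> R) l n : l \in kseq n -> - l \in kseq n ->
  \sum_(k <- kseq n) F k * (k == l)%:R = F l /\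
  \sum_(k <- kseq n) F k * (k == - l)%:R = F (- l).
Proof.
have H m : m \in kseq n -> \sum_(k <- kseq n) F k * (k == m)%:R = F m.
  move=> mn; rewrite (bigD1_seq m)//= ?kseq_uniq// eqxx mulr1 big1 ?addr0// => k km.
  by rewrite (negbTE km) mulr0.
by move=> l1 l2; split; exact: H.
Qed.

(** Each coefficient of the partial sum is one half of the contribution of [l] plus one half of that
    of - [l], so both frequencies must already be present. *)
Lemma fcos_fsum f l n : cper f -> l \in kseq n -> - l \in kseq n ->
  fcos (fsum f n) l = fcos f l /\ fsin (fsum f n) l = fsin f l.
Proof.
move=> cf l1 l2; split.
  rewrite fcos_sum; last by move=> k; exact: mode_cper.
  rewrite (eq_bigr (fun k => 2^-1 * (fcos f k * (k == l)%:R) + 2^-1 * (fcos f k * (k == - l)%:R))).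
    rewrite big_split/= -!mulr_sumr.
    have [-> ->] := sum_kseq_pair (fcos f) l1 l2.
    by rewrite fcosN; field.
  by move=> k _; rewrite fcos_mode; ring.
rewrite fsin_sum; last by move=> k; exact: mode_cper.
rewrite (eq_bigr (fun k => 2^-1 * (fsin f k * (k == l)%:R) - 2^-1 * (fsin f k * (k == - l)%:R))).
  rewrite sumrB -!mulr_sumr.
  have [-> ->] := sum_kseq_pair (fsin f) l1 l2.
  by rewrite fsinN//; field.
by move=> k _; rewrite fsin_mode; ring.
Qed.

Lemma kseq_sum_cvg (F : 'rV[int]_d -> R) (M : R) : (forall k, 0 <= F k) ->
  (forall n, \sum_(k <- kseq n) F k <= M) ->
  let T n := \sum_(k <- kseq n) F k in
  cvgn T /\ forall n, T n <= limn T.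
Proof.
move=> F0 FM T.
have nd : nondecreasing_seq T.
  move=> m n mn; rewrite /T -(subnKC mn) kseqD big_cat/= lerDl.
  by apply: sumr_ge0 => k _.
have cT : cvgn T.
  by apply: nondecreasing_is_cvgn => //; exists M => _ [n _ <-]; exact: FM.
by split => // n; exact: nondecreasing_cvgn_le.
Qed.

(** The summable weights [W] make the partial sums uniformly Cauchy. The limit [S] is continuous
    with the coefficients of [f], and [fourier_unique] applied to f - S and S - f identifies it with
    [f]. *)
Lemma fourier_uniform f (eps : R) : smoothT f -> 0 < eps ->
  exists N, forall n, (N <= n)%N -> forall x, `|f x - fsum f n x| <= eps.
Proof.
move=> sf e0; have cf := smoothT_cper sf.
have [C C0 HC] := fourier_decay sf.
pose W k : R := 2 * C * kweight k.
have W0 k : 0 <= W k by rewrite !mulr_ge0// ltW// kweight_gt0.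
have tW k x : `|fterm f k x| <= W k.
  apply: le_trans (mode_le _ _ _ _) _; have [h1 h2] := HC k.
  apply: le_trans (lerD h1 h2) _; rewrite /W.
  have := kweight_le1 (R := R) k; have := kweight_gt0 (R := R) k.
  set w := kweight k => w0 w1.
  have : C * w ^+ 2 <= C * w by rewrite ler_pM2l// expr2 ler_piMl// ltW.
  lra.
pose T n := \sum_(k <- kseq n) W k.
have [cT TL] : cvgn T /\ forall n, T n <= limn T.
  apply: (@kseq_sum_cvg W (2 * C * 6 ^+ d)) => // n.
  rewrite /W -mulr_sumr; apply: ler_wpM2l; first by rewrite mulr_ge0// ltW.
  exact: sum_kweight (kseq_uniq _).
have dST m n x : (m <= n)%N -> `|fsum f n x - fsum f m x| <= T n - T m.
  by move=> mn; apply: ler_sum_kseq => // k; exact: tW.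
have cS x : cvgn (fun n => fsum f n x).
  (* Adding the partial sums of the dominating series makes the sequence monotone and bounded, hence
     convergent. *)
  have c1 : cvgn (fun n => fsum f n x + T n).
    apply: nondecreasing_is_cvgn.
      move=> m n mn; have := dST _ _ x mn; rewrite ler_norml => /andP[].
      by lra.
    exists (`|fsum f 0 x| + 2 * limn T) => _ [n _ <-].
    have := dST _ _ x (leq0n n); rewrite ler_norml => /andP[_].
    have := TL n; have : 0 <= T 0%N by apply: sumr_ge0 => k _.
    by have := ler_norm (fsum f 0 x); lra.
  rewrite (_ : (fun n => fsum f n x) = (fun n => (fsum f n x + T n) - T n)).
    exact: is_cvgB.
  by apply/funext => n; rewrite addrK.
pose S x := limn (fun n => fsum f n x).
have ST m x : `|S x - fsum f m x| <= limn T - T m.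
  have c : (fun n => `|fsum f n x - fsum f m x|) @ \oo --> `|S x - fsum f m x|.
    by apply: cvg_norm; apply: cvgB; [exact: cS|exact: cvg_cst].
  rewrite -(cvg_lim _ c)//; apply: limr_le; first by apply/cvg_ex; eexists; exact: c.
  near=> n; apply: le_trans (dST m n x _) _; last by rewrite lerD2r.
  by near: n; exists m.
have tail (t : R) : 0 < t -> exists N, forall n, (N <= n)%N -> limn T - T n <= t.
  move=> t0; have /cvgrPdist_le /(_ _ t0) [N _ H] : T @ \oo --> limn T := cT.
  exists N => n /H /=; rewrite ger0_norm// subr_ge0; exact: TL.
have cpS : cper S.
  split; last first.
    move=> x k; rewrite /S; congr (limn _); apply/funext => n.
    exact: (fsum_cper f n).2.
  apply: continuous_eps => x t t0.
  have [N HN] := tail (t / 4) (divr_gt0 t0 (ltr0n R 4)).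
  have := continuous_near x (fsum_cper f N).1 (divr_gt0 t0 (ltr0n R 4)).
  apply: filterS => y /=.
  have := ST N x; have := ST N y; have := HN N (leqnn N).
  rewrite !ler_norml !ltr_norml => h /andP[? ?] /andP[? ?] /andP[? ?].
  by apply/andP; split; lra.
have ST0 k : fcos S k = fcos f k /\ fsin S k = fsin f k.
  suff H (t : R) : 0 < t -> `|fcos S k - fcos f k| <= t /\ `|fsin S k - fsin f k| <= t.
    split; apply/eqP; rewrite -subr_eq0 -normr_eq0 eq_le normr_ge0 andbT;
      apply/ler_addgt0Pr => t /H[]; by rewrite add0r.
  move=> t0; have [N HN] := tail t t0.
  have [M HM] := kseq_exhaust [:: k; - k].
  pose n := maxn N M.
  have kM : {subset [:: k; - k] <= kseq n} by apply: HM; exact: leq_maxr.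
  have [|| <- <-] := @fcos_fsum f k n cf; try by apply: kM; rewrite !inE eqxx ?orbT.
  have cfs := fsum_cper f n.
  have Sn x : `|S x - fsum f n x| <= t.
    by apply: le_trans (ST n x) _; apply: HN; exact: leq_maxl.
  rewrite -fcosB// -fsinB//; split; [apply: fcos_le|apply: fsin_le] => //; exact: cperB.
have fS x : f x = S x.
  have H1 := @fourier_unique R d (fun x => f x - S x) (cperB cf cpS) _ x.
  have H2 := @fourier_unique R d (fun x => S x - f x) (cperB cpS cf) _ x.
  apply/eqP; rewrite eq_le -subr_le0 H1/=; last first.
    by move=> k; rewrite fcosB// fsinB//; have [-> ->] := ST0 k; rewrite !subrr.
  rewrite -subr_le0 H2// => k.
  by rewrite fcosB// fsinB//; have [-> ->] := ST0 k; rewrite !subrr.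
have [N HN] := tail eps e0.
exists N => n Nn x; rewrite fS; apply: le_trans (ST n x) _; exact: HN.
Unshelve. all: by end_near. Qed.

End fourier_series.

(** * Polynomial bounds for 1 - cos from both sides *)

Section symbol.
Context {R : realType}.

Lemma sin_le_id (y : R) : 0 <= y -> sin y <= y.
Proof.
move=> y0.
have D x : 0 <= x <= y -> is_derive x (1 : R) (fun t => t - sin t) (1 - cos x).
  by move=> _; exact: (derfB (derf_id x) (is_derive_sin x)).
have [c _ E] := mean_value y0 D.
have : 0 <= (1 - cos c) * (y - 0) by rewrite mulr_ge0 ?subr_ge0 ?cos_le1.
by rewrite -E sin0; lra.
Qed.

Lemma sin_sqr_le (y : R) : sin y ^+ 2 <= y ^+ 2.
Proof.
wlog y0 : y / 0 <= y.
  move=> H; have [/H//|/ltW y0] := leP 0 y.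
  by have := H (- y); rewrite sinN !sqrrN oppr_ge0; apply.
have [y1|y1] := leP y 1.
  have h := sin_le_id y0.
  have s0 : 0 <= sin y.
    by apply: sin_ge0_pi; rewrite y0 /=; have := @pi_ge2 R; lra.
  by rewrite lerXn2r// nnegrE.
apply: (@le_trans _ _ 1); last by rewrite -[leLHS](expr1n _ 2) lerXn2r ?nnegrE// ltW.
by have := cos2Dsin2 y; have := sqr_ge0 (cos y); lra.
Qed.

Lemma one_sub_cos (t : R) : 1 - cos t = 2 * sin (t / 2) ^+ 2.
Proof.
rewrite -{1}(divfK (_ : 2 != 0) t)// mulr_natr mulr2n cosD -!expr2.
by have := cos2Dsin2 (t / 2); lra.
Qed.

Lemma one_sub_cos_le (t : R) : 1 - cos t <= t ^+ 2 / 2.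
Proof. by rewrite one_sub_cos; have := sin_sqr_le (t / 2); rewrite exprMn exprVn; lra. Qed.

Lemma sin_ge_cubic (y : R) : 0 <= y -> y - y ^+ 3 <= sin y.
Proof.
move=> y0.
have D x : 0 <= x <= y -> is_derive x (1 : R) (fun t => sin t - t + t ^+ 3)
    (cos x - 1 + 3 * x ^+ 2).
  move=> _.
  apply: derf_eq (derfD (derfB (is_derive_sin x) (derf_id x)) (derfX 3 (derf_id x))) _.
  by rewrite mulr1.
have [c /andP[c0 _] E] := mean_value y0 D.
have : 0 <= (cos c - 1 + 3 * c ^+ 2) * (y - 0).
  rewrite mulr_ge0 ?subr0//; have := one_sub_cos_le c.
  by have := sqr_ge0 c; lra.
by rewrite -E sin0 expr0n/=; lra.
Qed.

(** Written as 2 sin^2 (t / 2). The cubic lower bound for sin is squared when t / 2 is at most 1;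
    beyond that the left-hand side is negative. *)
Lemma one_sub_cos_ge (t : R) : t ^+ 2 / 2 - t ^+ 4 / 2 <= 1 - cos t.
Proof.
rewrite one_sub_cos; set y := t / 2.
have -> : t = 2 * y by rewrite /y mulrC divfK.
suff : y ^+ 2 - 4 * y ^+ 4 <= sin y ^+ 2 by rewrite !exprMn; lra.
wlog y0 : y / 0 <= y.
  move=> H; have [/H//|/ltW y0] := leP 0 y.
  by have := H (- y); rewrite sinN !sqrrN oppr_ge0 (_ : (- y) ^+ 4 = y ^+ 4); [apply|ring].
have h := sin_ge_cubic y0.
have [y1|y1] := leP y 1.
  have s0 : 0 <= y - y ^+ 3.
    by rewrite subr_ge0 (exprS y 2) ler_piMr// expr_le1.
  have : (y - y ^+ 3) ^+ 2 <= sin y ^+ 2.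
    by rewrite lerXn2r// nnegrE// (le_trans s0).
  have : 0 <= y ^+ 4 by rewrite exprn_ge0.
  have : 0 <= y ^+ 6 by rewrite exprn_ge0.
  have -> : (y - y ^+ 3) ^+ 2 = y ^+ 2 - 2 * y ^+ 4 + y ^+ 6 by ring.
  by lra.
have : y ^+ 2 <= y ^+ 4.
  have -> : y ^+ 4 = y ^+ 2 * y ^+ 2 by ring.
  by rewrite ler_peMr ?sqr_ge0// expr2; nra.
by have := sqr_ge0 (sin y); have := sqr_ge0 y; lra.
Qed.

End symbol.

(** * The discrete generator approximates - |nabla| with error O(h) *)

Section bridging.
Context {R : realType} {d : nat}.
Local Notation V := 'rV[R]_d.
Local Notation e := (@basis_vec R d).
Implicit Types (f g : V -> R) (x y z : V) (k l : 'rV[int]_d) (h : R).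

(* Approximates [- |nabla|]: with the symbol [q] of the walk, [2 sqrt d / h * sqrt (1 - q)]
   tends to [|k|] as [h] tends to 0. *)
Definition gen h N f x : R :=
  2 * Num.sqrt d%:R / h * \sum_(n < N) acoef n * (walkn h n.+1 f x - f x).

Definition wsymb h k : R := 2^-1 + (2 * d%:R)^-1 * \sum_i cos (h * (k ord0 i)%:~R).

Definition gsymb h N k : R :=
  2 * Num.sqrt d%:R / h * \sum_(n < N) acoef n * (1 - wsymb h k ^+ n.+1).

Hypothesis d_gt0 : (0 < d)%N.

Let d_neq0 : d%:R != 0 :> R.
Proof. by rewrite pnatr_eq0 -lt0n. Qed.

Let d_pos : 0 < d%:R :> R.
Proof. by rewrite ltr0n. Qed.

Lemma walkn_mode h n (a b : R) k x :
  walkn h n (mode a b k) x = wsymb h k ^+ n * mode a b k x.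
Proof.
elim: n x => [|n IH] x; first by rewrite expr0 mul1r.
rewrite walknS /walk IH.
rewrite (eq_bigr (fun i => 2 * wsymb h k ^+ n * mode a b k x * cos (h * (k ord0 i)%:~R))).
  rewrite -mulr_sumr exprS.
  have E : \sum_i cos (h * (k ord0 i)%:~R) = (wsymb h k - 2^-1) * (2 * d%:R).
    by rewrite /wsymb addrAC subrr add0r mulrC mulVKf// mulf_neq0.
  by rewrite E; move: (wsymb h k) (d_neq0) => q dn; field.
move=> i _; rewrite !IH /mode !phaseD -scaleNr !phaseZ phase_basis mulNr.
by rewrite !cosD !sinD cosN sinN; ring.
Qed.

Let sqrtd0 : 0 <= Num.sqrt d%:R :> R := sqrtr_ge0 _.

Lemma wsymb_itv h k : 0 <= wsymb h k <= 1.
Proof.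
have S1 : \sum_i cos (h * (k ord0 i)%:~R) <= d%:R.
  apply: (@le_trans _ _ (\sum_(i < d) 1)); last by rewrite sumr_const card_ord.
  by apply: ler_sum => i _; exact: cos_le1.
have S2 : - d%:R <= \sum_i cos (h * (k ord0 i)%:~R).
  apply: (@le_trans _ _ (\sum_(i < d) -1)); first by rewrite sumrN sumr_const card_ord.
  by apply: ler_sum => i _; exact: cos_geN1.
rewrite /wsymb; set S := \sum_i _ in S1 S2 *.
have -> : 2^-1 + (2 * d%:R)^-1 * S = (d%:R + S) / (2 * d%:R).
  by have := d_neq0 => ?; field.
by rewrite divr_ge0 ?ler_pdivrMr ?mulr_gt0//; lra.
Qed.

(** With s = (2 sqrt d / h) sqrt (1 - [wsymb h k]), the square s^2 is (2 / h^2) times the sum of 1 -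
    cos (h k_i), hence lies between |k|^2 - h^2 |k|^4 and |k|^2. This gives |k| - h |k|^2 <= s <=
    |k|; the last term is the truncation error from [sqrt_approx]. *)
Lemma gsymb_near h N k : 0 < h ->
  `|gsymb h N k - enorm (intvec k : V)| <=
  h * enorm (intvec k : V) ^+ 2 + 2 * Num.sqrt d%:R / h * bcoef N.
Proof.
move=> h0; set K := enorm _; set c := 2 * Num.sqrt d%:R / h.
have c0 : 0 <= c by rewrite /c divr_ge0 ?mulr_ge0// ltW.
have K0 : 0 <= K by exact: sqrtr_ge0.
have K2 : K ^+ 2 = \sum_i (k ord0 i)%:~R ^+ 2.
  rewrite /K /enorm sqr_sqrtr; last by apply: sumr_ge0 => i _; rewrite -expr2 sqr_ge0.
  by apply: eq_bigr => i _; rewrite mxE expr2.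
pose s := c * Num.sqrt (1 - wsymb h k).
have q01 := wsymb_itv h k.
have s0 : 0 <= s by rewrite mulr_ge0.
have s2 : s ^+ 2 = 2 / h ^+ 2 * \sum_i (1 - cos (h * (k ord0 i)%:~R)).
  rewrite exprMn sqr_sqrtr; last by case/andP: q01; rewrite subr_ge0.
  rewrite /c !exprMn exprVn sqr_sqrtr ?ler0n// /wsymb sumrB sumr_const card_ord.
  by have := d_neq0 => ?; field; rewrite d_neq0 gt_eqF.
have sK : s <= K.
  rewrite -(ler_pXn2r (n := 2))// ?nnegrE// s2 K2.
  rewrite mulrAC ler_pdivrMr ?exprn_gt0// [leRHS]mulrC !mulr_sumr.
  apply: ler_sum => i _; have := one_sub_cos_le (h * (k ord0 i)%:~R).
  by rewrite exprMn; lra.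
have Ks : K - h * K ^+ 2 <= s.
  (* For h K >= 1 the left-hand side is nonpositive; only in the other case may both sides be
     squared. *)
  have [hK|hK] := leP 1 (h * K).
    by apply: le_trans s0; rewrite subr_le0 expr2 mulrA ler_peMl.
  rewrite -(ler_pXn2r (n := 2))// ?nnegrE//; last first.
    by rewrite subr_ge0 expr2 mulrA ler_piMl// ltW.
  have K4 : \sum_i (k ord0 i)%:~R ^+ 4 <= K ^+ 4.
    have -> : K ^+ 4 = K ^+ 2 * K ^+ 2 by ring.
    rewrite K2 mulr_sumr.
    apply: ler_sum => i _.
    rewrite (_ : _ ^+ 4 = (k ord0 i)%:~R ^+ 2 * (k ord0 i)%:~R ^+ 2); last by ring.
    rewrite ler_wpM2r ?sqr_ge0//.
    by rewrite (bigD1 i)//= lerDl; apply: sumr_ge0 => j _; rewrite sqr_ge0.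
  apply: (@le_trans _ _ (K ^+ 2 - h ^+ 2 * K ^+ 4)).
    have -> : (K - h * K ^+ 2) ^+ 2 = K ^+ 2 - 2 * h * K * K ^+ 2 + h ^+ 2 * K ^+ 4 by ring.
    have : 0 <= (h * K - h ^+ 2 * K ^+ 2) * K ^+ 2.
      rewrite mulr_ge0 ?sqr_ge0// subr_ge0 -exprMn expr2 ler_piMl ?mulr_ge0// ltW//.
    have -> : (h * K - h ^+ 2 * K ^+ 2) * K ^+ 2 = h * K * K ^+ 2 - h ^+ 2 * K ^+ 4 by ring.
    by lra.
  apply: (@le_trans _ _ (K ^+ 2 - h ^+ 2 * \sum_i (k ord0 i)%:~R ^+ 4)).
    by rewrite lerD2l lerN2 ler_pM2l ?exprn_gt0.
  rewrite s2 [leRHS]mulrAC ler_pdivlMr ?exprn_gt0// K2 !mulr_sumr -sumrB mulr_suml.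
  apply: ler_sum => i _; have := one_sub_cos_ge (h * (k ord0 i)%:~R).
  rewrite !exprMn; set a := _%:~R.
  have -> : (a ^+ 2 - h ^+ 2 * a ^+ 4) * h ^+ 2 = h ^+ 2 * a ^+ 2 - h ^+ 4 * a ^+ 4 by ring.
  by lra.
have /andP[S1 S2] := sqrt_approx N q01.
have T1 : s - c * bcoef N <= gsymb h N k by rewrite /gsymb -/c /s -mulrBr ler_wpM2l.
have T2 : gsymb h N k <= s by rewrite /gsymb -/c /s ler_wpM2l.
have U1 : 0 <= h * K ^+ 2 by rewrite mulr_ge0 ?sqr_ge0// ltW.
have U2 : 0 <= c * bcoef N by rewrite mulr_ge0// ltW// bcoef_gt0.
by rewrite ler_norml; apply/andP; split; lra.
Qed.

Lemma gen_mode h N (a b : R) k x :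
  gen h N (mode a b k) x = - (gsymb h N k * mode a b k x).
Proof.
rewrite /gen /gsymb; set c := 2 * _ / h.
rewrite -[c * _ * mode a b k x]mulrA -mulrN; congr (c * _).
rewrite mulr_suml -sumrN; apply: eq_bigr => n _.
by rewrite walkn_mode; ring.
Qed.

Lemma gen_sum h N (I : Type) (s : seq I) (F : I -> V -> R) x :
  gen h N (fun y => \sum_(i <- s) F i y) x = \sum_(i <- s) gen h N (F i) x.
Proof.
rewrite /gen -mulr_sumr exchange_big; congr (_ * _).
apply: eq_bigr => n _. by rewrite walkn_sum -sumrB mulr_sumr.
Qed.

Lemma genB h N f g x : gen h N (fun y => f y - g y) x = gen h N f x - gen h N g x.
Proof.
rewrite /gen -mulrBr -sumrB; congr (_ * _); apply: eq_bigr => n _.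
by rewrite walknB; ring.
Qed.

Lemma sum_acoef_le1 N : \sum_(n < N) acoef n <= 1 :> R.
Proof.
have := sum_acoef (R := R) (leq0n N); rewrite big_mkord bcoef0 => ->.
by have := bcoef_gt0 (R := R) N; lra.
Qed.

(** Not uniform in [h]: it serves at a fixed [h] to discard the remainder of a Fourier series. *)
Lemma gen_bound h N f x (K : R) : 0 < h -> (forall y, `|f y| <= K) ->
  `|gen h N f x| <= 2 * Num.sqrt d%:R / h * (2 * K).
Proof.
move=> h0 fK; have K0 : 0 <= K by apply: le_trans (fK x).
rewrite /gen normrM (@ger0_norm _ (2 * _ / h)); last by rewrite divr_ge0 ?mulr_ge0// ltW.
apply: ler_wpM2l; first by rewrite divr_ge0 ?mulr_ge0// ltW.
apply: le_trans (ler_norm_sum _ _ _) _.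
apply: (@le_trans _ _ (\sum_(n < N) acoef n * (2 * K))).
  apply: ler_sum => n _; rewrite normrM (gtr0_norm (acoef_gt0 n)).
  apply: ler_wpM2l; first by rewrite ltW// acoef_gt0.
  apply: le_trans (ler_normB _ _) _.
  by have := normr_walkn_le d_gt0 h n.+1 x fK; have := fK x; lra.
by rewrite -mulr_suml ler_piMl ?sum_acoef_le1// mulr_ge0.
Qed.

(** The lattice sum is a supremum over finite subsets; for nonnegative terms the sets [kseq n]
    already reach it. *)
Lemma esum_kseq (p : 'rV[int]_d -> R) (M : R) : (forall k, 0 <= p k) ->
  (forall n, \sum_(k <- kseq n) p k <= M) ->
  (fun n => \sum_(k <- kseq n) p k) @ \oo --> fine (\esum_(k in [set: 'rV[int]_d]) (p k)%:E).
Proof.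
move=> p0 pM; have [cT TL] := kseq_sum_cvg p0 pM.
suff -> : (\esum_(k in [set: 'rV[int]_d]) (p k)%:E = (limn (fun n => \sum_(k <- kseq n) p k))%:E)%E.
  exact: cT.
apply/eqP; rewrite eq_le; apply/andP; split.
  apply: ub_ereal_sup => _ [X [fX _] <-].
  rewrite fsbig_finite//= sumEFin lee_fin.
  set s := finmap.enum_fset _.
  have us : uniq s by exact: finmap.fset_uniq.
  have [n Hn] := kseq_exhaust s.
  apply: le_trans (TL n).
  rewrite [leRHS](bigID (mem s))/= -[leLHS]addr0; apply: lerD; last exact: sumr_ge0.
  rewrite -[leRHS]big_filter.
  suff -> : \sum_(k <- s) p k = \sum_(k <- [seq k <- kseq n | mem s k]) p k by [].
  apply: perm_big; apply: uniq_perm.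
  - exact: us.
  - by rewrite filter_uniq// kseq_uniq.
  - move=> k; rewrite mem_filter /=.
    by have [kX|] := boolP (k \in s) => //=; rewrite (Hn n).
have H n : ((\sum_(k <- kseq n) p k)%:E <= \esum_(k in [set: 'rV[int]_d]) (p k)%:E)%E.
  apply: esum_ge; exists [set` kseq n].
    by split => //; exact: finite_seq.
  by rewrite -fsbig_seq ?kseq_uniq// sumEFin.
case E : (\esum_(k in [set: 'rV[int]_d]) (p k)%:E)%E H => [r| |] H.
- rewrite lee_fin; apply: limr_le => //; apply: nearW => n.
  by have := H n; rewrite lee_fin.
- exact: leey.
- by have := H 0%N; rewrite leeNy_eq.
Qed.

Lemma absnabla_lim f x (M : R) : (forall n, \sum_(k <- kseq n) `|absnabla_term f x k| <= M) ->
  (fun n => \sum_(k <- kseq n) absnabla_term f x k) @ \oo --> absnabla f x.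
Proof.
move=> tM; rewrite (_ : (fun n => _) = (fun n => \sum_(k <- kseq n) Num.max (absnabla_term f x k) 0
   - \sum_(k <- kseq n) Num.max (- absnabla_term f x k) 0)).
  apply: cvgB; (apply: (@esum_kseq _ M); first by [move=> k; rewrite le_max lexx orbT]) => n;
    apply: le_trans (tM n); apply: ler_sum => k _; rewrite ge_max normr_ge0 andbT.
    exact: ler_norm.
  by rewrite -normrN ler_norm.
apply/funext => n; rewrite -sumrB; apply: eq_bigr => k _.
by case: (leP (absnabla_term f x k) 0) => a0; case: leP => b0; lra.
Qed.

(** On the mode [k] the error is at most h (|k|^2 + 2 sqrt d) times the size of the mode, by
    [gsymb_near] and the choice of [N]; the decay of the coefficients sums these errors uniformly in
    [x]. The Fourier series is truncated only after [h] is fixed. *)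
Lemma gen_absnabla f : smoothT f -> exists2 C, 0 < C &
  forall h N x, 0 < h -> bcoef N <= h ^+ 2 -> `|gen h N f x + absnabla f x| <= C * h.
Proof.
move=> sf; have cf := smoothT_cper sf.
have [C0 C0p HC] := fourier_decay sf.
pose c := 1 + 2 * Num.sqrt d%:R : R.
have c1 : 1 <= c by rewrite lerDl mulr_ge0.
have tw x k : `|fterm f k x| * (1 + enorm (intvec k : V) ^+ 2) <= 2 * C0 * kweight k.
  have [h1 h2] := HC k; set K := 1 + _.
  have K1 : 0 <= K by rewrite addr_ge0// sqr_ge0.
  have := enorm_weight (R := R) k; rewrite -/K => Kw.
  have w0 := kweight_gt0 (R := R) k.
  apply: (@le_trans _ _ (2 * (C0 * kweight k ^+ 2) * K)).
    rewrite ler_wpM2r//; apply: le_trans (mode_le _ _ _ _) _; lra.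
  rewrite [leLHS](_ : _ = 2 * C0 * kweight k * (K * kweight k)); last by ring.
  by rewrite ler_piMr// !mulr_ge0// ltW.
pose S := 2 * C0 * 6 ^+ d.
have Sw n x : \sum_(k <- kseq n) `|fterm f k x| * (1 + enorm (intvec k : V) ^+ 2) <= S.
  apply: (@le_trans _ _ (\sum_(k <- kseq n) 2 * C0 * kweight k)); first exact: ler_sum.
  rewrite -mulr_sumr; apply: ler_wpM2l; first by rewrite mulr_ge0// ltW.
  exact: sum_kweight (kseq_uniq _).
have S0 : 0 < S by rewrite !mulr_gt0// exprn_gt0.
exists (c * S); first by rewrite mulr_gt0// (lt_le_trans ltr01).
move=> h N x h0 hN.
have tE k : absnabla_term f x k = enorm (intvec k : V) * fterm f k x by [].
have lim1 : (fun n => \sum_(k <- kseq n) absnabla_term f x k) @ \oo --> absnabla f x.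
  apply: (@absnabla_lim _ _ S) => n; apply: le_trans (Sw n x).
  apply: ler_sum => k _; rewrite tE normrM mulrC ler_wpM2l//.
  rewrite ger0_norm ?sqrtr_ge0//.
  by move: (enorm _) => K; have := sqr_ge0 (K - 1); have := sqr_ge0 K; nra.
apply/ler_addgt0Pr => t t0.
pose cc := 2 * Num.sqrt d%:R / h.
have cc0 : 0 <= cc by rewrite divr_ge0 ?mulr_ge0// ltW.
(* Small enough to compensate the factor of order 1 / h in [gen_bound] and leave t / 2. *)
pose eps := t / 2 / (2 * (cc + 1)).
have eps0 : 0 < eps by rewrite divr_gt0// ?divr_gt0// mulr_gt0// ltr_pwDr.
have [N1 H1] := fourier_uniform sf eps0.
have /cvgrPdist_le /(_ (t / 2)) := lim1.
move=> /(_ (divr_gt0 t0 (ltr0n R 2)))[N2 _ H2].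
pose n := maxn N1 N2.
have A1 : `|gen h N f x - gen h N (fsum f n) x| <= t / 2.
  rewrite -genB; apply: le_trans (gen_bound N _ h0 (H1 n (leq_maxl _ _))) _.
  rewrite -/cc /eps mulrA.
  have -> : cc * 2 * (t / 2 / (2 * (cc + 1))) = t / 2 * (cc / (cc + 1)).
    by field; lra.
  apply: ler_piMr; first by rewrite ltW// divr_gt0.
  by rewrite ler_pdivrMr ?mul1r; lra.
have A2 := H2 n (leq_maxr _ _).
have A3 : `|gen h N (fsum f n) x + \sum_(k <- kseq n) absnabla_term f x k| <= c * S * h.
  rewrite /fsum gen_sum -big_split/=; apply: le_trans (ler_norm_sum _ _ _) _.
  apply: (@le_trans _ _ (\sum_(k <- kseq n) c * h * (`|fterm f k x| * (1 + enorm (intvec k : V) ^+ 2)))).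
    apply: ler_sum => k _; rewrite tE.
    have -> : gen h N (mode (fcos f k) (fsin f k) k) x = - (gsymb h N k * fterm f k x).
      exact: gen_mode.
    move: (fterm f k x) => m.
    have -> : - (gsymb h N k * m) + enorm (intvec k : V) * m =
        - (gsymb h N k - enorm (intvec k : V)) * m by ring.
    rewrite normrM normrN.
    rewrite [leRHS](_ : _ = c * h * (1 + enorm (intvec k : V) ^+ 2) * `|m|); last by ring.
    apply: ler_wpM2r => //.
    apply: le_trans (gsymb_near N k h0) _.
    set K := enorm _; have K0 : 0 <= K ^+ 2 by exact: sqr_ge0.
    have : 2 * Num.sqrt d%:R / h * bcoef N <= 2 * Num.sqrt d%:R * h.
      by rewrite mulrAC ler_pdivrMr// -[leRHS]mulrA ler_wpM2l ?mulr_ge0.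
    have : 0 <= 2 * Num.sqrt d%:R * h * K ^+ 2.
      by apply: mulr_ge0 => //; apply: mulr_ge0; [exact: mulr_ge0|exact: ltW].
    by rewrite /c; have := h0; nra.
  rewrite -mulr_sumr (mulrAC c S) ler_wpM2l//.
  by rewrite mulr_ge0 ?ltW// (lt_le_trans ltr01).
have -> : gen h N f x + absnabla f x = (gen h N f x - gen h N (fsum f n) x)
   + (gen h N (fsum f n) x + \sum_(k <- kseq n) absnabla_term f x k)
   + (absnabla f x - \sum_(k <- kseq n) absnabla_term f x k) by ring.
apply: le_trans (ler_normD _ _) _.
have := ler_normD (gen h N f x - gen h N (fsum f n) x)
  (gen h N (fsum f n) x + \sum_(k <- kseq n) absnabla_term f x k).
move: A2 => /=; lra.
Qed.

End bridging.

(* A positive maximum of [g - 2 eps (t - a)] is impossible. *)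
Lemma dini_le0 (R : realType) (g : R -> R) (a b : R) : a <= b ->
  (forall t, a <= t <= b -> {for t, continuous g}) -> g a <= 0 ->
  (forall t, a < t -> t <= b -> 0 < g t -> forall eps, 0 < eps ->
     exists s, [/\ a <= s, s < t & g t - g s <= eps * (t - s)]) ->
  g b <= 0.
Proof.
move=> ab cg ga H; rewrite leNgt; apply/negP => gb.
have ab' : a < b.
  by rewrite lt_neqAle ab andbT; apply/eqP => E; move: gb; rewrite -E ltNge ga.
pose eps := g b / (4 * (b - a)).
have e0 : 0 < eps by rewrite divr_gt0// mulr_gt0// subr_gt0.
pose k t := g t - 2 * eps * (t - a).
have kb : 0 < k b.
  have -> : k b = g b / 2 by rewrite /k /eps; field; lra.
  by rewrite divr_gt0.
have [|t] := @EVT_max R k a b ab.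
  apply: continuous_in_subspaceT => t; rewrite inE/= in_itv/= => tab.
  apply: (@continuousB _ _ _ g (fun t => 2 * eps * (t - a))); first exact: cg.
  apply: (@continuousM _ _ (fun=> 2 * eps) (fun t => t - a)); first exact: cst_continuous.
  by apply: (@continuousB _ _ _ id (fun=> a)); [exact: cvg_id|exact: cst_continuous].
rewrite in_itv/= => /andP[at_ tb] kmax.
have kt : 0 < k t.
  by apply: (lt_le_trans kb); apply: kmax; rewrite in_itv/= lexx ltW.
have gtp : 0 < g t.
  apply: (lt_le_trans kt); by rewrite /k gerBl mulr_ge0 ?subr_ge0// mulr_ge0// ltW.
have at' : a < t.
  by rewrite lt_neqAle at_ andbT; apply/eqP => E; move: gtp; rewrite -E ltNge ga.
have [s [as_ st E]] := H t at' tb gtp eps e0.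
have : k s <= k t by apply: kmax; rewrite in_itv/= as_ (le_trans (ltW st)).
have : 0 < eps * (t - s) by rewrite mulr_gt0// subr_gt0.
rewrite /k; lra.
Qed.

Lemma local_lip_continuous (R : realType) (g : R -> R) (r del L : R) : 0 < del ->
  (forall r', `|r' - r| < del -> `|g r - g r'| <= L * `|r' - r|) ->
  {for r, continuous g}.
Proof.
move=> del0 H; apply/cvgrPdist_lt => w w0.
pose L1 := `|L| + 1; have L10 : 0 < L1 by rewrite ltr_wpDl.
apply/nbhs_ballP; exists (Num.min del (w / L1)); first by rewrite /= lt_min del0 divr_gt0.
move=> r' rr'; have : `|r - r'| < Num.min del (w / L1) by exact: rr'.
rewrite /= lt_min distrC => /andP[h1 h2].
apply: le_lt_trans (H r' h1) _; apply: (@le_lt_trans _ _ (L1 * `|r' - r|)).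
  by rewrite ler_wpM2r// /L1; have := ler_norm L; lra.
by rewrite mulrC -ltr_pdivlMr.
Qed.

(** * Self-adjointness of the walk and the sign of the discrete nonlinear form *)

Section generator_form.
Context {R : realType} {d : nat}.
Local Notation V := 'rV[R]_d.
Local Notation e := (@basis_vec R d).
Implicit Types (f g U : V -> R) (x y z : V) (h : R).

Lemma walk_cper h f : cper f -> cper (walk h f).
Proof.
move=> cf; apply: cperD; first exact: cperZ.
by apply/cperZ/cper_sum => i; apply: cperD; exact: cper_shift.
Qed.

Lemma walkn_cper h n f : cper f -> cper (walkn h n f).
Proof. by move=> cf; elim: n => [//|n IH]; rewrite walknS; exact: walk_cper. Qed.

Lemma tint_shiftM f g z : cper f -> cper g ->
  tint (fun x => f x * g (x + z)) = tint (fun x => f (x - z) * g x).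
Proof.
move=> cf cg.
rewrite -(tint_shift (- z) (cperM cf (cper_shift z cg))).
by congr tint; apply/funext => x; rewrite subrK.
Qed.

Lemma tint_walk h f g : cper f -> cper g ->
  tint (fun x => f x * walk h g x) = tint (fun x => walk h f x * g x).
Proof.
move=> cf cg; rewrite /walk.
have cs f1 z : cper f1 -> cper (fun x => f1 (x + z)) by exact: cper_shift.
have E1 : tint (fun x => f x * walk h g x) = 2^-1 * tint (fun x => f x * g x) +
    (4 * d%:R)^-1 * \sum_i (tint (fun x => f x * g (x + h *: e i)) +
                           tint (fun x => f x * g (x - h *: e i))).
  rewrite (_ : (fun x => _) = (fun x => 2^-1 * (f x * g x) + (4 * d%:R)^-1 *
     \sum_i (f x * g (x + h *: e i) + f x * g (x - h *: e i)))); last first.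
    apply/funext => x; rewrite /walk mulrDr mulrCA; congr (_ + _).
    rewrite mulrCA; congr (_ * _); rewrite mulr_sumr; apply: eq_bigr => i _.
    by rewrite mulrDr.
  rewrite tintD; last 2 first.
  - exact/cperZ/cperM.
  - by apply/cperZ/cper_sum => i; apply: cperD; apply: cperM => //; exact: cs.
  rewrite !tintZ; last 2 first.
  - by apply: cper_sum => i; apply: cperD; apply: cperM => //; exact: cs.
  - exact: cperM.
  rewrite tint_sum; last by move=> i; apply: cperD; apply: cperM => //; exact: cs.
  congr (_ + _ * _); apply: eq_bigr => i _.
  by rewrite tintD//; apply: cperM => //; exact: cs.
have E2 : tint (fun x => walk h f x * g x) = 2^-1 * tint (fun x => f x * g x) +
    (4 * d%:R)^-1 * \sum_i (tint (fun x => f (x - h *: e i) * g x) +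
                           tint (fun x => f (x + h *: e i) * g x)).
  rewrite (_ : (fun x => _) = (fun x => 2^-1 * (f x * g x) + (4 * d%:R)^-1 *
     \sum_i (f (x - h *: e i) * g x + f (x + h *: e i) * g x))); last first.
    apply/funext => x; rewrite /walk mulrDl -mulrA; congr (_ + _).
    rewrite -mulrA; congr (_ * _); rewrite mulr_suml; apply: eq_bigr => i _.
    by rewrite mulrDl addrC.
  rewrite tintD; last 2 first.
  - exact/cperZ/cperM.
  - by apply/cperZ/cper_sum => i; apply: cperD; apply: cperM => //; exact: cs.
  rewrite !tintZ; last 2 first.
  - by apply: cper_sum => i; apply: cperD; apply: cperM => //; exact: cs.
  - exact: cperM.
  rewrite tint_sum; last by move=> i; apply: cperD; apply: cperM => //; exact: cs.
  congr (_ + _ * _); apply: eq_bigr => i _.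
  by rewrite tintD//; apply: cperM => //; exact: cs.
rewrite -/(walk h g) -/(walk h f) E1 E2; congr (_ + _ * _).
by apply: eq_bigr => i _; rewrite !tint_shiftM// opprK.
Qed.

Lemma tint_walkn h n f g : cper f -> cper g ->
  tint (fun x => f x * walkn h n g x) = tint (fun x => walkn h n f x * g x).
Proof.
elim: n f g => [//|n IH] f g cf cg.
rewrite walknS tint_walk//; last exact: walkn_cper.
by rewrite IH// -?walknSr//; exact: walk_cper.
Qed.

(* [2 int f (Q U^2 - U Q U)] is symmetrized into the integral of [Q] applied in [y] to
   [(U y - U x) (f x U y - f y U x)]. *)
Lemma walkn_form_le0 h n f U : cper f -> cper U ->
  (forall x y, (U y - U x) * (f x * U y - f y * U x) <= 0) ->
  tint (fun x => f x * (walkn h n (fun y => U y ^+ 2) x - U x * walkn h n U x)) <= 0.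
Proof.
move=> cf cU H.
have cU2 : cper (fun x => U x ^+ 2).
  by apply: (cper_comp (phi := fun t => t ^+ 2)) => //; exact: exprn_continuous.
have cfU := cperM cf cU.
have cW f1 : cper f1 -> cper (walkn h n f1) by exact: walkn_cper.
pose I1 := tint (fun x => f x * walkn h n (fun y => U y ^+ 2) x).
pose I2 := tint (fun x => f x * U x * walkn h n U x).
have -> : tint (fun x => f x * (walkn h n (fun y => U y ^+ 2) x - U x * walkn h n U x)) = I1 - I2.
  rewrite /I1 /I2 -tintB; [|by apply: cperM => //; exact: cW|by apply: cperM => //; exact: cW].
  by congr tint; apply/funext => x; ring.
have J1 : I1 = tint (fun x => U x ^+ 2 * walkn h n f x).
  by rewrite /I1 tint_walkn//; congr tint; apply/funext => x; rewrite mulrC.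
have J2 : I2 = tint (fun x => U x * walkn h n (fun y => f y * U y) x).
  by rewrite /I2 tint_walkn//; congr tint; apply/funext => x; rewrite mulrC.
suff : (I1 + tint (fun x => U x ^+ 2 * walkn h n f x)) -
    (I2 + tint (fun x => U x * walkn h n (fun y => f y * U y) x)) <= 0.
  by rewrite -J1 -J2; lra.
have c1 : cper (fun x => f x * walkn h n (fun y => U y ^+ 2) x).
  by apply: cperM => //; exact: cW.
have c2 : cper (fun x => U x ^+ 2 * walkn h n f x) by apply: cperM => //; exact: cW.
have c3 : cper (fun x => f x * U x * walkn h n U x) by apply: cperM => //; exact: cW.
have c4 : cper (fun x => U x * walkn h n (fun y => f y * U y) x).
  by apply: cperM => //; exact: cW.
rewrite /I1 /I2 -!tintD// -tintB; [|exact: cperD|exact: cperD].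
rewrite -[leRHS](mul0r ((2 * pi) ^+ d)) -tint_cst; apply: tint_le => [||x].
- by apply: cperB; exact: cperD.
- exact: cper_cst.
pose G y := (U y - U x) * (f x * U y - f y * U x).
have -> : f x * walkn h n (fun y => U y ^+ 2) x + U x ^+ 2 * walkn h n f x -
  (f x * U x * walkn h n U x + U x * walkn h n (fun y => f y * U y) x) = walkn h n G x.
  rewrite -!walknZ -!walkn_add -walknB; congr (walkn h n _ x); apply/funext => y.
  by rewrite /G; ring.
by rewrite -(walkn0 h n x); apply: ler_walkn => y; exact: H.
Qed.

Lemma exists_bcoef (t : R) : 0 < t -> exists N, bcoef N <= t.
Proof.
move=> t0; exists (Num.bound (t ^- 2)).
set N := Num.bound _.
have hN : t ^- 2 < N%:R by apply: le_lt_trans (archi_boundP _); rewrite ?ler_norm// invr_ge0 sqr_ge0.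
have := bcoef_le (R := R) N; have b0 := bcoef_gt0 (R := R) N.
rewrite leNgt; move=> H; apply/negP => tb.
have t2 : 0 < t ^+ 2 by rewrite exprn_gt0.
have : t ^+ 2 < bcoef N ^+ 2 by rewrite !expr2; nra.
have : 1 < t ^+ 2 * N%:R by rewrite -ltr_pdivrMl// mulr1.
by nra.
Qed.

Hypothesis d_gt0 : (0 < d)%N.

Definition rhs U x : R := U x * absnabla U x - absnabla (fun y => U y ^+ 2) x.

Definition rhsh h N U x : R := gen h N (fun y => U y ^+ 2) x - U x * gen h N U x.

Lemma rhsh_approx U : smoothT U -> exists2 C, 0 < C &
  forall h N x, 0 < h -> bcoef N <= h ^+ 2 -> `|rhs U x - rhsh h N U x| <= C * h.
Proof.
move=> sU.
have [C1 C10 H1] := gen_absnabla d_gt0 sU.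
have [C2 C20 H2] := gen_absnabla d_gt0 (smoothTX2 sU).
have [K K0 HK] := periodic_bounded (smoothT_continuous sU) (smoothT_periodic sU).
exists (K * C1 + C2); first by rewrite addr_gt0// mulr_gt0.
move=> h N x h0 hN.
have -> : rhs U x - rhsh h N U x = U x * (gen h N U x + absnabla U x) -
  (gen h N (fun y => U y ^+ 2) x + absnabla (fun y => U y ^+ 2) x).
  by rewrite /rhs /rhsh; ring.
apply: le_trans (ler_normB _ _) _; rewrite mulrDl; apply: lerD; last exact: H2.
by rewrite normrM -mulrA ler_pM// H1.
Qed.

Lemma rhshE h N U x : rhsh h N U x = 2 * Num.sqrt d%:R / h *
  \sum_(n < N) acoef n * (walkn h n.+1 (fun y => U y ^+ 2) x - U x * walkn h n.+1 U x).
Proof.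
rewrite /rhsh /gen mulrCA -mulrBr mulr_sumr -sumrB; congr (_ * _).
by apply: eq_bigr => n _; ring.
Qed.

Lemma gen_cper h N f : cper f -> cper (gen h N f).
Proof.
move=> cf; apply: cperZ; apply: cper_sum => n; apply: cperZ.
by apply: cperB => //; exact: walkn_cper.
Qed.

Lemma rhsh_cper h N U : cper U -> cper (rhsh h N U).
Proof.
move=> cU; apply: cperB; last by apply: cperM => //; exact: gen_cper.
apply: gen_cper.
by apply: (cper_comp (phi := fun t => t ^+ 2)) => //; exact: exprn_continuous.
Qed.

Lemma rhsh_form_le0 h N f U : 0 < h -> cper f -> cper U ->
  (forall x y, (U y - U x) * (f x * U y - f y * U x) <= 0) ->
  tint (fun x => f x * rhsh h N U x) <= 0.
Proof.
move=> h0 cf cU H.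
pose c := 2 * Num.sqrt d%:R / h.
have c0 : 0 <= c by rewrite /c divr_ge0 ?mulr_ge0// ltW.
have cU2 : cper (fun x => U x ^+ 2).
  by apply: (cper_comp (phi := fun t => t ^+ 2)) => //; exact: exprn_continuous.
pose G (n : 'I_N) x := f x * (walkn h n.+1 (fun y => U y ^+ 2) x - U x * walkn h n.+1 U x).
have cG n : cper (G n).
  apply: cperM => //; apply: cperB; first exact: walkn_cper.
  by apply: cperM => //; exact: walkn_cper.
rewrite (_ : (fun x => _) = (fun x => c * \sum_(n <- index_enum 'I_N) (acoef n * G n x))); last first.
  apply/funext => x; rewrite rhshE mulrCA; congr (_ * _); rewrite mulr_sumr.
  by apply: eq_bigr => n _; rewrite /G; ring.
rewrite tintZ; last by apply: cper_sum => n; exact: cperZ.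
rewrite tint_sum; last by move=> n; exact: cperZ.
rewrite mulr_ge0_le0// sumr_le0// => n _.
rewrite tintZ//; apply: mulr_ge0_le0; first by rewrite ltW// acoef_gt0.
exact: walkn_form_le0.
Qed.

End generator_form.

Lemma tint_dominated (R : realType) (d : nat) (F : nat -> 'rV[R]_d -> R) (K : R) :
  (forall n, cper (F n)) -> (forall x, F ^~ x @ \oo --> (0 : R)) ->
  (forall n x, `|F n x| <= K) -> (fun n => tint (F n)) @ \oo --> (0 : R).
Proof.
move=> cF F0 FK.
have mF n : measurable_fun setT (fun x => (F n x)%:E).
  by apply/measurable_EFinP; exact: continuous_measurable_rV (cF n).1.
have ae1 : {ae torus_measure d, forall x, [set: 'rV[R]_d] x ->
    (fun n => (F n x)%:E) @ \oo --> 0%E}.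
  by apply: aeW => x _; apply: cvg_EFin; [exact: nearW|exact: F0].
have ae2 : {ae torus_measure d, forall x n, [set: 'rV[R]_d] x ->
    (`|(F n x)%:E| <= K%:E)%E}.
  by apply: aeW => x n _; rewrite lee_fin; exact: FK.
have [_ _] := dominated_convergence measurableT mF (measurable_cst _) ae1
  (cper_integrable (cper_cst d K)) ae2.
by rewrite integral0 => /fine_cvg.
Qed.

(** * The properties of a solution on which the estimates rest *)

Section flow.
Context {R : realType} {d : nat}.
Local Notation V := 'rV[R]_d.
Local Notation e := (@basis_vec R d).
Implicit Types (f g U : V -> R) (x y z : V) (h : R) (u : R -> V -> R).

(** Everything that is used at positive times. The time-Lipschitz bound serves in order 0 for
    energies and amplitude, in order 1 for the continuity of the largest gradient, and in order 2
    for differentiating the gradient in time. *)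
Record flow u : Prop := {
  flow_smooth : forall t : R, 0 < t -> smoothT (u t) ;
  flow_lip : forall t0 T : R, 0 < t0 -> t0 < T -> exists2 K, 0 < K &
    forall (s t : R) (i : seq 'I_d) x, (size i <= 2)%N -> t0 < s < T -> t0 < t < T ->
      `|partials i (u t) x - partials i (u s) x| <= K * `|t - s| ;
  flow_eq : forall (t : R) x, 0 < t -> is_derive t (1 : R) (fun s => u s x) (rhs (u t) x)
}.

Lemma le_tensor_norm k (a : {ffun k.-tuple 'I_d -> R}) j : `|a j| <= tensor_norm a.
Proof.
rewrite /tensor_norm -sqrtr_sqr ler_sqrt; last by apply: sumr_ge0 => i _; exact: sqr_ge0.
by rewrite (bigD1 j)//= lerDl; apply: sumr_ge0 => i _; exact: sqr_ge0.
Qed.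

Lemma regular_solution_flow B (u0 : V -> R) u : @regular_solution R d B u0 u -> flow u.
Proof.
move=> hu; split.
- move=> t t0; apply: SmoothT; first exact: (sol_periodic hu (ltW t0)).
  move=> k; have [a a01 H] := sol_smooth hu k (ltr_pwDr ltr01 (ltW t0)).
  have [|+ _ _] := H (t / 2).
    by apply/andP; split; lra.
  by apply; apply/andP; split; lra.
- move=> t0 T t00 t0T.
  have T0 : 0 < T by exact: lt_trans t0T.
  suff Hk k : exists2 K, 0 < K & forall (s t : R) (i : k.-tuple 'I_d) x,
      t0 < s < T -> t0 < t < T -> `|partials i (u t) x - partials i (u s) x| <= K * `|t - s|.
    have [K0 K00 H0] := Hk 0%N; have [K1 K10 H1] := Hk 1%N; have [K2 K20 H2] := Hk 2%N.
    exists (K0 + K1 + K2); first by rewrite !addr_gt0.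
    move=> s t i x si ht hs.
    have L (K : R) : K <= K0 + K1 + K2 -> K * `|t - s| <= (K0 + K1 + K2) * `|t - s|.
      by move=> ?; rewrite ler_wpM2r.
    case: i si => [|i0 [|i1 [|//]]] _.
    + by apply: le_trans (H0 s t [tuple] x ht hs) (L _ _); lra.
    + by apply: le_trans (H1 s t [tuple i0] x ht hs) (L _ _); lra.
    + by apply: le_trans (H2 s t [tuple i0; i1] x ht hs) (L _ _); lra.
  have [a a01 H] := sol_smooth hu k T0.
  have [|_ _] := H t0; first by apply/andP.
  set b := B _ _ _ _ _ => Hlip.
  exists (`|b| + 1); first by rewrite ltr_wpDl.
  move=> s t i x hs ht.
  have [->|ts] := eqVneq t s; first by rewrite !subrr normr0 mulr0.
  have := Hlip; rewrite /Lip_nablak_norm.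
  set S1 := ereal_sup _; set S2 := ereal_sup _ => HS.
  have S10 : (0 <= S1)%E.
    apply: (@le_trans _ _ (tensor_norm (nablak k (u t) x))%:E); first by rewrite lee_fin sqrtr_ge0.
    by apply: ereal_sup_ubound; exists (t, x).
  have HS2 := le_trans (leeDr S2 S10) HS.
  (* For two points with the same space component the space-time distance in the quotient is |t -
     s|. *)
  have E2 : ((tensor_norm (nablak k (u t) x - nablak k (u s) x) / `|t - s|)%:E <= S2)%E.
    apply: ereal_sup_ubound; exists ((t, x), (s, x)) => /=.
      by split => //; apply/eqP => -[] /eqP; rewrite (negbTE ts).
    by rewrite subrr /enorm /dot big1 ?sqrtr0 ?expr0n ?addr0 ?sqrtr_sqr// => j _; rewrite mxE mul0r.
  have := le_trans E2 HS2; rewrite lee_fin ler_pdivrMr ?normr_gt0 ?subr_eq0// => Hb.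
  have := le_tensor_norm (nablak k (u t) x - nablak k (u s) x) i.
  rewrite !ffunE => /le_trans; apply; apply: (le_trans Hb); rewrite ler_wpM2r//.
  by have := ler_norm b; lra.
- move=> t x t0; have [D _ _ E] := sol_classical hu x t0.
  apply: DeriveDef => //; rewrite -derive1E /rhs; lra.
Qed.

Lemma exists_seq_left (t t0 : R) : t0 < t -> exists sg : nat -> R,
  (forall n, t0 <= sg n < t) /\ sg @ \oo --> t.
Proof.
move=> t0t; exists (fun n => t - (t - t0) * n.+1%:R^-1); split.
  move=> n; have n1 : 1 <= n.+1%:R :> R by rewrite ler1n.
  have n0 : 0 < n.+1%:R^-1 :> R by rewrite invr_gt0; lra.
  have : n.+1%:R^-1 <= 1 :> R by rewrite invf_le1//; lra.
  move: n0; move: (n.+1%:R^-1) => v v0 v1.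
  by apply/andP; split; nra.
rewrite -[X in _ --> X]subr0 -(mulr0 (t - t0)).
apply: cvgB; first exact: cvg_cst.
apply: cvgM; first exact: cvg_cst.
exact: cvg_harmonic.
Qed.

Lemma derive_quotient (phi : R -> R) (t l : R) (sg : nat -> R) : is_derive t 1 phi l ->
  (forall n, sg n < t) -> sg @ \oo --> t ->
  (fun n => (phi t - phi (sg n)) / (t - sg n)) @ \oo --> l.
Proof.
move=> D sgt sgc.
have := @ex_derive _ _ _ _ _ _ _ D; rewrite /derivable => /cvg_ex[l' Hl].
have El : l' = l.
  by rewrite -(@derive_val _ _ _ _ _ _ _ D) /derive; apply/esym/cvg_lim.
rewrite -El.
have Hs : (fun n => sg n - t) @ \oo --> (0 : R)^'.
  have Hs0 : (fun n => sg n - t) @ \oo --> (0 : R).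
    by rewrite -(subrr t); apply: cvgB => //; exact: cvg_cst.
  move=> A A0; have A1 : nbhs (0 : R) [set y | y != 0 -> A y] by [].
  by apply: (@filterS _ \oo _ _ _ _ (Hs0 _ A1)) => n /= H; apply: H; apply/eqP; have := sgt n; lra.
have := cvg_comp _ _ Hs Hl.
apply: cvg_trans; apply: near_eq_cvg; apply: nearW => n /=.
rewrite [_ *: 1]mulr1 subrK /GRing.scale/= -[LHS]mulrNN -invrN !opprB mulrC.
by [].
Qed.

Lemma flow_quotient u (t : R) x (sg : nat -> R) : flow u -> 0 < t ->
  (forall n, sg n < t) -> sg @ \oo --> t ->
  (fun n => (u t x - u (sg n) x) / (t - sg n)) @ \oo --> rhs (u t) x.
Proof. by move=> fu t0; exact: (derive_quotient (flow_eq fu x t0)). Qed.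

End flow.

(** * Monotonicity of convex integral energies *)

Section energy.
Context {R : realType} {d : nat}.
Local Notation V := 'rV[R]_d.
Local Notation e := (@basis_vec R d).
Implicit Types (f g U : V -> R) (x y z : V) (h : R) (u : R -> V -> R).
Hypothesis d_gt0 : (0 < d)%N.

Let ratio_le1 (a : R) : 0 < a -> a / (a + 1) <= 1.
Proof. by move=> a0; rewrite ler_pdivrMr ?ltr_wpDr//; lra. Qed.

(** By convexity, the left difference quotient of the energy is at most the integral of psi (u)
    times the quotient of u. That quotient converges to [rhs], which is within C h of [rhsh], and
    the form with [rhsh] is nonpositive by [rhsh_form_le0]. [dini_le0] then concludes without
    differentiability of the energy. *)
Lemma energy_decreasing u (phi psi : R -> R) (s t : R) : flow u ->
  continuous phi -> continuous psi -> (forall a b, `|psi a - psi b| <= `|a - b|) ->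
  (forall a b, phi a - phi b <= psi a * (a - b)) ->
  0 < s -> s <= t ->
  (forall r, s <= r <= t -> forall x y,
     (u r y - u r x) * (psi (u r x) * u r y - psi (u r y) * u r x) <= 0) ->
  tint (fun x => phi (u t x)) <= tint (fun x => phi (u s x)).
Proof.
move=> fu cphi cpsi lpsi convex s0 st form.
have P0 : 0 < (2 * pi) ^+ d :> R by rewrite exprn_gt0// mulr_gt0// pi_gt0.
have cu r : s / 2 < r -> cper (u r).
  by move=> sr; apply: smoothT_cper; apply: (flow_smooth fu); lra.
have [||K K0 lip0] := flow_lip fu (t0 := s / 2) (T := t + 1).
- by lra.
- by lra.
have lip r r' x : s / 2 < r < t + 1 -> s / 2 < r' < t + 1 ->
    `|u r' x - u r x| <= K * `|r' - r|.
  by move=> rI r'I; exact: (lip0 r r' [::] x).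
pose Phi r := tint (fun x => phi (u r x)).
suff : Phi t - Phi s <= 0 by rewrite /Phi; lra.
apply: (@dini_le0 R (fun r => Phi r - Phi s) s t st); last 2 first.
- by rewrite subrr.
- move=> r sr rt _ eps eps0.
  have r0 : 0 < r by exact: lt_trans sr.
  have [sg [sgI sgc]] := exists_seq_left sr.
  have sgr n : sg n < r by have /andP[] := sgI n.
  have ssg n : s <= sg n by have /andP[] := sgI n.
  have cur : cper (u r) by apply: cu; lra.
  have cus n : cper (u (sg n)) by apply: cu; have := ssg n; lra.
  have cpu : cper (fun x => psi (u r x)) by exact: cper_comp.
  have [Kp Kp0 HKp] := periodic_bounded cpu.1 cpu.2.
  have [C C0 HC] := rhsh_approx d_gt0 (flow_smooth fu r0).
  pose P : R := (2 * pi) ^+ d.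
  (* Makes the discretization error, integrated against |psi (u)| <= Kp, at most eps / 4. *)
  pose h := eps / (4 * (Kp * P * C + 1)).
  have h0 : 0 < h.
    by rewrite divr_gt0// mulr_gt0// ltr_wpDl// ltW// !mulr_gt0.
  have [N HN] := exists_bcoef (exprn_gt0 2 h0).
  pose q n x := (r - sg n)^-1 * (u r x - u (sg n) x).
  have cq n : cper (q n) by apply: cperZ; exact: cperB.
  have qK n x : `|q n x| <= K.
    rewrite /q normrM normfV mulrC ler_pdivrMr ?normr_gt0 ?subr_eq0 ?gt_eqF//.
    by apply: lip; have := ssg n; have := sgr n; move: s0 rt; clear => ? ? ? ?; apply/andP; split; lra.
  have qlim x : q ^~ x @ \oo --> rhs (u r) x.
    have := flow_quotient (x := x) fu r0 sgr sgc.
    by apply: cvg_trans; apply: near_eq_cvg; apply: nearW => n; rewrite /q mulrC.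
  (* The excess of the discrepancy over the admissible error C h. It is continuous in [x], bounded
     and tends to 0 pointwise, so dominated convergence applies without any regularity of [rhs]. *)
  pose E n x := Num.max 0 (`|q n x - rhsh h N (u r) x| - C * h).
  have crh : cper (rhsh h N (u r)) by exact: rhsh_cper.
  have cE n : cper (E n).
    apply: (cper_comp (phi := fun w => Num.max 0 (`|w| - C * h))); last exact: cperB.
    have cn : continuous (fun w : R => `|w| - C * h).
      move=> w; apply: cvgB; last exact: cvg_cst.
      exact: norm_continuous.
    move=> w; apply: (@continuous_max _ _ (fun=> 0) (fun w => `|w| - C * h) w).
      exact: cst_continuous.
    exact: cn.
  have E0 n x : 0 <= E n x by rewrite /E le_max lexx.
  have [Kh Kh0 HKh] := periodic_bounded crh.1 crh.2.
  have EK n x : `|E n x| <= K + Kh.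
    rewrite ger0_norm// /E ge_max addr_ge0 ?ltW//=.
    have := ler_normB (q n x) (rhsh h N (u r) x); have := qK n x; have := HKh x.
    have : 0 < C * h by rewrite mulr_gt0.
    by lra.
  have Elim x : E ^~ x @ \oo --> (0 : R).
    have appr : `|rhs (u r) x - rhsh h N (u r) x| <= C * h by exact: HC.
    have c1 : (fun n => `|q n x - rhsh h N (u r) x|) @ \oo --> `|rhs (u r) x - rhsh h N (u r) x|.
      by apply: cvg_norm; apply: cvgB => //; exact: cvg_cst.
    apply/cvgrPdist_le => w w0; move/cvgrPdist_le : c1 => /(_ _ w0).
    apply: filterS => n /= H; rewrite sub0r normrN ger0_norm//.
    move: H; rewrite ler_norml => /andP[a1 a2].
    by rewrite /E ge_max (ltW w0)/=; move: a1 appr; clear; lra.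
  have tE := tint_dominated cE Elim EK.
  have eps4 : 0 < eps / (4 * (Kp + 1)) by rewrite divr_gt0// mulr_gt0// ltr_wpDl// ltW.
  have [n _ /(_ n (leqnn n))] := cvgr_le _ tE _ eps4.
  rewrite /= => tEn.
  exists (sg n); split => //.
  rewrite opprB addrA subrK.
  have conv : Phi r - Phi (sg n) <= (r - sg n) * tint (fun x => psi (u r x) * q n x).
    rewrite /Phi -tintB; [|exact: cper_comp|exact: cper_comp].
    rewrite -tintZ; last exact: cperM.
    apply: tint_le => [||x].
    - by apply: cperB; exact: cper_comp.
    - by apply: cperZ; exact: cperM.
    - rewrite /q mulrCA mulVKf ?subr_eq0 ?gt_eqF//; exact: convex.
  apply: (le_trans conv); rewrite mulrC; apply: ler_wpM2r.
    by rewrite subr_ge0 ltW.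
  have B1 : tint (fun x => psi (u r x) * rhsh h N (u r) x) <= 0.
    apply: rhsh_form_le0 => //; apply: form; apply/andP; split => //; exact: ltW.
  have B2 : tint (fun x => psi (u r x) * q n x) <=
      tint (fun x => psi (u r x) * rhsh h N (u r) x + (Kp * E n x + Kp * C * h)).
    apply: tint_le => [||x].
    - exact: cperM.
    - by apply: cperD; [exact: cperM|apply: cperD; [exact: cperZ|exact: cper_cst]].
    - rewrite -lerBlDl -mulrBr; apply: le_trans (ler_norm _) _.
      rewrite normrM -mulrA -mulrDr ler_pM//.
      by rewrite -lerBlDr /E le_max lexx orbT.
  apply: (le_trans B2).
  rewrite tintD; [|exact: cperM|by apply: cperD; [exact: cperZ|exact: cper_cst]].
  rewrite tintD; [|exact: cperZ|exact: cper_cst].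
  rewrite tintZ// tint_cst.
  have B3 : Kp * tint (E n) <= eps / 4.
    apply: (@le_trans _ _ (Kp * (eps / (4 * (Kp + 1))))); first by rewrite ler_pM2l.
    have -> : Kp * (eps / (4 * (Kp + 1))) = eps / 4 * (Kp / (Kp + 1)).
      by clear - Kp0; field; lra.
    by apply: ler_piMr; [rewrite divr_ge0// ltW|exact: ratio_le1].
  have B4 : Kp * C * h * (2 * pi) ^+ d <= eps / 4.
    pose Z := Kp * P * C; have Z0 : 0 < Z by rewrite !mulr_gt0.
    have -> : Kp * C * h * (2 * pi) ^+ d = eps / 4 * (Z / (Z + 1)).
      rewrite /h -/P -/Z; have : Z + 1 != 0 by rewrite gt_eqF// ltr_wpDr.
      by rewrite /Z; clear; move=> Z1; field.
    by apply: ler_piMr; [rewrite divr_ge0// ltW|exact: ratio_le1].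
  by move: B1 B3 B4 eps0; rewrite [Kp * C * h]mulrA; clear; lra.
- move=> r /andP[sr rt].
  have r0 : 0 < r by exact: lt_le_trans sr.
  have cur : cper (u r) by apply: cu; lra.
  have cpu : cper (fun x => psi (u r x)) by exact: cper_comp.
  have [Kp Kp0 HKp] := periodic_bounded cpu.1 cpu.2.
  pose del := Num.min (s / 2) 1.
  have del0 : 0 < del by rewrite lt_min divr_gt0 //=.
  apply: (@local_lip_continuous _ _ _ del ((Kp + K) * K * (2 * pi) ^+ d)) => // r'.
  rewrite lt_min => /andP[h1 h2].
  move: (h1); rewrite ltr_norml => /andP[h3 h4].
  move: (h2); rewrite ltr_norml => /andP[h5 h6].
  have cur' : cper (u r') by apply: cu; lra.
  rewrite opprB addrA subrK /Phi -tintB; [|exact: cper_comp|exact: cper_comp].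
  rewrite [leRHS](_ : _ = (Kp + K) * K * `|r' - r| * (2 * pi) ^+ d); last by ring.
  apply: tint_bound => [|x]; first by apply: cperB; exact: cper_comp.
  have L1 : `|u r' x - u r x| <= K * `|r' - r|.
    by apply: lip; apply/andP; split; lra.
  have psi' : `|psi (u r' x)| <= Kp + K.
    have := lpsi (u r' x) (u r x); have := HKp x.
    have := ler_normD (psi (u r' x) - psi (u r x)) (psi (u r x)); rewrite subrK.
    have : K * `|r' - r| <= K by rewrite ler_piMr// ltW.
    by lra.
  rewrite -mulrA; rewrite ler_norml; apply/andP; split.
    rewrite lerNl opprB; apply: le_trans (convex _ _) _; apply: le_trans (ler_norm _) _.
    by rewrite normrM ler_pM.
  apply: le_trans (convex _ _) _; apply: le_trans (ler_norm _) _.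
  rewrite normrM (distrC (u r x)) ler_pM//.
  by have := HKp x; lra.
Qed.

End energy.

(** * Lower and upper bounds, from time 0 on *)

Section bounds.
Context {R : realType} {d : nat}.
Local Notation V := 'rV[R]_d.
Local Notation mu := (torus_measure d : set V -> \bar R).
Implicit Types (f g U : V -> R) (x y z : V) (h : R) (u : R -> V -> R).
Hypothesis d_gt0 : (0 < d)%N.

(** Half the squared excess below or above the level [k]; [lowpsi] and [uppsi] are the derivatives
    in [a]. *)
Definition lowphi (k a : R) : R := Num.max 0 (k - a) ^+ 2 / 2.
Definition lowpsi (k a : R) : R := - Num.max 0 (k - a).
Definition upphi (k a : R) : R := Num.max 0 (a - k) ^+ 2 / 2.
Definition uppsi (k a : R) : R := Num.max 0 (a - k).

Let max0_lip (a b : R) : `|Num.max 0 a - Num.max 0 b| <= `|a - b|.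
Proof.
have := ler_norm (a - b); have := ler_norm (b - a); rewrite (distrC b) => h1 h2.
by case: (leP 0 a) => a0; case: (leP 0 b) => b0; rewrite ler_norml; apply/andP; split; lra.
Qed.

Let cmax0 : continuous (fun a : R => Num.max 0 a).
Proof.
move=> a; apply: (@continuous_max _ _ (fun=> 0) (fun b => b) a).
  exact: cst_continuous.
exact: cvg_id.
Qed.

Let csub1 (k : R) : continuous (fun a => k - a).
Proof. by move=> a; apply: cvgB; [exact: cvg_cst|exact: cvg_id]. Qed.

Let csub2 (k : R) : continuous (fun a => a - k).
Proof. by move=> a; apply: cvgB; [exact: cvg_id|exact: cvg_cst]. Qed.

Let cp1 (k : R) : continuous (fun a => Num.max 0 (k - a)).
Proof.
move=> a; apply: (@continuous_comp _ _ _ (fun a => k - a) (fun b => Num.max 0 b)).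
  exact: csub1.
exact: cmax0.
Qed.

Let cp2 (k : R) : continuous (fun a => Num.max 0 (a - k)).
Proof.
move=> a; apply: (@continuous_comp _ _ _ (fun a => a - k) (fun b => Num.max 0 b)).
  exact: csub2.
exact: cmax0.
Qed.

Let csq : continuous (fun a : R => a ^+ 2 / 2).
Proof. by move=> a; apply: cvgM; [exact: exprn_continuous|exact: cvg_cst]. Qed.

Lemma lowphi_continuous k : continuous (lowphi k).
Proof.
move=> a; apply: (@continuous_comp _ _ _ (fun a => Num.max 0 (k - a)) (fun a => a ^+ 2 / 2)).
  exact: cp1.
exact: csq.
Qed.

Lemma upphi_continuous k : continuous (upphi k).
Proof.
move=> a; apply: (@continuous_comp _ _ _ (fun a => Num.max 0 (a - k)) (fun a => a ^+ 2 / 2)).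
  exact: cp2.
exact: csq.
Qed.

(** The sign of the form is checked by cases on which of the two values lie below [k]. A value above
    [k] is positive because [k] is, so no sign of [u] is assumed, and positivity of the solution can
    be derived from this lemma. *)
Lemma low_energy u (k s t : R) : flow u -> 0 < k -> 0 < s -> s <= t ->
  tint (fun x => lowphi k (u t x)) <= tint (fun x => lowphi k (u s x)).
Proof.
move=> fu k0 s0 st; apply: (@energy_decreasing R d d_gt0 u (lowphi k) (lowpsi k)) => //.
- exact: lowphi_continuous.
- by move=> a; apply: cvgN; exact: cp1.
- move=> a b; rewrite /lowpsi -opprD normrN; apply: le_trans (max0_lip _ _) _.
  by rewrite opprB addrC addrA subrK distrC.
- move=> a b; rewrite /lowphi /lowpsi.
  by case: (leP 0 (k - a)) => ha; case: (leP 0 (k - b)) => hb;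
    rewrite ?expr0n/=; have := sqr_ge0 (a - b); nra.
- move=> r _ x y; rewrite /lowpsi; move: (u r x) (u r y) => a b.
  case: (leP 0 (k - a)) => ha; case: (leP 0 (k - b)) => hb; rewrite ?oppr0 ?mul0r ?mulr0 ?subr0 ?sub0r ?mulr0//.
  + have -> : (b - a) * (- (k - a) * b - - (k - b) * a) = - (k * (b - a) ^+ 2) by ring.
    by rewrite oppr_le0 mulr_ge0 ?sqr_ge0// ltW.
  + have -> : (b - a) * (- (k - a) * b) = - ((b - a) * (k - a) * b) by ring.
    by rewrite oppr_le0 !mulr_ge0//; lra.
  + rewrite mulNr opprK.
    have -> : (b - a) * ((k - b) * a) = - ((a - b) * (k - b) * a) by ring.
    by rewrite oppr_le0 !mulr_ge0//; lra.
Qed.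

(** Here a value below [k] enters with its own sign, so that [0 <= u] is required: the lower bound
    has to be established first. *)
Lemma up_energy u (k s t : R) : flow u -> 0 <= k -> 0 < s -> s <= t ->
  (forall r x, s <= r <= t -> 0 <= u r x) ->
  tint (fun x => upphi k (u t x)) <= tint (fun x => upphi k (u s x)).
Proof.
move=> fu k0 s0 st upos; apply: (@energy_decreasing R d d_gt0 u (upphi k) (uppsi k)) => //.
- exact: upphi_continuous.
- exact: cp2.
- move=> a b; rewrite /uppsi; apply: le_trans (max0_lip _ _) _.
  by rewrite opprB addrA subrK.
- move=> a b; rewrite /upphi /uppsi.
  by case: (leP 0 (a - k)) => ha; case: (leP 0 (b - k)) => hb;
    rewrite ?expr0n/=; have := sqr_ge0 (a - b); nra.
- move=> r rI x y; rewrite /uppsi; have := upos r x rI; have := upos r y rI.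
  move: (u r x) (u r y) => a b b0 a0.
  case: (leP 0 (a - k)) => ha; case: (leP 0 (b - k)) => hb; rewrite ?mul0r ?mulr0 ?subr0 ?sub0r ?mulr0//.
  + have -> : (b - a) * ((a - k) * b - (b - k) * a) = - (k * (b - a) ^+ 2) by ring.
    by rewrite oppr_le0 mulr_ge0 ?sqr_ge0.
  + have -> : (b - a) * ((a - k) * b) = - ((a - b) * (a - k) * b) by ring.
    by rewrite oppr_le0 !mulr_ge0//; lra.
  + have -> : (b - a) * - ((b - k) * a) = - ((b - a) * (b - k) * a) by ring.
    by rewrite oppr_le0 !mulr_ge0//; lra.
Qed.

Let lowphi_ge0 k a : 0 <= lowphi k a.
Proof. by rewrite /lowphi divr_ge0 ?sqr_ge0. Qed.

Let upphi_ge0 k a : 0 <= upphi k a.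
Proof. by rewrite /upphi divr_ge0 ?sqr_ge0. Qed.

Let lowphi_eq0 k a : (lowphi k a = 0) <-> k <= a.
Proof.
rewrite /lowphi; split.
  move=> /eqP; rewrite mulf_eq0 invr_eq0 pnatr_eq0 orbF sqrf_eq0.
  by case: (leP 0 (k - a)) => h; [move=> /eqP ?; lra|lra].
by move=> ka; case: (leP 0 (k - a)) => h; [have -> : k - a = 0 by lra|]; rewrite ?expr0n mul0r.
Qed.

Let upphi_eq0 k a : (upphi k a = 0) <-> a <= k.
Proof.
rewrite /upphi; split.
  move=> /eqP; rewrite mulf_eq0 invr_eq0 pnatr_eq0 orbF sqrf_eq0.
  by case: (leP 0 (a - k)) => h; [move=> /eqP ?; lra|lra].
by move=> ka; case: (leP 0 (a - k)) => h; [have -> : a - k = 0 by lra|]; rewrite ?expr0n mul0r.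
Qed.

Let tint0 (phi : R -> R) f : continuous phi -> cper f -> (forall a, 0 <= phi a) ->
  tint (fun x => phi (f x)) <= 0 -> forall x, phi (f x) = 0.
Proof.
move=> cphi cf p0 le0; have cpf : cper (fun x => phi (f x)) by exact: cper_comp.
apply: (tint_eq0 cpf) => //; apply/eqP; rewrite eq_le le0/=.
rewrite -(mul0r ((2 * pi) ^+ d)) -tint_cst; apply: tint_le => //; exact: cper_cst.
Qed.

Let tint00 (phi : R -> R) f : (forall x, phi (f x) = 0) -> tint (fun x => phi (f x)) = 0.
Proof.
move=> H; rewrite -(mul0r ((2 * pi) ^+ d)) -tint_cst; congr tint.
by apply/funext => x; rewrite H.
Qed.

Lemma flow_cper u t : flow u -> 0 < t -> cper (u t).
Proof. by move=> fu t0; exact/smoothT_cper/(flow_smooth fu). Qed.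

Lemma flow_lower u (k s t : R) : flow u -> 0 < k -> 0 < s -> s <= t ->
  (forall x, k <= u s x) -> forall x, k <= u t x.
Proof.
move=> fu k0 s0 st ks x; apply/lowphi_eq0; move: x.
apply: tint0 => //; first exact: lowphi_continuous.
  by apply: flow_cper => //; exact: lt_le_trans st.
apply: le_trans (low_energy fu k0 s0 st) _.
by rewrite tint00// => x; exact/lowphi_eq0.
Qed.

Lemma flow_upper u (k s t : R) : flow u -> 0 <= k -> 0 < s -> s <= t ->
  (forall r x, s <= r <= t -> 0 <= u r x) ->
  (forall x, u s x <= k) -> forall x, u t x <= k.
Proof.
move=> fu k0 s0 st upos ks x; apply/upphi_eq0; move: x.
apply: tint0 => //; first exact: upphi_continuous.
  by apply: flow_cper => //; exact: lt_le_trans st.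
apply: le_trans (up_energy fu k0 s0 st upos) _.
by rewrite tint00// => x; exact/upphi_eq0.
Qed.

(** Since phi (u s) <= (u s - u0)^2 almost everywhere, the energy at time s is at most the squared
    L^2 distance to the datum, which tends to 0. Monotonicity makes the energy vanish at time t, and
    continuity turns this into a statement at every point. *)
Lemma initial_vanish u (u0 : V -> R) (phi : R -> R) (t : R) : flow u ->
  measurable_fun setT u0 ->
  Lnorm mu 2%:E (fun x => (u t x - u0 x)%:E) @[t --> 0^'+] --> 0%E ->
  continuous phi -> (forall a, 0 <= phi a) ->
  {ae mu, forall x, forall a, phi a <= (a - u0 x) ^+ 2} ->
  (forall s, 0 < s -> s <= t -> tint (fun x => phi (u t x)) <= tint (fun x => phi (u s x))) ->
  0 < t -> forall x, phi (u t x) = 0.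
Proof.
move=> fu mu0 hlim cphi phi0 hae hmono t0.
apply: tint0 => //; first exact: flow_cper.
apply/ler_addgt0Pr => eps eps0; rewrite add0r.
have eta0 : 0 < Num.sqrt eps by rewrite sqrtr_gt0.
move/fine_cvgP : hlim => [near_fin near_cvg].
have near_lt := cvgr_lt _ near_cvg _ eta0.
have [s [s0 st sfin slt]] : exists s, [/\ 0 < s, s < t,
    Lnorm mu 2%:E (fun x => (u s x - u0 x)%:E) \is a fin_num &
    fine (Lnorm mu 2%:E (fun x => (u s x - u0 x)%:E)) < Num.sqrt eps].
  near (0 : R)^'+ => s; exists s; split.
  - by near: s; exact: nbhs_right_gt.
  - by near: s; exact: nbhs_right_lt.
  - by near: s; exact: near_fin.
  - by near: s; exact: near_lt.
apply: (le_trans (hmono s s0 (ltW st))).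
have cus : cper (u s) by exact: flow_cper.
have cphis : cper (fun x => phi (u s x)) by exact: cper_comp.
have two_neq0 : 2 != 0 :> R by rewrite pnatr_eq0.
have := @poweR_Lnorm _ _ R (torus_measure d : {measure set _ -> \bar R})
  (fun x => (u s x - u0 x)%:E) 2 two_neq0.
rewrite -(fineK sfin) poweR_EFin => E.
have mu_s : measurable_fun setT (u s : V -> measurableTypeR R).
  exact: continuous_measurable_rV cus.1.
have Ephi : (tint (fun x => phi (u s x)))%:E = (\int[mu]_x (phi (u s x))%:E)%E.
  rewrite /tint /Rintegral fineK//; apply: integrable_fin_num => //.
  exact: cper_integrable.
have : ((tint (fun x => phi (u s x)))%:E <=
    \int[mu]_x (`|(u s x - u0 x)%:E| `^ 2))%E.
  rewrite Ephi; apply: ae_ge0_le_integral => //.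
  - by move=> x _; rewrite lee_fin.
  - by apply/measurable_EFinP; exact: continuous_measurable_rV cphis.1.
  - by move=> x _; exact: poweR_ge0.
  - rewrite (_ : (fun x => _) = (fun x => ((u s x - u0 x) ^+ 2)%:E)).
      apply/measurable_EFinP; apply: measurable_funX; exact: measurable_funB.
    by apply/funext => x; rewrite abse_EFin poweR_EFin powR_mulrn// real_normK// num_real.
  - apply: filterS hae => x H _.
    rewrite abse_EFin poweR_EFin powR_mulrn// real_normK ?num_real// lee_fin; exact: H.
rewrite -E lee_fin => /le_trans; apply.
have f0 : 0 <= fine (Lnorm mu 2%:E (fun x => (u s x - u0 x)%:E)).
  by rewrite fine_ge0// Lnorm_ge0.
rewrite powR_mulrn// -[leRHS](sqr_sqrtr (ltW eps0)).
by rewrite lerXn2r ?nnegrE// ltW.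
Unshelve. all: by end_near. Qed.

Variables (B : nat -> R -> R -> R -> R -> R) (u0 : V -> R) (u : R -> V -> R).
Hypothesis hu0 : Linfty u0.
Hypothesis hu0_pos : (0 < ess_inf mu (EFin \o u0))%E.
Hypothesis hu : regular_solution B u0 u.

Let fu : flow u := regular_solution_flow hu.

Let muT0 : (0 < mu [set: V])%E.
Proof. by rewrite torus_measureT lte_fin exprn_gt0// mulr_gt0// pi_gt0. Qed.

Lemma ess_inf_fin : ess_inf mu (EFin \o u0) \is a fin_num /\
  ess_sup mu (EFin \o u0) \is a fin_num /\
  (ess_inf mu (EFin \o u0) <= ess_sup mu (EFin \o u0))%E.
Proof.
have le1 : (ess_inf mu (EFin \o u0) <= ess_sup mu (EFin \o u0))%E.
  rewrite leNgt; apply/negP => H.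
  have h1 := @ess_inf_le _ _ _ (torus_measure d : {measure set V -> \bar R}) (EFin \o u0).
  have h2 := @ess_sup_ge _ _ _ (torus_measure d : {measure set V -> \bar R}) (EFin \o u0).
  have : {ae mu, forall x : V, False}.
    by apply: filterS2 h1 h2 => x a1 a2; have := lt_le_trans H (le_trans a1 a2); rewrite ltxx.
  move=> [N [mN N0 HN]].
  have : N = setT by apply/seteqP; split => // x _; apply: HN.
  by move=> NT; move: muT0; rewrite -NT N0 ltxx.
have le2 : (ess_sup mu (EFin \o u0) < +oo)%E.
  case: hu0 => _; rewrite unlock /= ifT; last exact: muT0.
  apply: le_lt_trans; apply: le_ess_sup; apply: nearW => x /=.
  by rewrite lee_fin ler_norm.
split.
  by rewrite fin_numElt (lt_trans _ hu0_pos) ?ltNy0//= (le_lt_trans le1).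
split=> //; rewrite fin_numElt le2 andbT; apply: lt_le_trans le1.
by rewrite (lt_trans _ hu0_pos) ?ltNy0.
Qed.

Let k0 := fine (ess_inf mu (EFin \o u0)).
Let k1 := fine (ess_sup mu (EFin \o u0)).

Lemma ess_inf_gt0 : 0 < k0.
Proof. by rewrite -lte_fin fineK//; have [] := ess_inf_fin. Qed.

Lemma ess_inf_le_flow t x : 0 < t -> k0 <= u t x.
Proof.
move=> t0; apply/lowphi_eq0; move: x.
apply: (initial_vanish fu hu0.1 (sol_init_L2 hu)) => //.
- exact: lowphi_continuous.
- have h1 := @ess_inf_le _ _ _ (torus_measure d : {measure set V -> \bar R}) (EFin \o u0).
  apply: filterS h1 => x; rewrite -(fineK ess_inf_fin.1) lee_fin -/k0 => H a.
  rewrite /lowphi; case: (leP 0 (k0 - a)) => ha; last by rewrite expr0n mul0r sqr_ge0.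
  have : 0 <= (u0 x - k0) * (u0 x - a) by rewrite mulr_ge0//; lra.
  by have := sqr_ge0 (u0 x - a); have := sqr_ge0 (u0 x - k0); nra.
- by move=> s s0 st; exact: (low_energy fu ess_inf_gt0 s0 st).
Qed.

Lemma ess_sup_ge_flow t x : 0 < t -> u t x <= k1.
Proof.
move=> t0; apply/upphi_eq0; move: x.
have [f0 [f1 f01]] := ess_inf_fin.
have k01 : k0 <= k1 by rewrite -lee_fin !fineK.
have k1p : 0 <= k1 by apply: le_trans k01; exact/ltW/ess_inf_gt0.
apply: (initial_vanish fu hu0.1 (sol_init_L2 hu)) => //.
- exact: upphi_continuous.
- have h1 := @ess_sup_ge _ _ _ (torus_measure d : {measure set V -> \bar R}) (EFin \o u0).
  apply: filterS h1 => x; rewrite -(fineK f1) lee_fin -/k1 => H a.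
  rewrite /upphi; case: (leP 0 (a - k1)) => ha; last by rewrite expr0n mul0r sqr_ge0.
  have : 0 <= (k1 - u0 x) * (a - u0 x) by rewrite mulr_ge0//; lra.
  by have := sqr_ge0 (u0 x - a); have := sqr_ge0 (u0 x - k1); nra.
- move=> s s0 st; apply: (up_energy fu k1p s0 st) => r x /andP[sr _].
  by apply: (le_trans (ltW ess_inf_gt0)); apply: ess_inf_le_flow; exact: lt_le_trans s0 sr.
Qed.

End bounds.

(** * Gradients of walk averages of smooth functions *)

Section walk_smooth.
Context {R : realType} {d : nat}.
Local Notation V := 'rV[R]_d.
Local Notation e := (@basis_vec R d).
Implicit Types (f g U : V -> R) (x y z : V) (i : 'I_d) (h r : R).

Lemma smoothT_shift f z : smoothT f -> smoothT (fun x => f (x + z)).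
Proof.
move=> sf; apply: SmoothT; first by move=> x k; rewrite addrAC (smoothT_periodic sf).
apply: (@Ck_coind _ _ (fun g => exists2 f0, smoothT f0 & g = fun x => f0 (x + z))); last by exists f.
move=> _ [f0 sf0 ->]; split.
- by have [] := cper_shift z (smoothT_cper sf0).
- move=> x i; have := smoothT_derivable (x := x + z) (i := i) sf0; rewrite /derivable.
  suff -> : (fun h : R => h^-1 *: (f0 (h *: e i + (x + z)) - f0 (x + z))) =
    (fun h => h^-1 *: (f0 (h *: e i + x + z) - f0 (x + z))) by [].
  by apply/funext => h; rewrite addrA.
- move=> i; exists (pd i f0); first exact: smoothT_pd.
  by apply/funext => x; exact: (derive_translate f0 (e i) x z).
Qed.

Lemma pd_sum i (I : Type) (s : seq I) (F : I -> V -> R) x :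
  (forall j, smoothT (F j)) ->
  pd i (fun y => \sum_(j <- s) F j y) x = \sum_(j <- s) pd i (F j) x.
Proof.
move=> sF; elim: s => [|j s IH].
  rewrite big_nil -[RHS](pd_cst i 0 x); congr (pd i _ x); apply/funext => y.
  by rewrite big_nil.
rewrite big_cons -IH -[pd i (F j) x]mul1r -pd_lin//; last exact: smoothT_sum.
by congr (pd i _ x); apply/funext => y; rewrite big_cons mul1r.
Qed.

Lemma pdZ i (a : R) f x : smoothT f -> pd i (fun y => a * f y) x = a * pd i f x.
Proof.
move=> sf; rewrite -[RHS]addr0 -(pd_cst i 0 x) -pd_lin//; last exact: smoothT_cst.
by congr (pd i _ x); apply/funext => y; rewrite addr0.
Qed.

Lemma pdD i f g x : smoothT f -> smoothT g ->
  pd i (fun y => f y + g y) x = pd i f x + pd i g x.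
Proof.
move=> sf sg; rewrite -[pd i f x]mul1r -pd_lin//.
by congr (pd i _ x); apply/funext => y; rewrite mul1r.
Qed.

Lemma pdB i f g x : smoothT f -> smoothT g ->
  pd i (fun y => f y - g y) x = pd i f x - pd i g x.
Proof.
move=> sf sg; rewrite -[- pd i g x]mulN1r addrC -pd_lin//.
by congr (pd i _ x); apply/funext => y; rewrite mulN1r addrC.
Qed.

Lemma smoothT_walk h f : smoothT f -> smoothT (walk h f).
Proof.
move=> sf; apply: smoothTD; first exact: smoothTZ.
by apply/smoothTZ/smoothT_sum => i; apply: smoothTD; exact: smoothT_shift.
Qed.

Lemma pd_walk h i f : smoothT f -> pd i (walk h f) = walk h (pd i f).
Proof.
move=> sf; apply/funext => x.
have ss z : smoothT (fun x => f (x + z)) by exact: smoothT_shift.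
have s2 j : smoothT (fun x => f (x + h *: e j) + f (x - h *: e j)) by exact: smoothTD.
rewrite /walk pdD; [|exact: smoothTZ|by apply/smoothTZ/smoothT_sum].
rewrite !pdZ//; last exact: smoothT_sum.
rewrite pd_sum//; congr (_ + _ * _); apply: eq_bigr => j _.
rewrite (pdD i x (ss (h *: e j)) (ss (- (h *: e j)))).
by rewrite /pd !derive_translate.
Qed.

Lemma smoothT_walkn h n f : smoothT f -> smoothT (walkn h n f).
Proof. by move=> sf; elim: n => [//|n IH]; rewrite walknS; exact: smoothT_walk. Qed.

Lemma pd_walkn h n i f : smoothT f -> pd i (walkn h n f) = walkn h n (pd i f).
Proof.
move=> sf; elim: n => [//|n IH].
by rewrite !walknS pd_walk ?IH//; exact: smoothT_walkn.
Qed.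

Lemma smoothT_gen h N f : smoothT f -> smoothT (gen h N f).
Proof.
move=> sf; apply/smoothTZ/smoothT_sum => n; apply/smoothTZ/smoothTB => //.
exact: smoothT_walkn.
Qed.

Lemma pd_gen h N i f : smoothT f -> pd i (gen h N f) = gen h N (pd i f).
Proof.
move=> sf; apply/funext => x.
have sw n : smoothT (walkn h n f) by exact: smoothT_walkn.
have s1 (n : 'I_N) : smoothT (fun x => acoef n * (walkn h n.+1 f x - f x)).
  by apply: smoothTZ; exact: smoothTB.
rewrite /gen pdZ; last exact: smoothT_sum.
rewrite pd_sum//; congr (_ * _); apply: eq_bigr => n _.
by rewrite pdZ ?pdB ?pd_walkn//; exact: smoothTB.
Qed.

Lemma smoothT_taylor U : smoothT U -> exists2 C, 0 < C &
  forall h i x, 0 < h -> `|U (x + h *: e i) - U x - h * pd i U x| <= C * h ^+ 2.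
Proof.
move=> sU.
have H i : exists2 K, 0 < K & forall x, `|pd i (pd i U) x| <= K.
  have s2 : smoothT (pd i (pd i U)) by do 2 apply: smoothT_pd.
  exact: periodic_bounded (smoothT_continuous s2) (smoothT_periodic s2).
pose Kf i := projT1 (cid2 (H i)).
have Kf0 i : 0 < Kf i by rewrite /Kf; case: cid2.
have KfP i x : `|pd i (pd i U) x| <= Kf i by rewrite /Kf; case: cid2.
have S0 : 0 <= \sum_i Kf i by apply: sumr_ge0 => i _; exact: ltW.
exists (1 + \sum_i Kf i) => [|h i x h0]; first by rewrite ltr_pwDl.
have [||c /andP[c0 ch]] := @line_mean_value R d U i x 0 h; [|exact: ltW|].
  by move=> y; exact: smoothT_derivable.
rewrite scale0r addr0 subr0 => ->.
have [||c' _] := @line_mean_value R d (pd i U) i x 0 c; [|exact: c0|].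
  by move=> y; apply: smoothT_derivable; exact: smoothT_pd.
rewrite scale0r addr0 subr0 [h * _]mulrC -mulrBl => ->.
rewrite !normrM (ger0_norm c0) (gtr0_norm h0) expr2 mulrA ler_pM2r//.
apply: ler_pM => //; apply: (le_trans (KfP _ _)).
by rewrite (bigD1 i)//= addrCA lerDl addr_ge0// sumr_ge0// => j _; exact: ltW.
Qed.

Hypothesis d_gt0 : (0 < d)%N.

(** [sqgrad_walkn_le] bounds the increments of the averaged function by its oscillation; a Taylor
    expansion, averaged by the walk, replaces increments by derivatives. This is the smoothing rate
    A / (h sqrt n) with an explicit constant. *)
Lemma grad_walkn_le U : smoothT U -> exists2 C, 0 < C &
  forall h n x (a A : R), 0 < h -> (forall y, a <= U y <= a + A) ->
  \sum_i walkn h n (pd i U) x ^+ 2 <= 16 * d%:R * A ^+ 2 / (h ^+ 2 * n.+1%:R) + C * h ^+ 2.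
Proof.
move=> sU; have [C C0 HC] := smoothT_taylor sU.
have d0 : 0 < d%:R :> R by rewrite ltr0n.
exists (2 * d%:R * C ^+ 2) => [|h n x a A h0 Ua]; first by rewrite !mulr_gt0// exprn_gt0.
have n0 : 0 < n.+1%:R :> R by rewrite ltr0n.
(* Subtracting [a] makes the squares at most [A ^+ 2], so that the bound sees the oscillation of [U]
   and not its size. *)
pose w := walkn h n (fun y => U y - a).
have W : n.+1%:R / (8 * d%:R) * sqgrad h w x <= A ^+ 2.
  apply: le_trans (sqgrad_walkn_le d_gt0 _ _ _ _) _; apply: walkn_le => // y.
  have /andP[h1 h2] := Ua y.
  by rewrite lerXn2r ?nnegrE; lra.
have {W}W : sqgrad h w x <= 8 * d%:R * A ^+ 2 / n.+1%:R.
  rewrite ler_pdivlMr// mulrC.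
  have -> : n.+1%:R * sqgrad h w x = 8 * d%:R * (n.+1%:R / (8 * d%:R) * sqgrad h w x).
    by field; rewrite gt_eqF.
  by rewrite ler_pM2l// mulr_gt0.
have T i : walkn h n (pd i U) x ^+ 2 <=
    2 / h ^+ 2 * ((w (x + h *: e i) - w x) ^+ 2 + (w (x - h *: e i) - w x) ^+ 2) + 2 * C ^+ 2 * h ^+ 2.
  have E : `|w (x + h *: e i) - w x - h * walkn h n (pd i U) x| <= C * h ^+ 2.
    have -> : w (x + h *: e i) - w x - h * walkn h n (pd i U) x =
        walkn h n (fun y => U (y + h *: e i) - U y - h * pd i U y) x.
      rewrite !walknB walknZ walkn_shift /w !walknB !(walkn_cst d_gt0); ring.
    by apply: normr_walkn_le => // y; exact: HC.
  move: E; set p := w _ - _; set q := walkn _ _ _ x => E.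
  have E2 : (p - h * q) ^+ 2 <= (C * h ^+ 2) ^+ 2.
    by rewrite -[leLHS]real_normK ?num_real// lerXn2r ?nnegrE ?mulr_ge0 ?sqr_ge0// ltW.
  rewrite -(ler_pM2l (exprn_gt0 2 h0)) mulrDr.
  have -> : h ^+ 2 * (2 / h ^+ 2 * (p ^+ 2 + (w (x - h *: e i) - w x) ^+ 2)) =
      2 * p ^+ 2 + 2 * (w (x - h *: e i) - w x) ^+ 2 by field; rewrite gt_eqF.
  have := sqr_ge0 (2 * p - h * q); have := sqr_ge0 (w (x - h *: e i) - w x); nra.
apply: (le_trans (ler_sum _ (fun i _ => T i))).
rewrite big_split/= -mulr_sumr -/(sqgrad h w x) sumr_const card_ord -[_ *+ d]mulr_natl.
apply: lerD; last by rewrite le_eqVlt; apply/orP; left; apply/eqP; ring.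
have -> : 16 * d%:R * A ^+ 2 / (h ^+ 2 * n.+1%:R) = 2 / h ^+ 2 * (8 * d%:R * A ^+ 2 / n.+1%:R).
  by field; rewrite !gt_eqF// pnatr_eq0.
by apply: (ler_wpM2l _ W); rewrite divr_ge0// ltW// exprn_gt0.
Qed.

End walk_smooth.

(** * Limit of vanishing mesh and the mass carried by long walks *)

Section tail.
Context {R : realType}.

(** How the mesh is sent to 0: an estimate with error C h for all small h holds without the
    error. *)
Lemma le_small (X Y C h0 : R) : 0 < h0 ->
  (forall h, 0 < h -> h <= h0 -> X <= Y + C * h) -> X <= Y.
Proof.
move=> h00 H; apply/ler_addgt0Pr => eps eps0.
pose h := Num.min h0 (eps / (1 + `|C|)).
have C0 := normr_ge0 C.
have C1 : 0 < 1 + `|C| by lra.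
have h_gt0 : 0 < h by rewrite lt_min h00 divr_gt0.
have hle : h <= eps / (1 + `|C|) by rewrite ge_min lexx orbT.
apply: (le_trans (H h h_gt0 _)); first by rewrite ge_min lexx.
rewrite lerD2l; apply: (@le_trans _ _ (`|C| * h)); first by rewrite ler_pM2r// ler_norm.
by move: hle; rewrite ler_pdivlMr//; nra.
Qed.

Lemma bcoef_anti m n : (m <= n)%N -> bcoef n <= bcoef m :> R.
Proof.
move=> mn; rewrite -subr_ge0 -(sum_acoef mn); apply: sumr_ge0 => i _.
exact/ltW/acoef_gt0.
Qed.

(* [N1] is the first time at which the walk of step [h] has travelled a distance [rho]. *)
Lemma tail_mass (rho h : R) N : 0 < rho -> 0 < h -> h <= rho -> 6 * rho * h <= 1 ->
  bcoef N <= h ^+ 2 -> exists N1, [/\ (N1 <= N)%N, rho ^+ 2 <= N1%:R * h ^+ 2,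
    N1%:R * h ^+ 2 <= 2 * rho ^+ 2 &
    (6 * rho)^-1 <= (bcoef N1 - bcoef N) / h].
Proof.
move=> r0 h0 hr hr1 bN.
have h2 : 0 < h ^+ 2 by rewrite exprn_gt0.
have r20 : 0 <= rho ^+ 2 / h ^+ 2 by rewrite divr_ge0// ltW// exprn_gt0.
pose N1 := (Num.truncn (rho ^+ 2 / h ^+ 2)).+1.
have /andP[t1 t2] := truncn_itv r20; rewrite -/N1 in t2.
have R1 : rho ^+ 2 <= N1%:R * h ^+ 2 by rewrite -ler_pdivrMr// ltW.
have R2 : N1%:R * h ^+ 2 <= 2 * rho ^+ 2.
  have hh : h ^+ 2 <= rho ^+ 2 by rewrite lerXn2r ?nnegrE// ltW.
  by rewrite /N1 -addn1 natrD mulrDl mul1r; move: t1; rewrite ler_pdivlMr//; lra.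
have b1 := bcoef_gt0 (R := R) N1.
(* From [bcoef_ge] and (4 N1 + 1) h^2 <= 9 rho^2, the latter because h <= rho. The cut at [N] then
   removes at most half of this mass, by 6 rho h <= 1. *)
have B1 : (3 * rho)^-1 <= bcoef N1 / h.
  have e1 : 0 <= (3 * rho)^-1 by rewrite invr_ge0; lra.
  have e2 : 0 <= bcoef N1 / h by rewrite divr_ge0 ?ltW.
  rewrite -(@ler_pXn2r _ 2)// ?nnegrE// expr_div_n exprVn.
  rewrite -div1r ler_pdivrMr ?exprn_gt0 ?mulr_gt0// mulrAC ler_pdivlMr// mul1r.
  have := bcoef_ge (R := R) N1; nra.
have B2 : bcoef N / h <= (6 * rho)^-1.
  rewrite ler_pdivrMr//; apply: (le_trans bN).
  rewrite [leRHS]mulrC ler_pdivlMr ?mulr_gt0//; nra.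
have key : (6 * rho)^-1 <= (bcoef N1 - bcoef N) / h.
  have E : (3 * rho)^-1 = (6 * rho)^-1 + (6 * rho)^-1 by field; rewrite gt_eqF.
  by rewrite mulrBl; lra.
(* If [N] were smaller than [N1], monotonicity of [bcoef] would make the mass nonpositive. *)
exists N1; split=> //; rewrite leqNgt; apply/negP => /ltnW /bcoef_anti H.
have : 0 < (bcoef N1 - bcoef N) / h by apply: lt_le_trans key; rewrite invr_gt0 mulr_gt0.
by rewrite pmulr_lgt0 ?invr_gt0//; lra.
Qed.

(** Terms before [N1] are dropped, and the weights of the others telescope to
    [bcoef N1 - bcoef N]. *)
Lemma tail_sum_ge (rho h w : R) N N1 (f : nat -> R) : 0 < h -> 0 <= w ->
  (N1 <= N)%N -> (6 * rho)^-1 <= (bcoef N1 - bcoef N) / h ->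
  (forall n, 0 <= f n) -> (forall n, (N1 <= n)%N -> w <= f n) ->
  w / (6 * rho) <= h^-1 * \sum_(n < N) acoef n * f n.
Proof.
move=> h0 w0 NN key f0 fw.
rewrite -(big_mkord xpredT (fun n => acoef n * f n)) (big_cat_nat (n := N1))//=.
apply: (@le_trans _ _ (h^-1 * \sum_(N1 <= n < N) acoef n * w)).
  rewrite -mulr_suml sum_acoef// [w / _]mulrC.
  have -> : h^-1 * ((bcoef N1 - bcoef N) * w) = (bcoef N1 - bcoef N) / h * w by ring.
  exact: ler_wpM2r.
rewrite ler_pM2l ?invr_gt0//.
rewrite -[leLHS]add0r; apply: lerD.
  by apply: sumr_ge0 => n _; rewrite mulr_ge0// ltW// acoef_gt0.
apply: ler_sum_nat => n /andP[n1 _].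
by rewrite ler_pM2l ?acoef_gt0// fw.
Qed.

End tail.

(** * Comparison in time for maxima over the torus *)

Section touching.
Context {R : realType}.

(** Applied to a maximum over [x], with [phi] built from the values at the point where the maximum
    is attained at time [t]: at earlier times the maximum is at least the value there, which is the
    required inequality from the left. *)
Lemma touching_le0 (g : R -> R) (a b : R) : a <= b ->
  (forall t, a <= t <= b -> {for t, continuous g}) -> g a <= 0 ->
  (forall t, a < t -> t <= b -> 0 < g t -> exists (phi : R -> R) (l : R),
     [/\ is_derive t (1 : R) phi l, l <= 0 &
         forall s, a <= s -> s < t -> g t - g s <= phi t - phi s]) ->
  g b <= 0.
Proof.
move=> ab cg ga H; apply: (dini_le0 ab cg ga) => t at_ tb gt0 eps eps0.
have [phi [l [D l0 Hphi]]] := H t at_ tb gt0.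
have [sg [sgt sgc]] := exists_seq_left at_.
have sglt n : sg n < t by have /andP[] := sgt n.
have := cvgr_lt _ (derive_quotient D sglt sgc) eps (le_lt_trans l0 eps0).
move=> [n _ /(_ n (leqnn n)) /=]; rewrite ltr_pdivrMr ?subr_gt0// => Hn.
have /andP[h1 h2] := sgt n.
by exists (sg n); split=> //; apply: (le_trans (Hphi _ h1 h2)); exact: ltW.
Qed.

End touching.

HB.lock Definition pmax (R : realType) (d : nat) (f : 'rV[R]_d -> R) : R := sup (range f).

Section periodic_maximum.
Context {R : realType} {d : nat}.
Implicit Types f g : 'rV[R]_d -> R.

Lemma pmaxP f : cper f ->
  exists x, [/\ torus_cell x, f x = pmax f & forall y, f y <= pmax f].
Proof.
move=> [cf pf]; have [x [cx Hx]] := periodic_max cf pf.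
have ub : has_ubound (range f) by exists (f x) => _ [y _ <-].
have le y : f y <= pmax f by rewrite unlock; apply: ub_le_sup => //; exists y.
exists x; split => //; apply/eqP; rewrite eq_le le /= unlock.
by apply: ge_sup => [|_ [y _ <-] //]; exists (f x), x.
Qed.

Lemma pmax_lip f g (e : R) : cper f -> cper g -> (forall x, `|f x - g x| <= e) ->
  `|pmax f - pmax g| <= e.
Proof.
move=> cf cg fg; have [x [_ fx fmax]] := pmaxP cf; have [y [_ gy gmax]] := pmaxP cg.
rewrite -fx -gy in fmax gmax *.
have := gmax x; have := fmax y; have := fg x; have := fg y.
rewrite !ler_norml => /andP[h1 h2] /andP[h3 h4] h5 h6.
by apply/andP; split; lra.
Qed.

End periodic_maximum.

(** * Exponential decay of the amplitude *)

Section amplitude.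
Context {R : realType} {d : nat}.
Local Notation V := 'rV[R]_d.
Local Notation e := (@basis_vec R d).
Implicit Types (f g U : V -> R) (x y z : V) (i : 'I_d) (h r : R) (u : R -> V -> R).
Hypothesis d_gt0 : (0 < d)%N.

Lemma line_variation f i x r (L : R) : smoothT f -> (forall y, `|pd i f y| <= L) ->
  `|f (x + r *: e i) - f x| <= L * `|r|.
Proof.
move=> sf fL; have df y : derivable f y (e i) by exact: smoothT_derivable.
have [r0|r0] := leP 0 r.
  have [c _] := line_mean_value x df r0; rewrite scale0r addr0 subr0 => ->.
  by rewrite normrM ler_wpM2r.
have [c _] := line_mean_value x df (ltW r0); rewrite scale0r addr0 sub0r distrC => ->.
by rewrite normrM normrN ler_wpM2r.
Qed.

Lemma path_variation f (s : seq 'I_d) (r : 'I_d -> R) x (L P : R) : smoothT f ->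
  (forall i y, `|pd i f y| <= L) -> (forall i, `|r i| <= P) ->
  `|f (x + \sum_(i <- s) r i *: e i) - f x| <= (size s)%:R * (L * P).
Proof.
move=> sf fL rP; elim: s x => [|i s IH] x.
  by rewrite big_nil addr0 subrr normr0 mul0r.
rewrite big_cons addrA; apply: (le_trans (ler_distD (f (x + r i *: e i)) _ _)); rewrite -natr1 mulrDl mul1r lerD//.
apply: (le_trans (line_variation _ _ sf (fL i))).
by rewrite ler_wpM2l// (le_trans _ (fL i x)).
Qed.

(** The segment is replaced by a path along the d coordinate directions, each leg of length at most
    2 pi; hence the requirement that both points lie in the cell. *)
Lemma cell_variation f x y (L : R) : smoothT f -> (forall i z, `|pd i f z| <= L) ->
  torus_cell x -> torus_cell y -> f x - f y <= d%:R * (L * (2 * pi)).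
Proof.
move=> sf fL cx cy; apply: (le_trans (ler_norm _)).
have := @path_variation f (enum 'I_d) (fun i => (x - y) ord0 i) y L (2 * pi) sf fL.
rewrite size_enum_ord big_enum/= -row_sum_delta [y + _]addrC subrK.
apply=> i; rewrite !mxE ler_norml.
have /andP[h1 h2] := cx i; have /andP[h3 h4] := cy i.
by apply/andP; split; lra.
Qed.

(** After a time of order h^(-2) the walk has smoothed [U] so much that its averages at the two
    extremal points differ by at most half the amplitude; the weights of these times total at least
    h / (6 rho), which makes [kappa] independent of [U]. *)
Lemma amplitude_rate : exists2 kappa : R, 0 < kappa &
  forall U (m : R) x1 x2, smoothT U -> 0 < m -> (forall y, m <= U y) ->
    torus_cell x1 -> torus_cell x2 -> (forall y, U y <= U x1) ->
    (forall y, U x2 <= U y) -> U x2 < U x1 ->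
    rhs U x1 - rhs U x2 <= - (kappa * m * (U x1 - U x2)).
Proof.
have d0 : 0 < d%:R :> R by rewrite ltr0n.
have d1 : 1 <= d%:R :> R by rewrite ler1n.
have p0 : 0 < pi :> R := pi_gt0 R.
pose K : R := 2 * Num.sqrt d%:R.
have K0 : 0 < K by rewrite mulr_gt0// sqrtr_gt0.
(* Chosen so that 16 d A^2 / rho^2 <= a^2 for the slope [a] below, using d >= 1. *)
pose rho : R := 32 * pi * d%:R ^+ 2.
have r0 : 0 < rho by rewrite !mulr_gt0// exprn_gt0.
exists (K / (12 * rho)) => [|U m x1 x2 sU m0 mU cx1 cx2 Umax Umin U12].
  by rewrite divr_gt0// mulr_gt0.
set A := U x1 - U x2; have A0 : 0 < A by rewrite subr_gt0.
have [C1 C10 H1] := rhsh_approx d_gt0 sU.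
have [C2 C20 H2] := grad_walkn_le d_gt0 sU.
(* Partial derivatives bounded by 2 a give a variation of at most d (2 a) (2 pi) = A / 2 over the
   cell. *)
pose a : R := A / (8 * pi * d%:R).
have a0 : 0 < a by rewrite divr_gt0// !mulr_gt0.
have aE : A = a * (8 * pi * d%:R) by rewrite /a divfK// gt_eqF// !mulr_gt0.
pose h0 : R := Num.min rho (Num.min (6 * rho)^-1 (a / (1 + C2))).
have h00 : 0 < h0 by rewrite !lt_min r0 invr_gt0 mulr_gt0//= divr_gt0//; lra.
apply: (@le_small _ _ _ (2 * C1) h0 h00) => h hp hh.
move: hh; rewrite !le_min => /and3P[hr hr6 ha].
have hr1 : 6 * rho * h <= 1 by move: hr6; rewrite -div1r ler_pdivlMr ?mulr_gt0// mulrC.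
have {}ha : h * (1 + C2) <= a by move: ha; rewrite ler_pdivlMr//; lra.
have [N bN] := exists_bcoef (exprn_gt0 2 hp).
have [N1 [N1N N1a N1b key]] := tail_mass r0 hp hr hr1 bN.
have := H1 h N x1 hp bN; have := H1 h N x2 hp bN.
rewrite !ler_norml => /andP[e1 e2] /andP[e3 e4].
suff : rhsh h N U x1 - rhsh h N U x2 <= - (K / (12 * rho) * m * A) by lra.
pose w n x := walkn h n.+1 U x.
pose f n := A - (w n x1 - w n x2).
have wmax n y : w n y <= U x1 by exact: walkn_le.
have wmin n y : U x2 <= w n y by exact: walkn_ge.
have f0 n : 0 <= f n by have := wmax n x1; have := wmin n x2; rewrite /f /A; lra.
have fN n : (N1 <= n)%N -> A / 2 <= f n.
  move=> nN; suff : w n x1 - w n x2 <= A / 2 by rewrite /f; lra.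
  have grad i y : `|pd i (walkn h n.+1 U) y| <= 2 * a.
    have a20 : 0 <= 2 * a by lra.
    rewrite pd_walkn// -(@ler_pXn2r _ 2)// real_normK ?num_real//.
    have B := H2 h n.+1 y (U x2) A hp.
    have {}B : \sum_i walkn h n.+1 (pd i U) y ^+ 2 <=
        16 * d%:R * A ^+ 2 / (h ^+ 2 * n.+2%:R) + C2 * h ^+ 2.
      by apply: B => z; rewrite Umin /A addrCA subrr addr0 Umax.
    have {B} : walkn h n.+1 (pd i U) y ^+ 2 <=
        16 * d%:R * A ^+ 2 / (h ^+ 2 * n.+2%:R) + C2 * h ^+ 2.
      apply: le_trans B; rewrite (bigD1 i)//= lerDl; apply: sumr_ge0 => j _.
      exact: sqr_ge0.
    move=> /le_trans; apply.
    have t1 : C2 * h ^+ 2 <= a ^+ 2.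
      apply: (@le_trans _ _ ((h * (1 + C2)) ^+ 2)).
        by rewrite exprMn mulrC ler_wpM2l ?sqr_ge0//; nra.
      by apply: lerXn2r => //; rewrite nnegrE; [apply: mulr_ge0; lra|exact: ltW].
    have n2 : rho ^+ 2 <= h ^+ 2 * n.+2%:R.
      apply: (le_trans N1a); rewrite mulrC ler_wpM2l ?sqr_ge0// ler_nat.
      by apply: (leq_trans nN); rewrite ltnW.
    have t2 : 16 * d%:R * A ^+ 2 / (h ^+ 2 * n.+2%:R) <= a ^+ 2.
      rewrite ler_pdivrMr; last by apply: lt_le_trans n2; rewrite exprn_gt0.
      apply: (@le_trans _ _ (a ^+ 2 * rho ^+ 2)); last by rewrite ler_wpM2l ?sqr_ge0.
      pose q : R := (32 * a * pi * d%:R) ^+ 2 * d%:R.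
      have q0 : 0 <= q by apply: mulr_ge0; [exact: sqr_ge0|exact: ltW].
      have -> : 16 * d%:R * A ^+ 2 = q by rewrite aE /q; ring.
      have -> : a ^+ 2 * rho ^+ 2 = q * d%:R by rewrite /rho /q; ring.
      by rewrite ler_peMr.
    apply: (le_trans (lerD t2 t1)).
    have -> : (2 * a) ^+ 2 = a ^+ 2 + a ^+ 2 + (a ^+ 2 + a ^+ 2) by ring.
    by rewrite lerDl addr_ge0 ?sqr_ge0.
  have := cell_variation (smoothT_walkn h n.+1 sU) grad cx1 cx2.
  move=> /le_trans; apply.
  by rewrite aE le_eqVlt; apply/orP; left; apply/eqP; field.
have T := tail_sum_ge hp (ltW (divr_gt0 A0 (ltr0Sn _ 1))) N1N key f0 fN.
rewrite !rhshE -mulrBr -sumrB -/K.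
apply: (@le_trans _ _ (K / h * \sum_(n < N) - m * (acoef n * f n))).
  rewrite ler_pM2l ?divr_gt0//; apply: ler_sum => n _.
  have -> : - m * (acoef n * f n) = acoef n * (- m * f n) by ring.
  rewrite -mulrBr ler_pM2l ?acoef_gt0//.
  (* Pointwise, U y (U y - U x1) <= m (U y - U x1), since U y >= m and the other factor is
     nonpositive at a maximum point; at the minimum point the inequality reverses. *)
  have b1 : walkn h n.+1 (fun y => U y ^+ 2) x1 - U x1 * walkn h n.+1 U x1 <=
      m * (w n x1 - U x1).
    rewrite -walknZ -walknB mulrBr -(walkn_cst d_gt0 h n.+1 (m * U x1) x1) -walknZ -walknB.
    by apply: ler_walkn => y; have := mU y; have := Umax y; nra.
  have b2 : m * (w n x2 - U x2) <=
      walkn h n.+1 (fun y => U y ^+ 2) x2 - U x2 * walkn h n.+1 U x2.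
    rewrite -walknZ -walknB mulrBr -(walkn_cst d_gt0 h n.+1 (m * U x2) x2) -walknZ -walknB.
    by apply: ler_walkn => y; have := mU y; have := Umin y; nra.
  by rewrite /f /A; move: b1 b2; rewrite /w; nra.
rewrite -mulr_sumr.
have -> : K / h * (- m * \sum_(i < N) acoef i * f i) =
    - (m * K * (h^-1 * \sum_(i < N) acoef i * f i)) by ring.
rewrite lerN2.
have -> : K / (12 * rho) * m * A = m * K * (A / 2 / (6 * rho)) by field; rewrite gt_eqF.
by rewrite ler_pM2l// mulr_gt0.
Qed.

End amplitude.

Section amplitude_decay.
Context {R : realType} {d : nat}.
Local Notation V := 'rV[R]_d.
Local Notation e := (@basis_vec R d).
Implicit Types (f g U : V -> R) (x y z : V) (i : 'I_d) (u : R -> V -> R).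
Hypothesis d_gt0 : (0 < d)%N.

Lemma pmax_continuous (F : R -> V -> R) (t del K : R) : 0 < del ->
  (forall s, `|s - t| < del -> cper (F s)) ->
  (forall s x, `|s - t| < del -> `|F t x - F s x| <= K * `|s - t|) ->
  {for t, continuous (fun s => pmax (F s))}.
Proof.
move=> del0 cF HF; apply: (@local_lip_continuous _ _ _ del K) => // s st.
apply: pmax_lip; [|exact: cF|by move=> x; exact: HF].
by apply: cF; rewrite subrr normr0.
Qed.

Lemma flow_lip_near u (t : R) : flow u -> 0 < t -> exists2 del : R, 0 < del & exists2 K, 0 < K &
  forall s (l : seq 'I_d) x, (size l <= 2)%N -> `|s - t| < del ->
  0 < s /\ `|partials l (u t) x - partials l (u s) x| <= K * `|s - t|.
Proof.
move=> fu t0; exists (t / 2); first by rewrite divr_gt0.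
have [||K K0 HK] := flow_lip fu (t0 := t / 2) (T := 2 * t); [lra|lra|].
exists K => // s l x l2; rewrite ltr_norml => /andP[h1 h2]; split; first lra.
by rewrite [leRHS](_ : _ = K * `|t - s|) ?[`|s - t|]distrC//; apply: HK => //; apply/andP; split; lra.
Qed.

Lemma is_derive_expR_lin (a c t : R) :
  is_derive t (1 : R) (fun s => c * expR (a * s)) (a * (c * expR (a * t))).
Proof.
have D := @is_derive1_comp R (@expR R) (fun s => a * s) t (expR (a * t)) a
  (is_derive_expR _) (derf_eq (derfZ a (derf_id t)) (mulr1 a)).
by apply: (derf_eq (derfZ c D)); rewrite /GRing.scale/=; ring.
Qed.

Lemma continuous_expR_lin (a c : R) : continuous (fun s => c * expR (a * s)).
Proof.
move=> t; apply: differentiable_continuous; apply/derivable1_diffP.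
exact: (@ex_derive _ _ _ _ _ _ _ (is_derive_expR_lin a c t)).
Qed.

Lemma amplitude_decay u (m T0 : R) : flow u -> 0 < m -> 0 < T0 ->
  (forall t x, T0 <= t -> m <= u t x) ->
  exists C gamma : R, [/\ 0 < C, 0 < gamma &
    forall t x y, T0 <= t -> u t x - u t y <= C * expR (- gamma * t)].
Proof.
move=> fu m0 T00 mu_.
have [kappa k0 Hk] := @amplitude_rate R d d_gt0.
pose gamma := kappa * m; have g0 : 0 < gamma by rewrite mulr_gt0.
pose A t := pmax (u t) + pmax (fun x => - u t x).
(* The barrier lies above the amplitude at time [T0] and stays positive even when the amplitude
   vanishes. *)
pose C := (`|A T0| + 1) * expR (gamma * T0).
have C0 : 0 < C by rewrite mulr_gt0 ?expR_gt0// ltr_wpDl.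
have cu t : 0 < t -> cper (u t) by move=> t0; exact: flow_cper.
have cNu t : 0 < t -> cper (fun x => - u t x) by move=> t0; apply: cperN; exact: cu.
have main t : T0 <= t -> A t - C * expR (- gamma * t) <= 0.
  move=> T0t.
  apply: (@touching_le0 R (fun s => A s - C * expR (- gamma * s)) T0 t T0t).
  - move=> s /andP[s0 _]; have sp : 0 < s by exact: lt_le_trans s0.
    have [del del0 [K K0 HK]] := flow_lip_near fu sp.
    apply: (@continuousB _ _ _ A (fun s => C * expR (- gamma * s))); last exact: continuous_expR_lin.
    apply: (@continuousD _ _ _ (fun s => pmax (u s)) (fun s => pmax (fun x => - u s x))).
      apply: (@pmax_continuous _ _ del K) => // r; first by move=> rs; apply: cu; have [] := HK r [::] 0 isT rs.
      by move=> x rs; have [] := HK r [::] x isT rs.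
    apply: (@pmax_continuous _ _ del K) => // r; first by move=> rs; apply: cNu; have [] := HK r [::] 0 isT rs.
    by move=> x rs; rewrite opprK addrC distrC; have [] := HK r [::] x isT rs.
  - rewrite /C -mulrA -expRD mulNr subrr expR0 mulr1.
    by have := ler_norm (A T0); lra.
  - move=> s T0s st gs; have sp : 0 < s by exact: lt_trans T0s.
    have [x1 [cx1 E1 H1]] := pmaxP (cu s sp).
    have [x2 [cx2 E2 H2]] := pmaxP (cNu s sp).
    have EA : A s = u s x1 - u s x2 by rewrite /A -E1 -E2.
    have Ap : u s x2 < u s x1.
      have : 0 < C * expR (- gamma * s) by rewrite mulr_gt0 ?expR_gt0.
      by move: gs; rewrite EA; lra.
    (* Both extremal points are frozen at time [s]. Above the barrier the decay gamma A of the
       amplitude is faster than that of the barrier. *)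
    exists (fun r => u r x1 - u r x2 - C * expR (- gamma * r)).
    eexists; split.
    + exact: (derfB (derfB (flow_eq fu x1 sp) (flow_eq fu x2 sp)) (is_derive_expR_lin _ _ _)).
    + have := Hk (u s) m x1 x2 (flow_smooth fu sp) m0 (fun y => mu_ s y (ltW T0s)) cx1 cx2.
      rewrite E1 => /(_ H1) H; have {}H := H (fun y => _).
      have {}H : rhs (u s) x1 - rhs (u s) x2 <= - (gamma * (u s x1 - u s x2)).
        rewrite E1; apply: H; last by rewrite -E1.
        by move=> y; have := H2 y; rewrite -E2; lra.
      move: gs; rewrite EA mulNr; nra.
    + move=> r T0r rs; have rp : 0 < r by exact: lt_le_trans T0r.
      have [_ [_ _ h1]] := pmaxP (cu r rp); have [_ [_ _ h2]] := pmaxP (cNu r rp).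
      by rewrite EA /A; have := h1 x1; have := h2 x2; lra.
exists C, gamma; split=> // t x y T0t; have tp : 0 < t by exact: lt_le_trans T0t.
have [_ [_ _ h1]] := pmaxP (cu t tp); have [_ [_ _ h2]] := pmaxP (cNu t tp).
by have := main t T0t; have := h1 x; have := h2 y; rewrite /A; lra.
Qed.

End amplitude_decay.

(** * Control of walk increments by the deviation of the gradient *)

Section gradient_estimates.
Context {R : realType} {d : nat}.
Local Notation V := 'rV[R]_d.
Local Notation e := (@basis_vec R d).
Implicit Types (f g U : V -> R) (x y z : V) (i j : 'I_d) (h r : R).

Lemma sum_bcoef N : \sum_(m < N) bcoef m = 2 * N%:R * bcoef N :> R.
Proof.
elim: N => [|N IH]; first by rewrite big_ord0 mulr0 mul0r.
rewrite big_ord_recr/= IH bcoefS -natr1.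
have N0 : 0 <= N%:R :> R by [].
by field; lra.
Qed.

(** Abel summation, as [acoef] is minus the increment of [bcoef]. It trades the displacement
    accumulated after n steps for one-step increments, which have a local bound. *)
Lemma sum_acoef_abel (S : nat -> R) N : S 0%N = 0 ->
  \sum_(n < N) acoef n * S n.+1 = \sum_(m < N) bcoef m * (S m.+1 - S m) - bcoef N * S N.
Proof.
move=> S0; elim: N => [|N IH]; first by rewrite !big_ord0 S0 mulr0 subr0.
by rewrite !big_ord_recr/= IH acoefE; ring.
Qed.

(** Expresses second differences through increments of the first derivative. Subtracting from the
    derivative its value at a fixed point changes nothing, which is how [dev] enters. *)
Lemma smoothT_second_diff U : smoothT U -> exists2 C, 0 < C &
  forall h i y, 0 < h ->
  `|U (y + h *: e i) + U (y - h *: e i) - 2 * U y - h * (pd i U (y + h *: e i) - pd i U y)|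
  <= C * h ^+ 3.
Proof.
move=> sU.
have s1 i : smoothT (pd i U) by exact: smoothT_pd.
have s2 i : smoothT (pd i (pd i U)) by exact: smoothT_pd.
have s3 i : smoothT (pd i (pd i (pd i U))) by exact: smoothT_pd.
have H i : exists2 K, 0 < K & forall x, `|pd i (pd i (pd i U)) x| <= K.
  exact: periodic_bounded (smoothT_continuous (s3 i)) (smoothT_periodic (s3 i)).
pose Kf i := projT1 (cid2 (H i)).
have Kf0 i : 0 < Kf i by rewrite /Kf; case: cid2.
have KfP i x : `|pd i (pd i (pd i U)) x| <= Kf i by rewrite /Kf; case: cid2.
have S0 : 0 <= \sum_i Kf i by apply: sumr_ge0 => i _; exact: ltW.
exists (2 * (1 + \sum_i Kf i)) => [|h i y h0]; first by rewrite mulr_gt0// ltr_pwDl.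
have Kle : Kf i <= 1 + \sum_i Kf i.
  by rewrite (bigD1 i)//= addrCA lerDl addr_ge0// sumr_ge0// => j _; exact: ltW.
(* The second difference at [y] is the increment of [W] from y to y + h e_i. Mean values turn it and
   the increment of the derivative into multiples of second derivatives at points at most 2 h
   apart. *)
pose W z := U z - U (z - h *: e i).
have sS : smoothT (fun z => U (z - h *: e i)) by exact: smoothT_shift.
have sW : smoothT W by exact: smoothTB.
have dS f : smoothT f -> forall z, derivable f z (e i).
  by move=> sf z; exact: smoothT_derivable.
have [c /andP[c0 ch]] := line_mean_value y (dS _ sW) (ltW h0).
have [c' /andP[c'0 c'h]] := line_mean_value (y + c *: e i - h *: e i) (dS _ (s1 i)) (ltW h0).
have [c'' /andP[c''0 c''h]] := line_mean_value y (dS _ (s1 i)) (ltW h0).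
rewrite !scale0r !addr0 !subr0 subrK => E3 E2.
rewrite /W pdB//; have -> : pd i (fun z => U (z - h *: e i)) (y + c *: e i) =
    pd i U (y + c *: e i - h *: e i) by exact: (derive_translate U (e i)).
rewrite E2 addrK => E1.
have -> : U (y + h *: e i) + U (y - h *: e i) - 2 * U y - h * (pd i U (y + h *: e i) - pd i U y)
  = h ^+ 2 * (pd i (pd i U) (y + (c - h + c') *: e i) - pd i (pd i U) (y + c'' *: e i)).
  have -> : y + (c - h + c') *: e i = y + c *: e i - h *: e i + c' *: e i.
    by rewrite !scalerDl scaleNr !addrA.
  rewrite E3.
  have -> : U (y + h *: e i) + U (y - h *: e i) - 2 * U y = 
      U (y + h *: e i) - U y - (U y - U (y - h *: e i)) by ring.
  rewrite E1; move: (pd i (pd i U) _) (pd i (pd i U) _) => p q; ring.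
have := line_variation (y + c'' *: e i) (c - h + c' - c'') (s2 i) (KfP i).
rewrite -addrA -scalerDl [c'' + _]addrC subrK => B.
have h2 : 0 <= h ^+ 2 by exact: sqr_ge0.
rewrite normrM (ger0_norm h2).
have -> : 2 * (1 + \sum_i Kf i) * h ^+ 3 = h ^+ 2 * ((1 + \sum_i Kf i) * (2 * h)) by ring.
apply: ler_wpM2l => //; apply: (le_trans B).
apply: ler_pM => //; first exact: ltW.
by clear - c0 ch c'0 c'h c''0 c''h h0; rewrite ler_norml; apply/andP; split; lra.
Qed.

Hypothesis d_gt0 : (0 < d)%N.

(** The function F y of the overview; [gen h N (dev U x) x] is the discrete D. *)
Definition dev U x y : R := \sum_i (pd i U y - pd i U x) ^+ 2.

Lemma walkn_dev h n U x z :
  walkn h n (dev U x) z = \sum_i walkn h n (fun y => (pd i U y - pd i U x) ^+ 2) z.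
Proof. exact: walkn_sum. Qed.

Lemma walkn_dev_ge0 h n U x z : 0 <= walkn h n (dev U x) z.
Proof. by apply: walkn_ge => // y; apply: sumr_ge0 => i _; exact: sqr_ge0. Qed.

Lemma gen_dev h N U x : gen h N (dev U x) x =
  2 * Num.sqrt d%:R / h * \sum_(n < N) acoef n * walkn h n.+1 (dev U x) x.
Proof.
rewrite /gen; congr (_ * _); apply: eq_bigr => n _.
by rewrite [dev U x x]big1 ?subr0// => i _; rewrite subrr expr0n.
Qed.

(** One step changes the average by (h / (4 d)) times a sum of increments [g i] of averaged
    derivatives, up to O(h^3). [sqgrad_walkn_le] bounds each (n + 1) (g i)^2 by the average of the
    squared deviation, and Young's inequality with parameter [theta] gives the linear bound. *)
Lemma walk_increment_le U : smoothT U -> exists2 C, 0 < C &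
  forall h n x (theta : R), 0 < h -> 0 < theta ->
  bcoef n * `|walkn h n.+1 U x - walkn h n U x| <=
  theta * (acoef n * walkn h n.+1 (dev U x) x) + bcoef n * (h ^+ 2 / (4 * theta) + C * h ^+ 3).
Proof.
move=> sU; have [C C0 HC] := smoothT_second_diff sU.
have d0 : 0 < d%:R :> R by rewrite ltr0n.
exists (C / 4) => [|h n x theta h0 th0]; first by rewrite divr_gt0.
pose w i := walkn h n (fun y => pd i U y - pd i U x).
pose g i := w i (x + h *: e i) - w i x.
have n0 : 0 < n.+1%:R :> R by rewrite ltr0n.
have E : `|walkn h n.+1 U x - walkn h n U x| <=
    (4 * d%:R)^-1 * \sum_i (h * `|g i| + C * h ^+ 3).
  have -> : walkn h n.+1 U x - walkn h n U x = (4 * d%:R)^-1 *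
      \sum_i walkn h n (fun y => U (y + h *: e i) + U (y - h *: e i) - 2 * U y) x.
    rewrite -walkn_sum -walknZ walknSr -walknB; congr walkn; apply/funext => y.
    rewrite /walk sumrB sumr_const card_ord -[_ *+ d]mulr_natl.
    by field; rewrite gt_eqF.
  rewrite normrM gtr0_norm ?invr_gt0 ?mulr_gt0//.
  apply: ler_wpM2l; first by rewrite invr_ge0 mulr_ge0.
  apply: (le_trans (ler_norm_sum _ _ _)); apply: ler_sum => i _.
  have -> : walkn h n (fun y => U (y + h *: e i) + U (y - h *: e i) - 2 * U y) x =
      walkn h n (fun y => U (y + h *: e i) + U (y - h *: e i) - 2 * U y
         - h * (pd i U (y + h *: e i) - pd i U y)) x + h * g i.
    have -> : h * g i = walkn h n (fun y => h * (pd i U (y + h *: e i) - pd i U y)) x.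
      by rewrite walknZ walknB walkn_shift /g /w !walknB !(walkn_cst d_gt0) opprB addrA subrK.
    by rewrite -walkn_add; congr walkn; apply/funext => y; rewrite subrK.
  rewrite addrC; apply: (le_trans (ler_normD _ _)); rewrite normrM (gtr0_norm h0) lerD2l.
  by apply: normr_walkn_le => // y; exact: HC.
pose W i := walkn h n.+1 (fun y => (pd i U y - pd i U x) ^+ 2) x.
have gF i : n.+1%:R / (8 * d%:R) * g i ^+ 2 <= W i.
  apply: le_trans (sqgrad_walkn_le d_gt0 h n _ x).
  by apply: ler_wpM2l; [rewrite divr_ge0 ?mulr_ge0// ltW|exact: sqgrad_ge].
(* Turns the weight from Abel summation into the weight of the generator; the factor n + 1 is the
   one gained in [sqgrad_walkn_le]. *)
have Eb : bcoef n = 2 * n.+1%:R * acoef n :> R.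
  by rewrite /acoef -natr1; field; have : 0 <= n%:R :> R by []; lra.
have a0 := acoef_gt0 (R := R) n.
apply: (le_trans (ler_wpM2l (ltW (bcoef_gt0 n)) E)).
have DW : walkn h n.+1 (dev U x) x = \sum_i W i by exact: walkn_dev.
move: W gF DW => W gF ->; rewrite Eb -subr_ge0.
have -> : theta * (acoef n * \sum_i W i) +
   2 * n.+1%:R * acoef n * (h ^+ 2 / (4 * theta) + C / 4 * h ^+ 3) -
   2 * n.+1%:R * acoef n * ((4 * d%:R)^-1 * \sum_i (h * `|g i| + C * h ^+ 3)) =
   acoef n * \sum_i (theta * W i +
     n.+1%:R * h ^+ 2 / (2 * theta * d%:R) - n.+1%:R * h * `|g i| / (2 * d%:R)).
  have sumc (c : R) : \sum_(i < d) c = d%:R * c by rewrite sumr_const card_ord mulr_natl.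
  rewrite sumrB !big_split/= !sumc -mulr_suml -!mulr_sumr.
  move: (\sum_i W i) (\sum_i `|g i|) => S1 S2.
  by field; rewrite !gt_eqF.
apply: mulr_ge0; first exact: ltW.
apply: sumr_ge0 => i _.
have := ler_wpM2l (ltW th0) (gF i); rewrite -[g i ^+ 2]real_normK ?num_real//.
set q := `|g i| => B; rewrite subr_ge0; apply: le_trans (lerD B (lexx _)); rewrite -subr_ge0.
(* Young's inequality in the form of a complete square. *)
have -> : theta * (n.+1%:R / (8 * d%:R) * q ^+ 2) + n.+1%:R * h ^+ 2 / (2 * theta * d%:R) -
   n.+1%:R * h * q / (2 * d%:R) = n.+1%:R / (8 * d%:R * theta) * (theta * q - 2 * h) ^+ 2.
  by field; rewrite !gt_eqF.
by rewrite mulr_ge0 ?sqr_ge0// divr_ge0 ?mulr_ge0// ltW.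
Qed.

End gradient_estimates.

Arguments walkn : simpl never.

Section gradient_rate.
Context {R : realType} {d : nat}.
Local Notation V := 'rV[R]_d.
Local Notation e := (@basis_vec R d).
Implicit Types (f g U : V -> R) (x y z : V) (i j : 'I_d) (h r : R).
Hypothesis d_gt0 : (0 < d)%N.
Local Notation K := (2 * Num.sqrt d%:R : R).

Let K0 : 0 < K.
Proof. by rewrite mulr_gt0// sqrtr_gt0 ltr0n. Qed.

(** The sum is split at the time [N1] of distance [rho]. Before it, Abel summation and
    [walk_increment_le] give the first two terms; the boundary term and the later times are bounded
    by the oscillation, which gives the third. *)
Lemma gen_near_far U : smoothT U -> exists2 C, 0 < C &
  forall h N x (rho theta a A : R), 0 < rho -> 0 < h -> h <= rho -> 6 * rho * h <= 1 ->
  bcoef N <= h ^+ 2 -> 0 < theta -> (forall y, a <= U y <= a + A) ->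
  `|gen h N U x| <= theta * gen h N (dev U x) x + K * rho / (2 * theta) + 2 * K * A / rho + C * rho * h.
Proof.
move=> sU; have [C C0 HC] := walk_increment_le d_gt0 sU.
exists (2 * K * C) => [|h N x rho theta a A r0 h0 hr hr1 bN th0 Ua]; first by rewrite mulr_gt0// mulr_gt0.
have [N1 [N1N N1a N1b key]] := tail_mass r0 h0 hr hr1 bN.
pose S n := walkn h n U x - U x; pose F n := walkn h n.+1 (dev U x) x.
have SA n : `|S n| <= A.
  have h1 : walkn h n U x <= a + A by apply: walkn_le => // y; have /andP[] := Ua y.
  have h2 : a <= walkn h n U x by apply: walkn_ge => // y; have /andP[] := Ua y.
  by have /andP[h3 h4] := Ua x; rewrite /S ler_norml; apply/andP; split; lra.
have A0 : 0 <= A by apply: le_trans (SA 0%N).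
set b := bcoef N1 : R; have b0 : 0 < b by exact: bcoef_gt0.
have aF n : 0 <= acoef n * F n by apply: mulr_ge0; [exact/ltW/acoef_gt0|exact: walkn_dev_ge0].
have near_part : `|\sum_(n < N1) acoef n * S n.+1| <=
    theta * \sum_(n < N) acoef n * F n + 2 * N1%:R * b * (h ^+ 2 / (4 * theta) + C * h ^+ 3) + b * A.
  rewrite sum_acoef_abel; last by rewrite /S subrr.
  apply: (le_trans (ler_normB _ _)); apply: lerD; last first.
    by rewrite normrM (gtr0_norm b0); apply: ler_wpM2l; [exact: ltW|exact: SA].
  apply: (le_trans (ler_norm_sum _ _ _)).
  apply: (@le_trans _ _ (\sum_(n < N1) (theta * (acoef n * F n) + bcoef n * (h ^+ 2 / (4 * theta) + C * h ^+ 3)))).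
    apply: ler_sum => n _; rewrite normrM (gtr0_norm (bcoef_gt0 _)).
    have -> : S n.+1 - S n = walkn h n.+1 U x - walkn h n U x by rewrite /S; ring.
    exact: HC.
  rewrite big_split/= -mulr_sumr -mulr_suml sum_bcoef lerD2r ler_pM2l//.
  rewrite -(big_mkord xpredT (fun n => acoef n * F n)) -(big_mkord xpredT (fun n => acoef n * F n)).
  by rewrite (big_cat_nat (n := N1) (p := N))//= lerDl; apply: sumr_ge0.
have far_part : `|\sum_(N1 <= n < N) acoef n * S n.+1| <= b * A.
  apply: (le_trans (ler_norm_sum _ _ _)).
  apply: (@le_trans _ _ (\sum_(N1 <= n < N) acoef n * A)).
    by apply: ler_sum => n _; rewrite normrM (gtr0_norm (acoef_gt0 _)); apply: ler_wpM2l; [exact/ltW/acoef_gt0|exact: SA].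
  rewrite -mulr_suml sum_acoef//; apply: ler_wpM2r => //.
  by rewrite lerBlDr lerDl; exact/ltW/bcoef_gt0.
have tot : `|\sum_(n < N) acoef n * S n.+1| <=
    theta * \sum_(n < N) acoef n * F n + 2 * N1%:R * b * (h ^+ 2 / (4 * theta) + C * h ^+ 3) + 2 * (b * A).
  rewrite -(big_mkord xpredT (fun n => acoef n * S n.+1)) (big_cat_nat (n := N1))//= big_mkord.
  by apply: (le_trans (ler_normD _ _)); move: near_part far_part; lra.
have B := bcoef_le (R := R) N1; rewrite -/b in B.
have n0 : 0 <= N1%:R :> R by [].
(* [bcoef_le] gives b^2 N1 <= 1/2, while N1 h^2 <= 2 rho^2 by the choice of [N1]. The bound on b / h
   below uses rho^2 <= N1 h^2 instead. *)
have bn : N1%:R * b * h <= rho.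
  have p0 : 0 <= N1%:R * b * h by rewrite !mulr_ge0// ltW.
  rewrite -(@ler_pXn2r _ 2)// ?nnegrE//; last exact: ltW.
  have -> : (N1%:R * b * h) ^+ 2 = (b ^+ 2 * N1%:R) * (N1%:R * h ^+ 2) by ring.
  have -> : rho ^+ 2 = 2^-1 * (2 * rho ^+ 2) by field.
  apply: ler_pM => //; first by rewrite mulr_ge0 ?sqr_ge0.
    by rewrite mulr_ge0 ?sqr_ge0.
  by have := sqr_ge0 b; lra.
have bh : b / h <= rho^-1.
  have p0 : 0 <= b / h by rewrite divr_ge0// ltW.
  rewrite -(@ler_pXn2r _ 2)// ?nnegrE ?invr_ge0//; last exact: ltW.
  rewrite expr_div_n exprVn ler_pdivrMr ?exprn_gt0// mulrC ler_pdivlMr ?exprn_gt0//.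
  have := ler_wpM2l (sqr_ge0 b) N1a; have := sqr_ge0 b; have := sqr_ge0 h; nra.
rewrite gen_dev /gen normrM gtr0_norm ?divr_gt0//.
apply: (le_trans (ler_wpM2l (ltW (divr_gt0 K0 h0)) tot)).
have -> : K / h * (theta * (\sum_(n < N) acoef n * F n) +
     2 * N1%:R * b * (h ^+ 2 / (4 * theta) + C * h ^+ 3) + 2 * (b * A)) =
   theta * (K / h * \sum_(n < N) acoef n * F n) + K / (2 * theta) * (N1%:R * b * h)
   + 2 * K * A * (b / h) + 2 * K * C * h * (N1%:R * b * h).
  by field; rewrite !gt_eqF.
have -> : 2 * K * C * rho * h = 2 * K * C * h * rho by ring.
apply: lerD; last by apply: ler_wpM2l => //; rewrite !mulr_ge0// ?sqrtr_ge0// ltW.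
apply: lerD; last by apply: ler_wpM2l => //; rewrite !mulr_ge0// ?sqrtr_ge0// ltW.
rewrite lerD2l [K * rho / _]mulrAC; apply: ler_wpM2l => //.
by apply: divr_ge0; [exact: ltW|apply: mulr_ge0 => //; exact: ltW].
Qed.

(** A function of oscillation A cannot keep its slope over a distance large compared with A over
    that slope: past [N1] the squared averaged gradient is at most G / 4 + G / 8. By Jensen and (p -
    q)^2 >= q^2 / 2 - p^2, the average of [dev] is then at least G / 8. *)
Lemma gen_dev_ge U : smoothT U -> exists2 C, 0 < C &
  forall h N x (rho a A : R), 0 < rho -> 0 < h -> h <= rho -> 6 * rho * h <= 1 ->
  bcoef N <= h ^+ 2 -> (forall y, a <= U y <= a + A) ->
  64 * d%:R * A ^+ 2 <= rho ^+ 2 * \sum_i pd i U x ^+ 2 ->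
  C * h ^+ 2 <= (\sum_i pd i U x ^+ 2) / 8 ->
  K * (\sum_i pd i U x ^+ 2) / (48 * rho) <= gen h N (dev U x) x.
Proof.
move=> sU; have [C C0 HC] := grad_walkn_le d_gt0 sU.
exists C => // h N x rho a A r0 h0 hr hr1 bN Ua; set G := \sum_i _ => Ar Ch.
have G0 : 0 <= G by apply: sumr_ge0 => i _; exact: sqr_ge0.
have [N1 [N1N N1a N1b key]] := tail_mass r0 h0 hr hr1 bN.
pose F n := walkn h n.+1 (dev U x) x.
have F0 n : 0 <= F n by exact: walkn_dev_ge0.
have FN n : (N1 <= n)%N -> G / 8 <= F n.
  move=> nN; have H1 := HC h n.+1 x a A h0 Ua.
  have n2 : rho ^+ 2 <= h ^+ 2 * n.+2%:R.
    apply: (le_trans N1a); rewrite mulrC ler_wpM2l ?sqr_ge0// ler_nat.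
    by apply: (leq_trans nN); rewrite ltnW.
  have hn : 0 < h ^+ 2 * n.+2%:R by rewrite mulr_gt0// exprn_gt0.
  have t : 16 * d%:R * A ^+ 2 / (h ^+ 2 * n.+2%:R) <= G / 4.
    rewrite ler_pdivrMr//; have := ler_wpM2r G0 n2; lra.
  have H2 : \sum_i (walkn h n.+1 (pd i U) x - pd i U x) ^+ 2 <= F n.
    rewrite /F walkn_dev; apply: ler_sum => i _; apply: le_trans (walkn_sqr d_gt0 _ _ _ _).
    by rewrite walknB walkn_cst.
  have H3 : G / 2 - \sum_i walkn h n.+1 (pd i U) x ^+ 2 <=
      \sum_i (walkn h n.+1 (pd i U) x - pd i U x) ^+ 2.
    rewrite /G mulr_suml -sumrB; apply: ler_sum => i _.
    move: (walkn h n.+1 (pd i U) x) (pd i U x) => p q.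
    by have := sqr_ge0 (2 * p - q); nra.
  apply: le_trans H2; apply: le_trans H3; rewrite lerBrDr.
  apply: (le_trans (lerD (lexx _) H1)); apply: (le_trans (lerD (lexx _) (lerD t Ch))).
  by clear; rewrite /=; lra.
have G8 : 0 <= G / 8 by rewrite divr_ge0.
have T := tail_sum_ge h0 G8 N1N key F0 FN.
rewrite gen_dev; have := ler_wpM2l (ltW K0) T; rewrite [K * (h^-1 * _)]mulrA.
by apply: le_trans; rewrite le_eqVlt; apply/orP; left; apply/eqP; field; rewrite gt_eqF.
Qed.

Lemma pd_rhsh h N U j x : smoothT U -> pd j (rhsh h N U) x =
  gen h N (fun y => 2 * (U y * pd j U y)) x
  - (pd j U x * gen h N U x + U x * gen h N (pd j U) x).
Proof.
move=> sU; have sg f : smoothT f -> smoothT (gen h N f) by exact: smoothT_gen.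
rewrite /rhsh pdB; [|exact/sg/smoothTX2|by apply: smoothTM => //; exact: sg].
rewrite pdM//; last exact: sg.
rewrite !pd_gen//; last exact: smoothTX2.
congr (_ - _); congr gen; apply/funext => y.
have -> : (fun y => U y ^+ 2) = (fun y => U y * U y) by apply/funext => z; rewrite expr2.
by rewrite pdM//; ring.
Qed.

(** With S the scalar product of the gradients at [x] and [y], maximality at [x] gives S <= G - F /
    2, where F is [dev U x y]. The integrand (2 U y - U x) S - G U y is then at most G (U y - U x) -
    (m / 4) F, because 2 A <= m makes 2 U y - U x at least m / 2. *)
Lemma grad_form_le h N U x (m A : R) : 0 < h -> smoothT U ->
  (forall y, m <= U y <= m + A) -> 2 * A <= m ->
  (forall y, \sum_i pd i U y ^+ 2 <= \sum_i pd i U x ^+ 2) ->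
  \sum_j pd j U x * pd j (rhsh h N U) x <=
  (\sum_i pd i U x ^+ 2) * gen h N U x - m / 4 * gen h N (dev U x) x.
Proof.
move=> h0 sU Um Am Vmax; set G := \sum_i pd i U x ^+ 2.
pose c j := pd j U x.
rewrite gen_dev; under eq_bigr => j _ do rewrite pd_rhsh//.
pose P j y := c j * (2 * (U y * pd j U y) - (c j * U y + U x * pd j U y)).
have E : \sum_j c j * (gen h N (fun y => 2 * (U y * pd j U y)) x -
    (c j * gen h N U x + U x * gen h N (pd j U) x)) =
    K / h * \sum_(n < N) acoef n * walkn h n.+1 (fun y => \sum_j P j y) x.
  rewrite [RHS](_ : _ = K / h * \sum_(n < N) \sum_j acoef n * walkn h n.+1 (P j) x); last first.
    by congr (_ * _); apply: eq_bigr => n _; rewrite walkn_sum mulr_sumr.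
  rewrite exchange_big mulr_sumr; apply: eq_bigr => j _.
  rewrite /gen [c j * (K / h * _)]mulrCA [U x * (K / h * _)]mulrCA -mulrDr -mulrBr mulrCA.
  congr (_ * _); rewrite !mulr_sumr -big_split/= -sumrB mulr_sumr; apply: eq_bigr => n _.
  have -> : walkn h n.+1 (P j) x = c j * (walkn h n.+1 (fun y => 2 * (U y * pd j U y)) x -
      (c j * walkn h n.+1 U x + U x * walkn h n.+1 (pd j U) x)).
    by rewrite /P [LHS]walknZ walknB walkn_add !walknZ.
  rewrite /c; ring.
rewrite E {E}.
have -> : G * gen h N U x - m / 4 * (K / h * \sum_(n < N) acoef n * walkn h n.+1 (dev U x) x) =
   K / h * \sum_(n < N) acoef n * walkn h n.+1 (fun y => G * (U y - U x) - m / 4 * dev U x y) x.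
  rewrite /gen !(mulrCA _ (K / h)) -mulrBr; congr (_ * _).
  rewrite !mulr_sumr -sumrB; apply: eq_bigr => n _.
  by rewrite walknB !walknZ walknB (walkn_cst d_gt0); ring.
rewrite ler_pM2l ?divr_gt0//; apply: ler_sum => n _.
rewrite ler_pM2l ?acoef_gt0//; apply: ler_walkn => y.
have Vy := Vmax y; rewrite -/G in Vy.
pose S := \sum_j c j * pd j U y.
have -> : \sum_j P j y = (2 * U y - U x) * S - G * U y.
  rewrite /S /G mulr_sumr mulr_suml -sumrB; apply: eq_bigr => j _.
  by rewrite /P /c; ring.
have D : dev U x y = \sum_i pd i U y ^+ 2 - 2 * S + G.
  rewrite /dev /S /G mulr_sumr -sumrB -big_split; apply: eq_bigr => j _.
  by rewrite /c /=; ring.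
have D0 : 0 <= dev U x y by apply: sumr_ge0 => i _; exact: sqr_ge0.
have /andP[y1 y2] := Um y; have /andP[x1 x2] := Um x.
have k0 : m / 2 <= 2 * U y - U x by lra.
have m0 : 0 <= m by lra.
move: D Vy; set F := dev U x y in D0 *; set Vv := \sum_i _; set k := _ - U x in k0 *.
move=> D Vy; have S1 : S <= G - F / 2 by lra.
have k1 : 0 <= k by lra.
have := ler_wpM2l k1 S1; have := ler_wpM2r D0 k0; rewrite /k; lra.
Qed.

End gradient_rate.

(** * The evolution inequality for the largest gradient *)

Section gradient_equation.
Context {R : realType} {d : nat}.
Local Notation V := 'rV[R]_d.
Local Notation e := (@basis_vec R d).
Implicit Types (f g U : V -> R) (x y z : V) (i j : 'I_d) (h r : R) (u : R -> V -> R).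
Hypothesis d_gt0 : (0 < d)%N.

Lemma common_bound (P : 'I_d -> R -> Prop) :
  (forall i a b, a <= b -> P i a -> P i b) ->
  (forall i, exists2 K, 0 < K & P i K) -> exists2 K, 0 < K & forall i, P i K.
Proof.
move=> mono H; pose k i := projT1 (cid2 (H i)).
have k0 i : 0 < k i by rewrite /k; case: cid2.
have kP i : P i (k i) by rewrite /k; case: cid2.
have S0 : 0 <= \sum_i k i by apply: sumr_ge0 => i _; exact: ltW.
exists (1 + \sum_i k i) => [|i]; first by rewrite ltr_pwDl.
apply: mono (kP i); rewrite (bigD1 i)//= addrCA lerDl addr_ge0// sumr_ge0// => j _.
exact: ltW.
Qed.

Lemma gradient_rate_approx U x (m A g : R) : smoothT U -> 0 < A ->
  (forall y, m <= U y <= m + A) -> 1600 * d%:R * A <= m ->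
  (forall y, \sum_i pd i U y ^+ 2 <= \sum_i pd i U x ^+ 2) ->
  0 < g -> g ^+ 2 = \sum_i pd i U x ^+ 2 ->
  exists2 h0, 0 < h0 & exists2 C, 0 < C & forall h N, 0 < h -> h <= h0 -> bcoef N <= h ^+ 2 ->
    \sum_j pd j U x * pd j (rhsh h N U) x <= - (m * g ^+ 3 / (8 * 192 * A)) + C * h.
Proof.
move=> sU A0 Um Am Vmax g0 gE.
have d1 : 1 <= d%:R :> R by rewrite ler1n.
have d0 : 0 < d%:R :> R by rewrite ltr0n.
pose q : R := Num.sqrt d%:R; have q0 : 0 < q by rewrite sqrtr_gt0.
have qE : d%:R = q ^+ 2 by rewrite sqr_sqrtr// ltW.
have [C1 C10 H1] := gen_near_far d_gt0 sU.
have [C2 C20 H2] := gen_dev_ge d_gt0 sU.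
(* The smallest radius allowed by [gen_dev_ge]. It turns the lower bound for D into g^3 / (192 A),
   and the oscillation term of [gen_near_far] into g / 2. *)
pose rho := 8 * q * A / g; have r0 : 0 < rho by rewrite divr_gt0// !mulr_gt0.
(* Makes the term of [gen_near_far] with rho / theta equal to g / 5, at the cost g^2 theta D = 40 d
   A D. *)
pose theta := 40 * d%:R * A / g ^+ 2.
have th0 : 0 < theta by rewrite divr_gt0 ?exprn_gt0// !mulr_gt0.
have g2 : 0 < g ^+ 2 by rewrite exprn_gt0.
pose h0 : R := Num.min (Num.min rho (6 * rho)^-1) (Num.min 1 (g ^+ 2 / 8 / (1 + C2))).
exists h0; first by rewrite !lt_min r0 invr_gt0 ltr01 mulr_gt0//= !divr_gt0//; lra.
exists (g ^+ 2 * (C1 * rho)) => [|h N hp].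
  by apply: mulr_gt0 => //; apply: mulr_gt0.
rewrite !le_min => /andP[/andP[hr hr6] /andP[h1 hC]] bN.
have hr1 : 6 * rho * h <= 1 by move: hr6; rewrite -div1r ler_pdivlMr; [lra|apply: mulr_gt0].
have Ch : C2 * h ^+ 2 <= (\sum_i pd i U x ^+ 2) / 8.
  rewrite -gE; move: hC; rewrite ler_pdivlMr; last exact: addr_gt0.
  move=> hC; apply: le_trans hC.
  have : 0 <= C2 * (h * (1 - h)) by rewrite !mulr_ge0 ?subr_ge0// ltW.
  by rewrite expr2; lra.
have Ar : 64 * d%:R * A ^+ 2 <= rho ^+ 2 * \sum_i pd i U x ^+ 2.
  by rewrite -gE /rho qE le_eqVlt; apply/orP; left; apply/eqP; field; rewrite gt_eqF.
have := H1 h N x rho theta m A r0 hp hr hr1 bN th0 Um.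
have := H2 h N x rho m A r0 hp hr hr1 bN Um Ar Ch.
have m2 : 2 * A <= m.
  apply: le_trans Am; apply: ler_wpM2r; first exact: ltW.
  by clear - d1; lra.
have := grad_form_le d_gt0 N hp sU Um m2 Vmax.
rewrite -gE; set D := gen h N (dev U x) x; set L := \sum_j _ => F1 F2 F3.
have {}F3 : gen h N U x <= theta * D + g / 5 + g / 2 + C1 * rho * h.
  apply: (le_trans (ler_norm _)); apply: (le_trans F3).
  have e1 : 2 * q * rho / (2 * theta) = g / 5.
    by rewrite /rho /theta qE; field; rewrite !gt_eqF.
  have e2 : 2 * (2 * q) * A / rho = g / 2.
    by rewrite /rho; field; rewrite !gt_eqF.
  by rewrite -/q e1 e2.
have {}F2 : g ^+ 3 <= 192 * (A * D).
  have -> : g ^+ 3 = 192 * A * (2 * q * g ^+ 2 / (48 * rho)).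
    by rewrite /rho; field; rewrite !gt_eqF.
  by rewrite [192 * (A * D)]mulrA (ler_pM2l (mulr_gt0 (ltr0Sn R 191) A0)).
have F4 : g ^+ 2 * gen h N U x <= g ^+ 2 * (theta * D + g / 5 + g / 2 + C1 * rho * h).
  by rewrite ler_pM2l.
have E4 : g ^+ 2 * (theta * D + g / 5 + g / 2 + C1 * rho * h) =
   40 * d%:R * (A * D) + (7 / 10) * g ^+ 3 + g ^+ 2 * (C1 * rho) * h.
  by rewrite /theta; field; rewrite gt_eqF.
rewrite {}E4 in F4.
have g3 : 0 < g ^+ 3 by rewrite exprn_gt0.
have AD : 0 <= A * D by clear - F2 g3; lra.
have D0 : 0 <= D by move: AD; rewrite pmulr_rge0.
have m0 : 0 <= m by apply: le_trans m2; rewrite mulr_ge0// ltW.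
have I1 : m * g ^+ 3 / (8 * 192 * A) <= m / 8 * D.
  rewrite ler_pdivrMr; last by rewrite !mulr_gt0.
  have -> : m / 8 * D * (8 * 192 * A) = m * (192 * (A * D)) by field.
  exact: ler_wpM2l.
(* Up to O(h), g^2 L_h u is at most 40 d A D + (7/10) g^3 with g^3 <= 192 A D, hence at most 200 d A
   D. The assumption on A bounds this by half of the dissipation (m / 4) D, whence 1600 = 8 times
   200. *)
have I2 : 200 * d%:R * (A * D) <= m / 8 * D.
  have -> : 200 * d%:R * (A * D) = 1600 * d%:R * A / 8 * D by field.
  by apply: ler_wpM2r => //; rewrite ler_pM2r.
have I3 : A * D <= d%:R * (A * D) by rewrite ler_peMl.
move: F1 F4 I1 I2 I3 F2 AD.
move: (m * g ^+ 3 / (8 * 192 * A)) (g ^+ 2 * gen h N U x) (g ^+ 2 * (C1 * rho) * h) => a1 a2 a3.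
have -> : m / 4 * D = 2 * (m / 8 * D) by field.
rewrite -!mulrA; move: (m * (8^-1 * D)) (A * D) (g ^+ 3) => a4 a5 a6; clear; move: (d%:R * a5) => a7.
lra.
Qed.

(** The formal j-th derivative of [rhs]. That it is the actual one follows only through the smooth
    approximations [rhsh], in [rhs_increment]. *)
Definition drhs j U x : R := U x * absnabla (pd j U) x + pd j U x * absnabla U x
  - absnabla (fun y => 2 * (U y * pd j U y)) x.

Lemma drhs_approx U : smoothT U -> exists2 C, 0 < C & forall j h N x, 0 < h ->
  bcoef N <= h ^+ 2 -> `|pd j (rhsh h N U) x - drhs j U x| <= C * h.
Proof.
move=> sU; apply: (common_bound (P := fun j C => forall h N x, 0 < h ->
  bcoef N <= h ^+ 2 -> `|pd j (rhsh h N U) x - drhs j U x| <= C * h)).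
  move=> j a b ab H h N x h0 bN; apply: (le_trans (H h N x h0 bN)).
  by rewrite ler_pM2r.
move=> j; have sj : smoothT (pd j U) by exact: smoothT_pd.
have s2 : smoothT (fun y => 2 * (U y * pd j U y)) by apply/smoothTZ/smoothTM.
have [C1 C10 H1] := gen_absnabla d_gt0 sU.
have [C2 C20 H2] := gen_absnabla d_gt0 sj.
have [C3 C30 H3] := gen_absnabla d_gt0 s2.
have [K1 K10 HK1] := periodic_bounded (smoothT_continuous sU) (smoothT_periodic sU).
have [K2 K20 HK2] := periodic_bounded (smoothT_continuous sj) (smoothT_periodic sj).
exists (C3 + (K1 * C2 + K2 * C1)) => [|h N x h0 bN].
  by rewrite !addr_gt0 ?mulr_gt0.
rewrite pd_rhsh// /drhs.
have -> : gen h N (fun y => 2 * (U y * pd j U y)) x -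
    (pd j U x * gen h N U x + U x * gen h N (pd j U) x) -
    (U x * absnabla (pd j U) x + pd j U x * absnabla U x -
     absnabla (fun y => 2 * (U y * pd j U y)) x) =
  (gen h N (fun y => 2 * (U y * pd j U y)) x + absnabla (fun y => 2 * (U y * pd j U y)) x)
  - (U x * (gen h N (pd j U) x + absnabla (pd j U) x) + pd j U x * (gen h N U x + absnabla U x)).
  move: (gen _ _ _ _) (gen _ _ _ _) (gen _ _ _ _) (absnabla _ _) (absnabla _ _) (absnabla _ _).
  by move=> *; ring.
apply: (le_trans (ler_normB _ _)); rewrite mulrDl; apply: lerD; first exact: H3.
apply: (le_trans (ler_normD _ _)); rewrite mulrDl -!mulrA !normrM.
by apply: lerD; apply: ler_pM => //; [exact: H2|exact: H1].
Qed.

Lemma gradient_rate U x (m A g : R) : smoothT U -> 0 < A ->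
  (forall y, m <= U y <= m + A) -> 1600 * d%:R * A <= m ->
  (forall y, \sum_i pd i U y ^+ 2 <= \sum_i pd i U x ^+ 2) ->
  0 < g -> g ^+ 2 = \sum_i pd i U x ^+ 2 ->
  \sum_j pd j U x * drhs j U x <= - (m * g ^+ 3 / (8 * 192 * A)).
Proof.
move=> sU A0 Um Am Vmax g0 gE.
have [h0 h00 [C C0 H]] := gradient_rate_approx sU A0 Um Am Vmax g0 gE.
have [C1 C10 H1] := drhs_approx sU.
apply: (@le_small _ _ _ (C + (\sum_j `|pd j U x|) * C1) h0 h00) => h hp hh.
have [N bN] := exists_bcoef (exprn_gt0 2 hp).
have B := H h N hp hh bN.
suff : \sum_j pd j U x * drhs j U x - \sum_j pd j U x * pd j (rhsh h N U) x <=
    (\sum_j `|pd j U x|) * (C1 * h).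
  move: B; move: (\sum_j _) (\sum_j _) (\sum_j _) (m * _ / _) => s1 s2 s3 s4; clear; lra.
rewrite -sumrB mulr_suml; apply: ler_sum => j _.
rewrite -mulrBr; apply: (le_trans (ler_norm _)); rewrite normrM ler_wpM2l//.
by rewrite distrC H1.
Qed.

(** Uniform limit of the continuous functions - [gen h N f]. *)
Lemma absnabla_continuous f : smoothT f -> continuous (absnabla f).
Proof.
move=> sf; have [C C0 H] := gen_absnabla d_gt0 sf.
apply: continuous_eps => x eps eps0.
pose h := eps / (4 * C); have h0 : 0 < h by rewrite divr_gt0// mulr_gt0.
have [N bN] := exists_bcoef (exprn_gt0 2 h0).
have hE : C * h = eps / 4 by rewrite /h; field; rewrite gt_eqF.
have := continuous_near x (smoothT_continuous (smoothT_gen h N sf)) (divr_gt0 eps0 (ltr0n R 4)).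
apply: filterS => y /=.
have := H h N x h0 bN; have := H h N y h0 bN; rewrite hE.
rewrite !ler_norml !ltr_norml => /andP[a1 a2] /andP[a3 a4] /andP[a5 a6].
by apply/andP; split; lra.
Qed.

Lemma drhs_continuous j U : smoothT U -> continuous (drhs j U).
Proof.
move=> sU x; have sj : smoothT (pd j U) by exact: smoothT_pd.
have s2 : smoothT (fun y => 2 * (U y * pd j U y)) by apply/smoothTZ/smoothTM.
have c1 := smoothT_continuous sU (x := x); have c2 := smoothT_continuous sj (x := x).
have c3 := absnabla_continuous s2 (x := x).
have c4 := absnabla_continuous sU (x := x); have c5 := absnabla_continuous sj (x := x).
exact: (cvgB (cvgD (cvgM c1 c5) (cvgM c2 c4)) c3).
Qed.

(** The mean value theorem is applied to [rhsh], whose derivative is uniformly close to [drhs]; then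
    h tends to 0 at fixed r, and continuity of [drhs] absorbs the intermediate point. *)
Lemma rhs_increment j U x (eps : R) : smoothT U -> 0 < eps ->
  exists2 r0, 0 < r0 & forall r, 0 < r -> r < r0 ->
    `|rhs U (x + r *: e j) - rhs U x - r * drhs j U x| <= eps * r.
Proof.
move=> sU eps0.
have [C C0 H] := drhs_approx sU; have [C1 C10 H1] := rhsh_approx d_gt0 sU.
have cl : {for 0, continuous (fun t : R => drhs j U (x + t *: e j))}.
  apply: (@continuous_comp _ _ _ (fun t : R => x + t *: e j) (drhs j U)).
    apply: (@continuousD _ _ _ (fun=> x) (fun t : R => t *: e j)); first exact: cst_continuous.
    exact: scalel_continuous.
  exact: drhs_continuous.
have /cvgrPdist_le/(_ eps eps0) := cl; rewrite scale0r addr0.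
move=> /nbhs_ballP[r0 r00 Hr]; exists r0 => // r rp rr0.
apply: (@le_small _ _ _ (2 * C1 + r * C) 1 ltr01) => h h0 _.
have [N bN] := exists_bcoef (exprn_gt0 2 h0).
have sh : smoothT (rhsh h N U).
  by apply: smoothTB; [exact/smoothT_gen/smoothTX2|apply: smoothTM => //; exact: smoothT_gen].
have [||c /andP[c0 cr]] := @line_mean_value R d (rhsh h N U) j x 0 r; [|exact: ltW|].
  by move=> y; exact: smoothT_derivable.
rewrite scale0r addr0 subr0 => E.
have B1 := H1 h N x h0 bN; have B2 := H1 h N (x + r *: e j) h0 bN.
have B3 := H j h N (x + c *: e j) h0 bN.
have B4 : `|drhs j U x - drhs j U (x + c *: e j)| <= eps.
  by apply: (Hr c); rewrite -ball_normE /= sub0r normrN ger0_norm//; exact: le_lt_trans rr0.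
rewrite (_ : rhs U (x + r *: e j) - rhs U x - r * drhs j U x =
  (rhs U (x + r *: e j) - rhsh h N U (x + r *: e j)) - (rhs U x - rhsh h N U x)
  + r * ((pd j (rhsh h N U) (x + c *: e j) - drhs j U (x + c *: e j))
     - (drhs j U x - drhs j U (x + c *: e j)))); last first.
  have -> : r * ((pd j (rhsh h N U) (x + c *: e j) - drhs j U (x + c *: e j))
     - (drhs j U x - drhs j U (x + c *: e j))) = pd j (rhsh h N U) (x + c *: e j) * r - r * drhs j U x by ring.
  by rewrite -E; ring.
apply: (le_trans (ler_normD _ _)); rewrite normrM (gtr0_norm rp).
have := ler_wpM2l (ltW rp) (le_trans (ler_normB _ _) (lerD B3 B4)).
have := le_trans (ler_normB _ _) (lerD B2 B1).
lra.
Qed.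

End gradient_equation.

Section derive_approx.
Context {R : realType}.
Implicit Types (f : R -> R) (t l : R).

Lemma derive_approx f t l : is_derive t (1 : R) f l -> forall eps, 0 < eps ->
  exists2 del, 0 < del & forall s, `|s - t| < del ->
    `|f s - f t - (s - t) * l| <= eps * `|s - t|.
Proof.
move=> D eps eps0.
have := @ex_derive _ _ _ _ _ _ _ D; rewrite /derivable => /cvg_ex[l' Hl].
have El : l' = l by rewrite -(@derive_val _ _ _ _ _ _ _ D) /derive; apply/esym/cvg_lim.
rewrite El in Hl.
have /cvgrPdist_le/(_ eps eps0) := Hl.
move=> /nbhs_ballP[del del0 H]; exists del => // s st.
have [->|ne] := eqVneq s t; first by rewrite !subrr mul0r subrr normr0 mulr0.
have st0 : s - t != 0 by rewrite subr_eq0.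
have := H (s - t); rewrite -ball_normE /= sub0r normrN => /(_ st st0).
rewrite [_ *: 1]mulr1 subrK /GRing.scale/= => B.
have -> : f s - f t - (s - t) * l = - ((s - t) * (l - (s - t)^-1 * (f s - f t))).
  by field.
by rewrite normrN normrM mulrC ler_pM2r ?normr_gt0.
Qed.

Lemma approx_derive f t l : (forall eps, 0 < eps -> exists2 del, 0 < del &
    forall s, `|s - t| < del -> `|f s - f t - (s - t) * l| <= eps * `|s - t|) ->
  is_derive t (1 : R) f l.
Proof.
move=> H.
have Hl : (fun h => h^-1 *: (f (h *: 1 + t) - f t)) @ (0 : R)^' --> l.
  apply/cvgrPdist_le => eps eps0; have [del del0 Hd] := H eps eps0.
  apply/nbhs_ballP; exists del => // h; rewrite -ball_normE /= sub0r normrN => hd h0.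
  have := Hd (h + t); rewrite addrK => /(_ hd) B.
  rewrite [h *: 1]mulr1 /GRing.scale/= -(ler_pM2r (_ : 0 < `|h|)) ?normr_gt0//.
  rewrite -normrM; apply: le_trans B; rewrite -normrN le_eqVlt; apply/orP; left; apply/eqP.
  by congr `|_|; field.
apply: DeriveDef; first by rewrite /derivable; apply/cvg_ex; exists l.
exact: cvg_lim Hl.
Qed.

Lemma derf_sum (I : Type) (r : seq I) (F : I -> R -> R) (F' : I -> R) x :
  (forall i, is_derive x (1 : R) (F i) (F' i)) ->
  is_derive x (1 : R) (fun z => \sum_(i <- r) F i z) (\sum_(i <- r) F' i).
Proof.
move=> H; elim: r => [|i r IH].
  rewrite (_ : (fun z => _) = (fun=> 0)); first by rewrite big_nil; exact: derf_cst.
  by apply/funext => z; rewrite big_nil.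
rewrite (_ : (fun z => _) = (fun z => F i z + \sum_(j <- r) F j z)).
  by rewrite big_cons; exact: derfD.
by apply/funext => z; rewrite big_cons.
Qed.

End derive_approx.

(** * Time derivative and exponential decay of the gradient *)

Section gradient_decay.
Context {R : realType} {d : nat}.
Local Notation V := 'rV[R]_d.
Local Notation e := (@basis_vec R d).
Implicit Types (f g U : V -> R) (x y z : V) (i j : 'I_d) (h r : R) (u : R -> V -> R).
Hypothesis d_gt0 : (0 < d)%N.

(** Interchange of the time and space derivatives. For u s - u t, the derivative along e_j is
    replaced by a difference quotient of step r at a cost K |s - t| r, by the Lipschitz bound on
    second derivatives; the equation is then used at the two points x and x + r e_j, and
    [rhs_increment] compares their right-hand sides. *)
Lemma flow_pd_derive u (t : R) x j : flow u -> 0 < t ->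
  is_derive t (1 : R) (fun s => pd j (u s) x) (drhs j (u t) x).
Proof.
move=> fu t0; apply: approx_derive => eps eps0.
have [del del0 [K K0 HK]] := flow_lip_near fu t0.
have sut := flow_smooth fu t0.
have e4 : 0 < eps / 4 by rewrite divr_gt0.
have [r0 r00 Hr] := rhs_increment d_gt0 j x sut e4.
(* The step depends on [eps] but not on [s]; the time neighbourhood is chosen afterwards, with
   precision eps r / 8 at both points. The errors add up to at most 3/4 of [eps]. *)
pose r := Num.min (r0 / 2) (eps / (4 * K)).
have rp : 0 < r by rewrite lt_min !divr_gt0// mulr_gt0.
have rr0 : r < r0 by rewrite gt_min ltr_pdivrMr// ltr_pMr// ltr1n.
have rK : r * (4 * K) <= eps by rewrite -ler_pdivlMr ?mulr_gt0// ge_min lexx orbT.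
have er : 0 < eps * r / 8 by rewrite divr_gt0// mulr_gt0.
have [del1 del10 H1] := derive_approx (flow_eq fu x t0) er.
have [del2 del20 H2] := derive_approx (flow_eq fu (x + r *: e j) t0) er.
exists (Num.min del (Num.min del1 del2)); first by rewrite !lt_min del0 del10.
move=> s; rewrite !lt_min => /and3P[sd s1 s2].
have [sp _] := HK s [::] x isT sd.
have sus := flow_smooth fu sp.
have E1 y : pd j (fun y => u s y - u t y) y = pd j (u s) y - pd j (u t) y by rewrite pdB.
have sq : smoothT (fun y => u s y - u t y) by exact: smoothTB.
have [||c /andP[c0 cr]] := @line_mean_value R d (fun y => u s y - u t y) j x 0 r; [|exact: ltW|].
  by move=> y; exact: smoothT_derivable.
have [||c' _] := @line_mean_value R d (pd j (fun y => u s y - u t y)) j x 0 c; [|exact: c0|].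
  by move=> y; apply: smoothT_derivable; exact: smoothT_pd.
rewrite !scale0r !addr0 !subr0 => E2 E3.
have E4 : `|pd j (pd j (fun y => u s y - u t y)) (x + c' *: e j)| <= K * `|s - t|.
  have -> : pd j (fun y => u s y - u t y) = (fun y => pd j (u s) y - pd j (u t) y) by exact/funext.
  rewrite pdB; [|exact: smoothT_pd|exact: smoothT_pd].
  by rewrite distrC; have [_] := HK s [:: j; j] (x + c' *: e j) isT sd.
have := H1 s s1; have := H2 s s2; have := Hr r rp rr0.
rewrite E1 in E2 E3; rewrite -[pd j (u s) x - pd j (u t) x]E1 in E2 *.
set P := pd j _ x in E2 *; set P' := pd j (u s) (x + c *: e j) - _ in E2 E3.
move=> B3 B2 B1.
have B4 : `|P' - P| <= K * `|s - t| * r.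
  by rewrite E2 normrM ler_pM// ger0_norm.
rewrite -(ler_pM2r rp) -{1}(gtr0_norm rp) -normrM.
rewrite (_ : (P - (s - t) * drhs j (u t) x) * r = - ((P' - P) * r)
  + (u s (x + r *: e j) - u t (x + r *: e j) - (s - t) * rhs (u t) (x + r *: e j))
  - (u s x - u t x - (s - t) * rhs (u t) x)
  + (s - t) * (rhs (u t) (x + r *: e j) - rhs (u t) x - r * drhs j (u t) x)); last first.
  have -> : - ((P' - P) * r) = P * r - P' * r by ring.
  by rewrite -E3; ring.
apply: (le_trans (ler_normD _ _)); apply: (le_trans (lerD (ler_normB _ _) (lexx _))).
apply: (le_trans (lerD (lerD (ler_normD _ _) (lexx _)) (lexx _))).
rewrite normrN !normrM (gtr0_norm rp).
have S0 : 0 <= `|s - t| by [].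
have := ler_wpM2l S0 B3; have := ler_wpM2r (ltW rp) B4.
have : K * `|s - t| * r * r <= eps / 4 * (`|s - t| * r).
  have -> : K * `|s - t| * r * r = r * (4 * K) / 4 * (`|s - t| * r) by field.
  by apply: ler_wpM2r; [rewrite mulr_ge0// ltW|rewrite ler_pM2r].
have S1 : 0 <= eps * r * `|s - t| by apply: mulr_ge0 => //; apply: mulr_ge0; exact: ltW.
move: S1 B1 B2; clear; lra.
Qed.

Definition sqgradient U x : R := \sum_i pd i U x ^+ 2.

Lemma sqgradient_cper U : smoothT U -> cper (sqgradient U).
Proof.
move=> sU; apply: smoothT_cper; apply: smoothT_sum => i.
by apply: smoothTX2; exact: smoothT_pd.
Qed.

Lemma flow_sqgradient_continuous u (t : R) : flow u -> 0 < t ->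
  {for t, continuous (fun s => pmax (sqgradient (u s)))}.
Proof.
move=> fu t0; have [del del0 [K K0 HK]] := flow_lip_near fu t0.
have sut := flow_smooth fu t0.
have [M M0 HM] : exists2 M, 0 < M & forall i, forall x, `|pd i (u t) x| <= M.
  apply: (common_bound (P := fun i M => forall x, `|pd i (u t) x| <= M)).
    by move=> i a b ab H x; exact: le_trans ab.
  move=> i; have si := smoothT_pd i sut.
  exact: periodic_bounded (smoothT_continuous si) (smoothT_periodic si).
apply: (@pmax_continuous _ _ _ t (Num.min del 1) (d%:R * (K * (2 * M + K)))).
- by rewrite lt_min del0 ltr01.
- move=> s; rewrite lt_min => /andP[sd _]; apply: sqgradient_cper.
  by apply: (flow_smooth fu); have [] := HK s [::] 0 isT sd.
- move=> s x; rewrite lt_min => /andP[sd s1].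
  rewrite /sqgradient -sumrB; apply: (le_trans (ler_norm_sum _ _ _)).
  apply: (@le_trans _ _ (\sum_(i < d) K * (2 * M + K) * `|s - t|)); last first.
    by rewrite sumr_const card_ord -[_ *+ d]mulr_natl !mulrA.
  apply: ler_sum => i _; have [_ B] := HK s [:: i] x isT sd.
  have {}B : `|pd i (u t) x - pd i (u s) x| <= K * `|s - t| by exact: B.
  have Bt := HM i x; move: (pd i (u t) x) (pd i (u s) x) B Bt => p q B Bt.
  rewrite subr_sqr normrM mulrAC; apply: ler_pM => //.
  have -> : p + q = 2 * p - (p - q) by ring.
  apply: (le_trans (ler_normB _ _)); rewrite normrM (gtr0_norm (ltr0Sn R 1)); apply: lerD.
    by rewrite ler_pM2l.
  by apply: (le_trans B); rewrite ger_pMr// ltW.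
Qed.

(** With V the largest squared gradient and A the exponential bound for the amplitude, V decreases
    at rate at least a multiple of m V^(3/2) / A. When sqrt V exceeds a large multiple of A, this is
    at least 2 gamma V, the decay rate of the squared barrier. *)
Lemma gradient_decay u (m T0 : R) : flow u -> 0 < m -> 0 < T0 ->
  (forall t x, T0 <= t -> m <= u t x) ->
  exists C gamma T1 : R, [/\ 0 < C, 0 < gamma &
    forall t x, T1 <= t -> sqgradient (u t) x <= (C * expR (- gamma * t)) ^+ 2].
Proof.
move=> fu m0 T00 mu_.
have d0 : 0 < d%:R :> R by rewrite ltr0n.
have [C [gamma [C0 g0 amp]]] := amplitude_decay d_gt0 fu m0 T00 mu_.
(* From this time on the amplitude satisfies the smallness condition of [gradient_rate], by exp x >=
   1 + x. *)
pose T1 := T0 + 1600 * d%:R * C / (m * gamma).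
have k0 : 0 <= 1600 * d%:R * C / (m * gamma).
  apply: divr_ge0; last by rewrite mulr_ge0// ltW.
  by apply: mulr_ge0; [apply: mulr_ge0; [exact: ler0n|exact: ltW]|exact: ltW].
have T01 : T0 <= T1 by rewrite lerDl.
have T1p : 0 < T1 by exact: lt_le_trans T01.
have small t : T1 <= t -> 1600 * d%:R * (C * expR (- gamma * t)) <= m.
  move=> T1t; rewrite mulNr expRN mulrA ler_pdivrMr ?expR_gt0//.
  have : 1600 * d%:R * C / (m * gamma) <= t by apply: le_trans T1t; rewrite /T1 lerDr ltW.
  rewrite ler_pdivrMr ?mulr_gt0// => H; apply: (le_trans H).
  rewrite mulrCA ler_pM2l// mulrC; apply: le_trans (expR_ge1Dx _).
  by rewrite lerDr.
pose G t := pmax (sqgradient (u t)).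
have Gp t : 0 < t -> 0 <= G t.
  move=> t0; rewrite /G; have [x [_ <- _]] := pmaxP (sqgradient_cper (flow_smooth fu t0)).
  by apply: sumr_ge0 => i _; exact: sqr_ge0.
(* The first summand ensures m g >= 8 * 192 * gamma * A as soon as [g] is above the barrier, with a
   factor 2 to spare; the second puts the barrier above the gradient at time [T1]. *)
pose C1 := 16 * 192 * gamma * C / m + (1 + G T1) * expR (gamma * T1).
have GT1 := Gp T1 T1p.
have p1 : 0 <= 16 * 192 * gamma * C / m.
  by apply: divr_ge0; [rewrite !mulr_ge0// ltW|exact: ltW].
have p2 : 0 < (1 + G T1) * expR (gamma * T1) by rewrite mulr_gt0 ?expR_gt0// ltr_pwDl.
have C10 : 0 < C1 by exact: ltr_wpDl.
have sqE t : (C1 * expR (- gamma * t)) ^+ 2 = C1 ^+ 2 * expR (- (2 * gamma) * t).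
  by rewrite exprMn -expRM_natl; congr (_ * expR _); ring.
suff main t : T1 <= t -> G t - C1 ^+ 2 * expR (- (2 * gamma) * t) <= 0.
  exists C1, gamma, T1; split=> // t x T1t; rewrite sqE.
  have [_ [_ _ h]] := pmaxP (sqgradient_cper (flow_smooth fu (lt_le_trans T1p T1t))).
  by apply: (le_trans (h x)); rewrite -subr_le0; exact: main.
move=> T1t; apply: (@touching_le0 R (fun s => G s - C1 ^+ 2 * expR (- (2 * gamma) * s)) T1 t T1t).
- move=> s /andP[s1 _]; have sp : 0 < s by exact: lt_le_trans s1.
  apply: (@continuousB _ _ _ G (fun s => C1 ^+ 2 * expR (- (2 * gamma) * s))); last exact: continuous_expR_lin.
  exact: flow_sqgradient_continuous.
- rewrite -sqE subr_le0; apply: (@le_trans _ _ ((1 + G T1) ^+ 2)); first by nra.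
  apply: lerXn2r; rewrite ?nnegrE; [exact: addr_ge0|by rewrite mulr_ge0 ?expR_ge0// ltW|].
  rewrite mulNr expRN ler_pdivlMr ?expR_gt0//; exact: ler_wpDl.
- move=> s T1s st gs; have sp : 0 < s by exact: lt_trans T1s.
  have sus := flow_smooth fu sp.
  have [x [_ Ex Hx]] := pmaxP (sqgradient_cper sus).
  rewrite -/(G s) in Ex Hx.
  pose A := C * expR (- gamma * s); pose B := C1 * expR (- gamma * s).
  have A0 : 0 < A by rewrite mulr_gt0 ?expR_gt0.
  have B0 : 0 < B by rewrite mulr_gt0 ?expR_gt0.
  have BG : B ^+ 2 < G s by move: gs; rewrite -sqE subr_gt0.
  pose g := Num.sqrt (G s).
  have gE : g ^+ 2 = G s by rewrite sqr_sqrtr// Gp.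
  have gp : 0 < g by rewrite sqrtr_gt0; apply: lt_trans BG; rewrite exprn_gt0.
  have Bg : B <= g by rewrite -(@ler_pXn2r _ 2)// ?nnegrE ?gE//; exact: ltW.
  have [z [_ Ez Hz]] := pmaxP (cperN (smoothT_cper sus)).
  have uz y : u s z <= u s y by have := Hz y; rewrite -Ez lerN2.
  have Ua y : u s z <= u s y <= u s z + A.
    by rewrite uz -lerBlDl; exact: amp (le_trans T01 (ltW T1s)).
  have mz : m <= u s z by apply: mu_; exact: le_trans (ltW T1s).
  have Vmax y : sqgradient (u s) y <= sqgradient (u s) x by rewrite Ex.
  have rate := gradient_rate d_gt0 sus A0 Ua (le_trans (small s (ltW T1s)) mz) Vmax gp (etrans gE (esym Ex)).
  exists (fun r => 2 * (\sum_j pd j (u s) x * pd j (u r) x) - C1 ^+ 2 * expR (- (2 * gamma) * r)).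
  exists (2 * (\sum_j pd j (u s) x * drhs j (u s) x) - - (2 * gamma) * (C1 ^+ 2 * expR (- (2 * gamma) * s))).
  split.
  + apply: (@derfB _ (fun r => 2 * (\sum_j pd j (u s) x * pd j (u r) x))); last exact: is_derive_expR_lin.
    apply: derfZ; apply: derf_sum => j; apply: derfZ; exact: flow_pd_derive.
  + rewrite -sqE -/B.
    have r1 : m * g ^+ 3 / (8 * 192 * A) <= u s z * g ^+ 3 / (8 * 192 * A).
      apply: ler_wpM2r; first by rewrite invr_ge0 !mulr_ge0// ltW.
      by apply: ler_wpM2r => //; rewrite exprn_ge0// ltW.
    have r2 : 16 * 192 * gamma * A <= m * B.
      rewrite /A /B !mulrA; apply: ler_wpM2r; first exact: expR_ge0.
      rewrite -ler_pdivrMl// mulrC /C1; apply: ler_wpDr => //; exact: ltW.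
    have r3 : gamma * g ^+ 2 <= m * g ^+ 3 / (8 * 192 * A).
      rewrite ler_pdivlMr; last by apply: mulr_gt0 => //; apply: mulr_gt0.
      have -> : m * g ^+ 3 = m * g * g ^+ 2 by ring.
      have : 8 * 192 * gamma * A <= m * g.
        apply: le_trans (ler_wpM2l (ltW m0) Bg); apply: le_trans r2.
        by apply: ler_wpM2r; [exact: ltW|apply: ler_wpM2r; [exact: ltW|rewrite ler_wpM2r// ler_nat]].
      move=> /(ler_wpM2r (sqr_ge0 g)); apply: le_trans; rewrite le_eqVlt; apply/orP; left; apply/eqP; ring.
    have r4 : gamma * B ^+ 2 <= gamma * g ^+ 2 by rewrite ler_pM2l// gE ltW.
    move: rate r1 r3 r4; move: (u s z * _ / _) (m * _ / _) => a1 a2.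
    move: (\sum_j _) (gamma * g ^+ 2) => a3 a4; clear.
    rewrite mulNr opprK -mulrA; move: (gamma * B ^+ 2) => a5; lra.
  + move=> r T1r rs; have rp : 0 < r by exact: lt_le_trans T1r.
    have [_ [_ _ h]] := pmaxP (sqgradient_cper (flow_smooth fu rp)).
    suff : sqgradient (u s) x - sqgradient (u r) x <=
        2 * (\sum_j pd j (u s) x * pd j (u s) x) - 2 * (\sum_j pd j (u s) x * pd j (u r) x).
      move: (h x); rewrite -Ex /G; move: (pmax _) (sqgradient _ _) (sqgradient _ _) => a1 a2 a3.
      move: (\sum_j _) (\sum_j _) (C1 ^+ 2 * _) (C1 ^+ 2 * _) => a4 a5 a6 a7 /=.
      by clear; lra.
    rewrite /sqgradient -sumrB -mulrBr -sumrB mulr_sumr; apply: ler_sum => i _.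
    have := sqr_ge0 (pd i (u s) x - pd i (u r) x).
    move: (pd i (u s) x) (pd i (u r) x) => p q; clear; nra.
Qed.

End gradient_decay.

(** * Translation into essential bounds and norms, and the conclusion *)

Section extrema.
Context {R : realType} {d : nat}.
Local Notation V := 'rV[R]_d.
Local Notation mu := (torus_measure d : set V -> \bar R).
Implicit Types (f U : V -> R) (x y : V) (u : R -> V -> R).

Definition pmin f : R := - pmax (fun x => - f x).

Lemma pminP f : cper f -> (exists x, f x = pmin f) /\ forall y, pmin f <= f y.
Proof.
move=> cf; have [x [_ E H]] := pmaxP (cperN cf).
split=> [|y]; first by exists x; rewrite /pmin -E opprK.
by rewrite /pmin; have := H y; lra.
Qed.

Lemma umax_pmax (u0 : V -> R) u (t : R) : 0 < t -> cper (u t) -> umax u0 u t = (pmax (u t))%:E.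
Proof.
move=> t0 cu; rewrite /umax gt_eqF//; have [x [_ E H]] := pmaxP cu.
apply/eqP; rewrite eq_le; apply/andP; split; last by rewrite -E; apply: ereal_sup_ubound; exists x.
by apply: ge_ereal_sup => _ [y _ <-]; rewrite lee_fin.
Qed.

Lemma umin_pmin (u0 : V -> R) u (t : R) : 0 < t -> cper (u t) -> umin u0 u t = (pmin (u t))%:E.
Proof.
move=> t0 cu; rewrite /umin gt_eqF//; have [[x E] H] := pminP cu.
apply/eqP; rewrite eq_le; apply/andP; split; first by rewrite -E; apply: ereal_inf_lbound; exists x.
by apply: le_ereal_inf_tmp => _ [y _ <-]; rewrite lee_fin.
Qed.

Lemma enorm_gradient U x : enorm (gradient U x) = Num.sqrt (sqgradient U x).
Proof.
rewrite /enorm /dot /sqgradient; congr Num.sqrt; apply: eq_bigr => i _.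
by rewrite !mxE -expr2.
Qed.

Lemma Lnorm_oo_le f (C : R) : 0 <= C -> (forall x, `|f x| <= C) ->
  (Lnorm mu +oo%E (EFin \o f) <= C%:E)%E.
Proof.
move=> C0 fC; rewrite unlock /=; case: ifPn => _; last by rewrite lee_fin.
by apply/ess_supP; apply: nearW => x /=; rewrite lee_fin.
Qed.

End extrema.

Unset Implicit Arguments.

Theorem theorem3p2 (R : realType) (d : nat) (hd : (1 <= d)%N)
    (c : R) (hc : @is_kernel_constant R d c)
    (B : nat -> R -> R -> R -> R -> R)
    (u0 : 'rV[R]_d -> R)
    (hu0_periodic : torus_periodic u0) (hu0 : Linfty u0)
    (hu0_pos : (0 < ess_inf (torus_measure d) (EFin \o u0))%E)
    (u : R -> 'rV[R]_d -> R)
    (hu_weak : weak_solution c u0 u)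
    (hu : regular_solution B u0 u) :
  [/\ forall s t : R, 0 <= s -> s <= t -> (umin u0 u s <= umin u0 u t)%E,
      forall s t : R, 0 <= s -> s <= t -> (umax u0 u t <= umax u0 u s)%E,
      decays_exponentially (amplitude u0 u),
      decays_exponentially (gradient_Linfty u) &
      exists a : R, decays_exponentially (fun t => uniform_dist (u t) a)].
Proof.
have fu : flow u := regular_solution_flow hu.
have [f0 [f1 _]] := ess_inf_fin hu0 hu0_pos.
pose k0 := fine (ess_inf (torus_measure d) (EFin \o u0)).
have k0_gt0 : 0 < k0 := ess_inf_gt0 hu0 hu0_pos.
have lower t x : 0 < t -> k0 <= u t x := @ess_inf_le_flow R d hd B u0 u hu0 hu0_pos hu t x.
have upper t x : 0 < t -> u t x <= fine (ess_sup (torus_measure d) (EFin \o u0)) :=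
  @ess_sup_ge_flow R d hd B u0 u hu0 hu0_pos hu t x.
have cu t : 0 < t -> cper (u t) := flow_cper fu.
have pos t x : 0 < t -> 0 <= u t x by move=> /(lower t x); apply: le_trans; exact: ltW.
have minP s t x : 0 < s -> s <= t -> pmin (u s) <= u t x.
  move=> s0 st; have [[y E] H] := pminP (cu s s0).
  apply: (flow_lower hd fu _ s0 st) => //; rewrite -E.
  exact: lt_le_trans (lower s y s0).
have maxP s t x : 0 < s -> s <= t -> u t x <= pmax (u s).
  move=> s0 st; have [y [_ E H]] := pmaxP (cu s s0).
  apply: (flow_upper hd fu _ s0 st) => //; first by rewrite -E; exact: pos.
  by move=> r z /andP[sr _]; apply: pos; exact: lt_le_trans sr.
have k1 : forall t x, 1 <= t -> k0 <= u t x.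
  by move=> t x t1; apply: lower; exact: lt_le_trans t1.
have [C [gamma [C0 g0 amp]]] := amplitude_decay hd fu k0_gt0 ltr01 k1.
have near1 : \forall t \near +oo, 1 <= t :> R by exact: nbhs_pinfty_ge.
split.
- move=> s t s0 st; have [t0|t0] := leP t 0.
    by have -> : s = t by apply/eqP; rewrite eq_le st (le_trans t0 s0).
  rewrite (umin_pmin _ t0 (cu t t0)); have [[x <-] _] := pminP (cu t t0).
  have [sp|sp] := ltP 0 s; first by rewrite (umin_pmin _ sp (cu s sp)) lee_fin; exact: minP.
  have -> : s = 0 by apply/eqP; rewrite eq_le s0 sp.
  by rewrite /umin eqxx -(fineK f0) lee_fin; exact: lower.
- move=> s t s0 st; have [t0|t0] := leP t 0.
    by have -> : s = t by apply/eqP; rewrite eq_le st (le_trans t0 s0).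
  rewrite (umax_pmax _ t0 (cu t t0)); have [x [_ <- _]] := pmaxP (cu t t0).
  have [sp|sp] := ltP 0 s; first by rewrite (umax_pmax _ sp (cu s sp)) lee_fin; exact: maxP.
  have -> : s = 0 by apply/eqP; rewrite eq_le s0 sp.
  by rewrite /umax eqxx -(fineK f1) lee_fin; exact: upper.
- exists C, gamma; split=> //; apply: filterS near1 => t t1.
  have tp : 0 < t by exact: lt_le_trans t1.
  rewrite /amplitude (umax_pmax _ tp (cu t tp)) (umin_pmin _ tp (cu t tp)).
  have [x [_ <- _]] := pmaxP (cu t tp); have [[y <-] _] := pminP (cu t tp).
  by rewrite -EFinB lee_fin; exact: amp.
- have [C' [gamma' [T1 [C'0 g'0 H]]]] := gradient_decay hd fu k0_gt0 ltr01 k1.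
  exists C', gamma'; split=> //; have : \forall t \near +oo, T1 <= t :> R by exact: (nbhs_pinfty_ge (num_real _)).
  apply: filterS => t tT.
  have E0 : 0 <= C' * expR (- gamma' * t) by rewrite mulr_ge0 ?expR_ge0// ltW.
  apply: Lnorm_oo_le => // x; rewrite enorm_gradient ger0_norm ?sqrtr_ge0//.
  by rewrite -(ger0_norm E0) -sqrtr_sqr ler_wsqrtr// H.
(* The limit constant is the supremum of the increasing minima. It lies between minimum and maximum
   at every time from 1 on, so its distance to the solution is at most the amplitude. *)
- pose S := [set pmin (u s) | s in [set s | 1 <= s]].
  have ub t : 1 <= t -> ubound S (pmax (u t)).
    move=> t1 _ [s /= s1 <-].
    have sp : 0 < s by exact: lt_le_trans s1.
    have tp : 0 < t by exact: lt_le_trans t1.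
    (* A minimum and a maximum at different times are compared through the value at an arbitrary
       point at the later of the two times. *)
    by apply: (le_trans (minP s (Num.max s t) 0 sp _) (maxP t _ 0 tp _)); rewrite le_max lexx ?orbT.
  exists (sup S), C, gamma; split=> //; apply: filterS near1 => t t1.
  have tp : 0 < t by exact: lt_le_trans t1.
  have h1 : sup S <= pmax (u t).
    by apply: ge_sup (ub t t1); exists (pmin (u 1)), 1 => /=.
  have h2 : pmin (u t) <= sup S.
    by apply: ub_le_sup; [exists (pmax (u t)); exact: ub|exists t].
  apply: ge_ereal_sup => _ [x _ <-]; rewrite lee_fin.
  have [y [_ E1 _]] := pmaxP (cu t tp); have [[z E2] _] := pminP (cu t tp).
  rewrite -E1 in h1; rewrite -E2 in h2.
  have := amp t x z t1; have := amp t y x t1 => a1 a2.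
  by rewrite ler_norml; apply/andP; split; lra.
Qed.
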